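(* Let $B:\,]a,b[\,\times\mathbb{R}^{d}\to\mathbb{R}$ be a locally bounded function such that: (A1) for all $w\in\mathbb{R}^{d}$ the function $B(\cdot,w)$ belongs to $BV(]a,b[)$, and there exists a countable set $\mathcal N\subset\,]a,b[$ such that for every $w\in\mathbb{R}^{d}$ the jump set $\mathcal N_w:=J_{B(\cdot,w)}$ satisfies $\mathcal N_w\subseteq\mathcal N$; (A2) for every compact set $M\subseteq\mathbb{R}^{d}$ there exists a finite positive Borel measure $\mu_{M}$ on $]a,b[$ such that for every $w,w'\in M$ and every Borel set $A\subseteq\,]a,b[$ $$|(D_x B)(\cdot,w)-(D_x B)(\cdot,w')|(A)\leq |w-w'|\,\mu_{M}(A);$$ (A3) for all $x\in\,]a,b[\,\setminus\mathcal N$ the function $B(x,\cdot)$ belongs to $C^{1}(\mathbb{R}^{d})$ and, for every compact set $M\subset\mathbb{R}^d$, there exists a constant $D_M>0$ such that $$|(D_{w} B)(x,w)|\leq D_M\qquad\forall x\in\,]a,b[\,\setminus\mathcal N,\ \forall w\in M;$$ (A4) the function $(D_{w}B)(\cdot,w)$ belongs to $BV(]a,b[;\mathbb{R}^d)$ for every $w\in\mathbb{R}^{d}$; (A5) there exists a positive finite Cantor measure $\lambda$ on $]a,b[$ such that $(D^{c}_x B)(\cdot,w)\ll\lambda$ for every $w\in\mathbb{R}^d$. Then for every $u\in BV(]a,b[;\mathbb{R}^{d})$ the composite function $v(x):=B(x,u(x))$, $x\in\,]a,b[$, belongs to $BV(]a,b[)$ and for any $\phi\in C_0^1(]a,b[)$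 we have $$\begin{aligned} \int_{]a,b[}\phi'(x)\,v(x)\,dx={}&-\int_{]a,b[}\phi(x)\,(\nabla_x B)(x,u(x))\,dx-\int_{]a,b[}\phi(x)\,\psi(x,u(x))\,d\lambda\\ &-\int_{]a,b[}\phi(x)\,(D_{w}B)(x,u(x))\cdot\nabla u(x)\,dx\\ &-\int_{]a,b[}\phi(x)\,(D_{w}B)(x,u(x))\cdot dD^c u(x)\\ &-\sum_{x\in\mathcal N\cup J_u}\phi(x)\left[B(x_{+},u(x_{+}))-B(x_{-},u(x_{-}))\right], \end{aligned}$$ where for every $w\in\mathbb{R}^d$ the function $\psi(\cdot,w)$ is the Radon–Nikodým derivative of the measure $(D^{c}_x B)(\cdot,w)$ with respect to $\lambda$, i.e. $\psi(\cdot,w):=\dfrac{d(D^{c}_x B)(\cdot,w)}{d\lambda}$.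
   Context: $]a,b[$ is an open interval with $a<b$ real, and $d\geq 1$. BV functions. $BV(]a,b[;\mathbb{R}^d)$ is the space of $u\in L^1(]a,b[;\mathbb{R}^d)$ whose distributional derivative $Du$ is a finite ($\mathbb{R}^d$-valued) Radon measure; $BV(]a,b[)$ is the case $d=1$. One-sided limits are $u(x_-):=\lim_{\varepsilon\to0+}\frac1\varepsilon\int_{x-\varepsilon}^{x}u\,dy$ and $u(x_+):=\lim_{\varepsilon\to0+}\frac1\varepsilon\int_x^{x+\varepsilon}u\,dy$, which exist at every $x\in\,]a,b[$. The jump set is $J_u:=\{x\in\,]a,b[\,:u(x_-)\ne u(x_+)\}$ (at most countable). One has the decomposition $$Du=\nabla u\,dx+D^cu+(u(x_+)-u(x_-))\,\mathcal H^0\lfloor J_u,$$ where $\nabla u$ is the density of the absolutely continuous part with respect to Lebesgue measure, $\mathcal H^0$ is counting measure, and $D^cu$ is the Cantor part (the singular part without atoms). A good representative of $u$ is a function equal to $u$ a.e. whose value at every $x$ lies in the segment $\{\theta u(x_-)+(1-\theta)u(x_+):\theta\in[0,1]\}$. BV functions (in particular $u$ and $B(\cdot,w)$ for each $w$) are always taken to be good representatives; so they are continuous off their jump sets. A Cantor measure is a nonnegative Borel measure without atoms that is singular with respect to Lebesgue measure. For a (vector or signed) measure $\mu$, $|\mu|$ is its total variation measure; $\mu\ll\lambda$ denotes absolute continuity. For fixed $w$, $(D_xB)(\cdot,w)$ is the distributional derivative of $x\mapsto B(x,w)$, with decomposition $$(D_xB)(\cdot,w)=(\nabla_xB)(\cdot,w)\,dx+(D_x^cB)(\cdot,w)+\sum_{x\in\mathcal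 N_w}[B(x_+,w)-B(x_-,w)]\,\delta_x,$$ where $B(x_\pm,w)$ are the right and left limits of $B(\cdot,w)$ at $x$, so $B(x_+,u(x_+))$ is $B(x_+,w)$ evaluated at $w=u(x_+)$, and similarly with minus signs. $D_wB$ is the gradient in the second variable. The densities $(\nabla_xB)(x,w)$ and $\psi(x,w)$ are taken in versions that are continuous in $w$ for Lebesgue-a.e. $x$, respectively $\lambda$-a.e. $x$ (such versions exist thanks to (A2)). $C_0^1(]a,b[)$ denotes the continuously differentiable real functions with compact support in $]a,b[$. *)

(* Defs.v *)
From HB Require Import structures.
From mathcomp Require Export all_boot all_order all_algebra.
From mathcomp Require Export all_classical all_reals all_analysis.

Export Order.TTheory GRing.Theory Num.Theory.
Export numFieldNormedType.Exports.

#[export] Set Implicit Arguments.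
#[export] Unset Strict Implicit.
#[export] Unset Printing Implicit Defensive.

Global Open Scope classical_set_scope.
Global Open Scope ring_scope.

(* Finite signed Radon measures on ]a, b[ are represented by charges on the
   Borel sets of R that are concentrated on ]a, b[. *)
Notation signedR R := (charge (measurableTypeR R) R).
(* Lebesgue measure on the Borel sets of R. *)
Notation leb := lebesgue_measure.

Definition choose_or (T : Type) (x0 : T) (P : T -> Prop) : T :=
  if pselect (exists x, P x) is left h then projT1 (cid h) else x0.

(* Euclidean norm; the library norm on 'rV[R]_n is the sup norm. *)
Definition enorm (R : realType) (n : nat) (w : 'rV[R]_n) : R :=
  Num.sqrt (\sum_(i < n) w ord0 i ^+ 2).

Definition coord (R : realType) (n : nat) (i : 'I_n) (u : R -> 'rV[R]_n)
  : R -> R := fun x => u x ord0 i.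

Section SignedMeasures.
Variable R : realType.
Implicit Types nu : signedR R.

Definition hahn_pos nu : set (measurableTypeR R) :=
  projT1 (cid (Hahn_decomposition nu)).

Definition hahn_neg nu : set (measurableTypeR R) :=
  projT1 (cid (projT2 (cid (Hahn_decomposition nu)))).

Definition hahnP nu : hahn_decomposition nu (hahn_pos nu) (hahn_neg nu) :=
  projT2 (cid (projT2 (cid (Hahn_decomposition nu)))).

(* On Borel sets these do not depend on the Hahn decomposition chosen. *)
Definition tvar nu := charge_variation (hahnP nu).

Definition cintegral nu (D : set R) (f : R -> R) : R :=
  \int[jordan_pos (hahnP nu)]_(x in D) f x
  - \int[jordan_neg (hahnP nu)]_(x in D) f x.

Definition no_atoms (mu : set (measurableTypeR R) -> \bar R) : Prop :=
  forall x : R, mu [set x] = 0%E.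

Definition lebesgue_singular (mu : set (measurableTypeR R) -> \bar R) : Prop :=
  exists Z : set (measurableTypeR R),
    [/\ measurable Z, leb Z = 0%E & mu.-null_set (~` Z)].

(* f coincides mu-a.e. with a Borel function that is integrable, i.e. f is
   integrable with respect to the completion of mu. *)
Definition ae_integrable (mu : {measure set (measurableTypeR R) -> \bar R})
    (D : set R) (f : R -> R) : Prop :=
  exists g : R -> R, mu.-integrable D (EFin \o g) /\ f = g %[ae mu in D].

Definition rsummable (A : set R) (f : R -> R) : Prop :=
  summable A (EFin \o f).

(* The value of the sum is meaningful when rsummable A f. *)
Definition rsum (A : set R) (f : R -> R) : R :=
  fine (\esum_(x in A) (f^\+ x)%:E) - fine (\esum_(x in A) (f^\- x)%:E).

End SignedMeasures.

Section BV.
Variables (R : realType) (a b : R).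
Local Notation I := (`]a, b[%classic : set R).

(* Functions of C^1_c(]a, b[), extended by zero to R. *)
Definition C01 (phi : R -> R) : Prop :=
  [/\ forall x, derivable phi x 1, continuous (derive1 phi),
      compact (closure [set x | phi x != 0]) &
      closure [set x | phi x != 0] `<=` I].

(* Since nu is a finite measure, testing with C^1_c or with smooth functions
   of compact support is the same. *)
Definition is_distributional_derivative (u : R -> R) (nu : signedR R) : Prop :=
  nu.-null_set (~` I) /\
  forall phi, C01 phi ->
    \int[leb]_(x in I) (derive1 phi x * u x) = - cintegral nu I phi.

Definition BV (u : R -> R) : Prop :=
  leb.-integrable I (EFin \o u) /\
  exists nu : signedR R, is_distributional_derivative u nu.

(* A vector-valued measure is the tuple of its components; it is finite if and
   only if all its components are. *)
Definition BVv (n : nat) (u : R -> 'rV[R]_n) : Prop :=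
  forall i, BV (coord i u).

Definition Dist (u : R -> R) : signedR R :=
  choose_or (czero : signedR R) (is_distributional_derivative u).

Definition llim (u : R -> R) (x : R) : R :=
  lim ((e^-1 * \int[leb]_(y in `[x - e, x]) u y) @[e --> 0^'+]).

Definition rlim (u : R -> R) (x : R) : R :=
  lim ((e^-1 * \int[leb]_(y in `[x, x + e]) u y) @[e --> 0^'+]).

Definition llimv (n : nat) (u : R -> 'rV[R]_n) (x : R) : 'rV[R]_n :=
  \row_i llim (coord i u) x.

Definition rlimv (n : nat) (u : R -> 'rV[R]_n) (x : R) : 'rV[R]_n :=
  \row_i rlim (coord i u) x.

Definition jump_set (u : R -> R) : set R :=
  [set x | I x /\ llim u x <> rlim u x].

Definition jump_setv (n : nat) (u : R -> 'rV[R]_n) : set R :=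
  [set x | I x /\ llimv u x <> rlimv u x].

Definition good_repr (u : R -> R) : Prop :=
  forall x, I x -> exists theta : R, 0 <= theta <= 1 /\
    u x = theta * llim u x + (1 - theta) * rlim u x.

Definition good_reprv (n : nat) (u : R -> 'rV[R]_n) : Prop :=
  forall x, I x -> exists theta : R, 0 <= theta <= 1 /\
    u x = theta *: llimv u x + (1 - theta) *: rlimv u x.

(* p.1 is the density of the absolutely continuous part, p.2 the Cantor part *)
Definition is_decomposition (u : R -> R) (p : (R -> R) * signedR R) : Prop :=
  let jump := fun x => rlim u x - llim u x in
  [/\ leb.-integrable I (EFin \o p.1),
      p.2.-null_set (~` I) /\ no_atoms p.2 /\ lebesgue_singular p.2,
      rsummable (jump_set u) jump &
      forall A : set (measurableTypeR R), measurable A -> A `<=` I ->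
        (Dist u A = \int[leb]_(x in A) (p.1 x)%:E + p.2 A
                    + (rsum (A `&` jump_set u) jump)%:E)%E].

Definition decomposition (u : R -> R) : (R -> R) * signedR R :=
  choose_or (cst 0, czero : signedR R) (is_decomposition u).

(* A representative of the density; it is determined up to null sets. *)
Definition nabla (u : R -> R) : R -> R := (decomposition u).1.

Definition Dcantor (u : R -> R) : signedR R := (decomposition u).2.

(* For a nonnegative measure, null_set (~` I) says that mu lives on ]a, b[. *)
Definition cantor_measure
    (mu : {finite_measure set (measurableTypeR R) -> \bar R}) : Prop :=
  [/\ mu.-null_set (~` I), no_atoms mu & lebesgue_singular mu].

End BV.

Section Gradient.
Variables (R : realType) (d : nat).

(* Unspecified where f is not differentiable. *)
Definition grad (f : 'rV[R]_d.+1 -> R) (w : 'rV[R]_d.+1) : 'rV[R]_d.+1 :=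
  \row_i 'D_(delta_mx ord0 i) f w.

Definition C1 (f : 'rV[R]_d.+1 -> R) : Prop :=
  (forall w, differentiable f w) /\ continuous (grad f).

End Gradient.

(* Main.v *)
From HB Require Import structures.
Require Import Defs.
From mathcomp Require Import measurable_realfun ring lra.
From mathcomp Require finmap.

(** The chain rule is proved by Riemann sums and dominated convergence.

Let [ru] be the right-continuous representative of [u], which is a constant plus
the map [x |-> Du(]a, x])], and let [C] be the countable set of points where [u] or some
[B^~ w] may jump.  Enclose the support of the test function [phi] in an interval
]al, be] such that no point of the grids [t_k = al + k (be - al) / (n + 1)]
lies in [C].  Between two grid points the increment of [v] splits as
[[
  B(t_{k+1}, ru t_{k+1}) - B(t_k, ru t_k)
    = D_xB(., ru t_{k+1})(]t_k, t_{k+1}]) + sum_i d_iB(t_k, xi_k) Du_i(]t_k, t_{k+1}]),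
]]
where [xi_k] is a mean value point on the segment from [ru t_k] to [ru t_{k+1}].
Multiply by [phi t_k] and sum over [k].  Summation by parts turns the left side
into Riemann sums of [- phi' v] ([Riemann_Stieltjes_cvg]).  On the right, split
[D_xB] and the [Du_i] into absolutely continuous, Cantor and atomic parts
([Dist_split]); every term is then the integral, for Lebesgue measure, [lambda],
a Cantor part or counting measure, of a function that varies with [n] only
through the cell containing the point, and [step_dominated_cvg_on] applies.  Its
two hypotheses are where [A2] and [A3] are used.

- Domination.  [A2] says that [w |-> D_xB(., w)] is Lipschitz for the total
  variation, with a measure [mu] as Lipschitz constant.  Comparing integrals over
  all sets shows that the densities are Lipschitz in [w] almost everywhere, with
  the density of [mu] as constant ([density_lipschitz]).  The gradients are
  bounded by [A3].
- Pointwise limit off [C].  As [ru] is right-continuous, [ru t_{k+1}] tends to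
  [u x], and the densities are continuous in [w].  For the gradient, [A2] applied
  to difference quotients gives [|d_iB(t, w) - d_iB(x, w)| <= c mu(]t, x[)]
  ([grad_left_dist]), which tends to [0] as [t] increases to [x] ([slope_cvg]).
- Pointwise limit at an atom [x] in [C].  The slopes need not converge, but
  their product with [Du({x})] does: up to the small quantity
  [Du(]t_k, t_{k+1}] - {x})] it is the increment of [B(t_k, .)] from
  [ru t_k] to [ru t_{k+1}], whose limit is [B(x-, u(x+)) - B(x-, u(x-))].
  Adding [D_xB(., u(x+))({x})] gives the jump in the formula ([jump_cvg]).

The function [v] is of bounded variation since the same splitting bounds its
increments by those of a finite measure ([composite_increment]): off [C] it is
then a difference of two nondecreasing right-continuous functions, to which Stieltjes
measures correspond ([charge_of_majorant]).

The structure of one-dimensional BV functions on which all this rests (one-sided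
limits, equality with a distribution function, existence of the decomposition
into three parts) follows from the du Bois-Reymond lemma ([du_Bois_Reymond]) and
the Lebesgue decomposition theorem ([charge_lebesgue_decomposition]). *)

(** * Almost everywhere statements and non-measurable integrands *)

Section AlmostEverywhere.
Variables (R : realType) (mu : {measure set (measurableTypeR R) -> \bar R}).
Implicit Types P Q S : R -> Prop.

(** The monotonicity of the almost everywhere filter, stated for a measure on the
Borel sets of R so that no filter structure has to be inferred at each use. *)
Lemma ae_imp P Q : (\forall x \ae mu, P x) -> (forall x, P x -> Q x) ->
  \forall x \ae mu, Q x.
Proof.
by move=> hP PQ; have F := ae_filter_ringOfSetsType mu; exact: filterS hP.
Qed.

Lemma ae_imp2 P Q S : (\forall x \ae mu, P x) -> (\forall x \ae mu, Q x) ->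
  (forall x, P x -> Q x -> S x) -> \forall x \ae mu, S x.
Proof.
by move=> hP hQ PQ; have F := ae_filter_ringOfSetsType mu; exact: filterS2 hP hQ.
Qed.

Lemma ae_all (P : nat -> R -> Prop) : (forall n, \forall x \ae mu, P n x) ->
  \forall x \ae mu, forall n, P n x.
Proof. exact: ae_foralln. Qed.

End AlmostEverywhere.

Section NonMeasurableIntegrands.
Local Open Scope ereal_scope.
Variables (R : realType) (mu : {measure set (measurableTypeR R) -> \bar R}).
Import HBNNSimple.

(** The integral of a nonnegative function is a supremum over the simple functions
below it, so it makes sense for all functions; multiplying such a simple function
by the indicator of the complement of [Z] does not change its integral. *)
Lemma le_integral_off_null (Z : set R) (f g : R -> \bar R) :
  measurable Z -> mu Z = 0 -> (forall x, 0 <= f x) -> (forall x, 0 <= g x) ->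
  (forall x, ~ Z x -> f x <= g x) -> \int[mu]_x f x <= \int[mu]_x g x.
Proof.
move=> mZ Z0 f0 g0 fg; rewrite !ge0_integralTE//.
apply: ge_ereal_sup => _ [h/= hf <-].
have mZ' : measurable (~` Z : set (measurableTypeR R)) by exact: measurableC.
have pE := esym (mrestrict h mZ').
apply: ereal_sup_ubound; exists (proj_nnsfun h mZ').
  move=> x; rewrite pE /patch; case: ifPn => [|_]; last exact: g0.
  by rewrite inE => Zx; apply: (le_trans (hf x)); exact: fg.
rewrite -integralT_nnsfun -[RHS]integralT_nnsfun.
rewrite [RHS](@ge0_negligible_integral _ _ _ mu setT Z)//; last 2 first.
  by apply/measurable_EFinP; exact: measurable_funTS.
  by move=> x _; rewrite lee_fin; exact: fun_ge0.
rewrite setTD [RHS]integral_mkcond; apply: eq_integral => x _.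
by rewrite pE restrict_EFin.
Qed.

(** The integrands of the chain rule, such as [x |-> nablaB x (u x)], are only
almost everywhere equal to Borel functions, hence arbitrary [f] and [g] here. *)
Lemma eq_Rintegral_ae (D : set R) (f g : R -> R) :
  f = g %[ae mu in D] -> (\int[mu]_(x in D) f x = \int[mu]_(x in D) g x)%R.
Proof.
move=> [Z [mZ Z0 DZ]]; rewrite /Rintegral; congr fine.
have off x : ~ Z x -> D x -> f x = g x.
  by move=> Zx Dx; apply: contrapT => fgx; apply: Zx; apply: DZ => /(_ Dx).
rewrite integralE [RHS]integralE; congr (_ - _).
- rewrite integral_mkcond [RHS]integral_mkcond; apply/eqP; rewrite eq_le.
  apply/andP; split; apply: (le_integral_off_null mZ Z0) => x;
    rewrite /patch; case: ifPn; rewrite ?inE//.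
  + by move=> Dx Zx; rewrite !funeposE (off x).
  + by move=> Dx Zx; rewrite !funeposE (off x).
- rewrite integral_mkcond [RHS]integral_mkcond; apply/eqP; rewrite eq_le.
  apply/andP; split; apply: (le_integral_off_null mZ Z0) => x;
    rewrite /patch; case: ifPn; rewrite ?inE//.
  + by move=> Dx Zx; rewrite !funenegE (off x).
  + by move=> Dx Zx; rewrite !funenegE (off x).
Qed.

End NonMeasurableIntegrands.

(** * Sums over countable sets as integrals for the counting measure *)

Section CountableSums.
Local Open Scope ereal_scope.
Variable R : realType.
Implicit Types (C : set R) (mu : {measure set (measurableTypeR R) -> \bar R}).

Lemma countable_measurable_real C : countable C -> measurable (C : set (measurableTypeR R)).
Proof.
move=> cC; apply: countable_measurable => // x _; exact: measurable_set1.
Qed.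

Lemma measurable_fun_countable C d (T : sigmaRingType d) (f : measurableTypeR R -> T) :
  countable C -> measurable_fun (C : set (measurableTypeR R)) f.
Proof.
move=> cC _ Y _; apply: countable_measurable_real.
by apply: sub_countable cC; apply: subset_card_le; exact: subIsetl.
Qed.

(** An enumeration of [C] by singletons in which empty sets pad the gaps, which
treats finite and infinite countable sets alike. *)
Lemma countable_singletons C : countable C -> exists F : nat -> set R,
  [/\ C = \bigcup_k F k, trivIset setT F &
      forall k, F k = set0 \/ exists2 x, C x & F k = [set x]].
Proof.
move=> /countable_injP[g ginj].
exists (fun k => C `&` g @^-1` [set k]); split.
- by apply/seteqP; split => [x Cx|x [k _ []//]]; exists (g x).
- by apply/trivIsetP => i j _ _ ij; rewrite -subset0 => x [[_ /= gi] [_ /= gj]];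
    move: ij; rewrite -gi -gj eqxx.
- move=> k; have [[x [Cx gx]]|nex] := pselect (exists x, C x /\ g x = k).
    right; exists x => //; apply/seteqP; split => [y [Cy gy]|y ->]; last by split.
    by apply: ginj; rewrite ?inE// gx gy.
  left; rewrite -subset0 => x [Cx gx]; apply: nex; by exists x.
Qed.

Lemma counting_set1 (x : R) : counting [set x] = 1 :> \bar R.
Proof. by rewrite /counting asboolT// fset_set1 finmap.cardfs1. Qed.

Lemma ge0_integral_counting C (f : R -> \bar R) : countable C ->
  (forall x, 0 <= f x) ->
  \int[@counting (measurableTypeR R) R]_(x in C) f x = \esum_(x in C) f x.
Proof.
move=> cC f0; have [F [CF tF F1]] := countable_singletons cC.
have mF k : measurable (F k : set (measurableTypeR R)).
  by have [->|[x _ ->]] := F1 k => //; exact: measurable_set1.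
rewrite CF ge0_integral_bigcup//; last first.
  by rewrite -CF; exact: measurable_fun_countable.
rewrite nneseries_sum_bigcup//; apply: eq_eseriesr => k _.
have [->|[x _ ->]] := F1 k; first by rewrite integral_set0 esum_set0.
rewrite esum_set1// (eq_integral (cst (f x))); last first.
  by move=> y; rewrite inE => ->.
  rewrite integral_cst//.
by rewrite [X in _ * X]counting_set1 mule1.
Qed.

Lemma integral_counting_measure mu C : countable C ->
  \int[@counting (measurableTypeR R) R]_(x in C) mu [set x] = mu C.
Proof.
move=> cC; have [F [CF tF F1]] := countable_singletons cC.
have mF k : measurable (F k : set (measurableTypeR R)).
  by have [->|[x _ ->]] := F1 k => //; exact: measurable_set1.
rewrite CF ge0_integral_bigcup//; last first.
  by rewrite -CF; exact: measurable_fun_countable.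
rewrite measure_bigcup//; under [RHS]eq_eseriesl do rewrite in_setT.
apply: eq_eseriesr => k _.
have [->|[x _ ->]] := F1 k; first by rewrite integral_set0 measure0.
rewrite (eq_integral (cst (mu [set x]))); last first.
  by move=> y; rewrite inE => ->.
rewrite integral_cst//.
by rewrite [X in _ * X]counting_set1 mule1.
Qed.

Lemma measure_countable0 mu C : countable C ->
  (forall x, C x -> mu [set x] = 0) -> mu C = 0.
Proof.
by move=> cC C0; rewrite -integral_counting_measure// integral0_eq.
Qed.

Lemma ae_off_countable mu C : countable C ->
  (forall x, C x -> mu [set x] = 0) -> \forall x \ae mu, ~ C x.
Proof.
move=> cC C0; exists C; split; first exact: countable_measurable_real.
  exact: measure_countable0.
by move=> x /= /contrapT.
Qed.

Lemma integrable_counting C (f : R -> R) : countable C ->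
  (@counting (measurableTypeR R) R).-integrable C (EFin \o f) <-> rsummable C f.
Proof.
move=> cC; rewrite /rsummable /summable.
have e : \int[@counting (measurableTypeR R) R]_(x in C) `|(f x)%:E| = \esum_(x in C) `|(EFin \o f) x|.
  by rewrite ge0_integral_counting.
split; first by move/integrableP => [_]; rewrite -e.
move=> h; apply/integrableP; split; first exact: measurable_fun_countable.
by move: h; rewrite -e.
Qed.

(** Turns the sum over the atoms into an integral, so that it is handled by the
same dominated convergence theorem as the diffuse terms. *)
Lemma Rintegral_counting C (f : R -> R) : countable C -> rsummable C f ->
  (\int[@counting (measurableTypeR R) R]_(x in C) f x = rsum C f)%R.
Proof.
move=> cC sf; have intf : (@counting (measurableTypeR R) R).-integrable C (EFin \o f) by exact/integrable_counting.
rewrite /Rintegral integralE fineB; last 2 first.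
- by apply: integrable_pos_fin_num => //; exact: countable_measurable_real.
- by apply: integrable_neg_fin_num => //; exact: countable_measurable_real.
rewrite /rsum -!ge0_integral_counting//; last 2 first.
- by move=> x; rewrite lee_fin funrneg_ge0.
- by move=> x; rewrite lee_fin funrpos_ge0.
by congr (fine _ - fine _)%R; apply: eq_integral => x _;
  rewrite ?funeposE ?funenegE// /funrpos /funrneg EFin_max.
Qed.

End CountableSums.

(** * Dominated convergence for step functions on a grid *)

Section DominatedConvergence.
Variables (R : realType) (rho : {measure set (measurableTypeR R) -> \bar R}).
Variables (D : set R) (mD : measurable (D : set (measurableTypeR R))).

Lemma ae_dominated_integrable (f g : R -> R) :
  measurable_fun (D : set (measurableTypeR R)) (f : measurableTypeR R -> R) ->
  rho.-integrable D (EFin \o g) ->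
  (\forall x \ae rho, D x -> `|f x| <= g x) -> rho.-integrable D (EFin \o f).
Proof.
move=> mf ig [Z [mZ Z0 DZ]].
have mf' : measurable_fun (D : set (measurableTypeR R)) (EFin \o f).
  exact/measurable_EFinP.
have mDZ : measurable (D `\` Z : set (measurableTypeR R)) by exact: measurableD.
apply/(negligible_integrable mZ mD mf' Z0).
apply: (@le_integrable _ _ _ _ _ mDZ _ (EFin \o g)).
- by apply: measurable_funS mf' => //; exact: subDsetl.
- move=> x [Dx nZx] /=; rewrite lee_fin (le_trans _ (ler_norm _))//.
  by apply: contrapT => h; apply: nZx; apply: DZ => /(_ Dx).
- by apply: integrableS ig => //; exact: subDsetl.
Qed.

(** The limit [f] is replaced by its restriction to the complement of the null set
where convergence fails, which is a pointwise limit of measurable functions. *)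
Lemma dominated_Rintegral_cvg (G : nat -> R -> R) (f g : R -> R) :
  (forall n, measurable_fun (D : set (measurableTypeR R)) (G n : measurableTypeR R -> R)) ->
  rho.-integrable D (EFin \o g) ->
  (\forall x \ae rho, D x -> forall n, `|G n x| <= g x) ->
  (\forall x \ae rho, D x -> G n x @[n --> \oo] --> f x) ->
  ae_integrable rho D f /\
  \int[rho]_(x in D) G n x @[n --> \oo] --> \int[rho]_(x in D) f x.
Proof.
move=> mG ig bG cG; have [Z [mZ Z0 DZ]] := cG.
have off x : (D `\` Z) x -> G n x @[n --> \oo] --> f x.
  by move=> [Dx nZx]; apply: contrapT => h; apply: nZx; apply: DZ => /(_ Dx).
have mDZ : measurable (D `\` Z : set (measurableTypeR R)) by exact: measurableD.
pose h := f \_ (D `\` Z).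
have fh : f = h %[ae rho in D].
  exists Z; split => // x /= fhx; apply: contrapT => nZx; apply: fhx => Dx.
  by rewrite /h /patch mem_set.
have mh : measurable_fun (D : set (measurableTypeR R)) (h : measurableTypeR R -> R).
  apply/measurable_restrict => //.
  rewrite (_ : D `&` (D `\` Z) = D `\` Z); last by rewrite setIDA setIid.
  apply: (measurable_fun_cvg (h := G)) => //.
  by move=> n; apply: measurable_funS (mG n) => //; exact: subDsetl.
have cG' : {ae rho, forall x, D x -> (fun n => (EFin \o G n) x) @ \oo --> (EFin \o h) x}.
  apply: (ae_imp2 cG fh) => x cx fx Dx; apply: cvg_EFin; first exact: nearW.
  by rewrite -(fx Dx); exact: cx.
have bG' : {ae rho, forall x n, D x -> (`|(EFin \o G n) x| <= (EFin \o g) x)%E}.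
  by apply: (ae_imp bG) => x bx n Dx; rewrite lee_fin; exact: bx.
have [ih _ ch] := @dominated_convergence _ _ _ rho D mD (fun n => EFin \o G n)
  (EFin \o h) (EFin \o g) (fun n => (measurable_EFinP _ _).2 (mG n))
  ((measurable_EFinP _ _).2 mh) cG' ig bG'.
split; first by exists h.
rewrite (eq_Rintegral_ae fh) /Rintegral; apply: fine_cvg.
by rewrite fineK//; exact: integrable_fin_num.
Qed.

End DominatedConvergence.

Section Grid.
Variables (R : realType) (al be : R) (alb : al < be).
Local Notation D := (`]al, be]%classic : set R).

Definition grid (n k : nat) : R := al + k%:R * ((be - al) / n.+1%:R).
Definition cell n k : set R := `]grid n k, grid n k.+1]%classic.
(** On the [k]th cell the value [F k x] may still depend on [x]: each term of the
Riemann sums is the integral of such a function, for instance of a density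
evaluated at [x] whose second argument is constant on the cell. *)
Definition step (n : nat) (F : nat -> R -> R) (x : R) : R :=
  \sum_(k < n.+1) F k x * \1_(cell n k) x.

Lemma mesh_gt0 n : 0 < (be - al) / n.+1%:R.
Proof. by rewrite divr_gt0// subr_gt0. Qed.

Lemma grid0 n : grid n 0 = al.
Proof. by rewrite /grid mul0r addr0. Qed.

Lemma grid_last n : grid n n.+1 = be.
Proof. by rewrite /grid mulrC divfK// addrC subrK. Qed.

Lemma gridS n k : grid n k.+1 = grid n k + (be - al) / n.+1%:R.
Proof. by rewrite /grid -natr1 mulrDl mul1r addrA. Qed.

Lemma le_grid n j k : (j <= k)%N -> grid n j <= grid n k.
Proof.
by move=> jk; rewrite lerD2l ler_wpM2r ?ler_nat// ltW// mesh_gt0.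
Qed.

Lemma lt_grid n j k : (j < k)%N -> grid n j < grid n k.
Proof.
by move=> jk; rewrite ltrD2l ltr_pM2r ?ltr_nat// mesh_gt0.
Qed.

Lemma grid_bounds n k : (k <= n.+1)%N -> al <= grid n k <= be.
Proof.
by move=> kn; rewrite -{1}(grid0 n) -(grid_last n) !le_grid.
Qed.

Lemma sub_cell n k : (k < n.+1)%N -> cell n k `<=` D.
Proof.
move=> kn x; rewrite /cell/= !in_itv/= => /andP[h1 h2].
have /andP[g1 _] := grid_bounds (ltnW kn); have /andP[_ g2] := grid_bounds kn.
by rewrite (le_lt_trans g1 h1) (le_trans h2 g2).
Qed.

Lemma cell_uniq n j k x : cell n j x -> cell n k x -> j = k.
Proof.
wlog jk : j k / (j <= k)%N.
  by move=> h cj ck; have [/h->//|/ltnW/h->//] := leqP j k.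
rewrite /cell/= !in_itv/= => /andP[_ h2] /andP[h3 _].
apply/eqP; rewrite eqn_leq jk/= leqNgt; apply/negP => /(le_grid n) h.
by have := lt_le_trans h3 (le_trans h2 h); rewrite ltxx.
Qed.

Lemma cell_ex n x : D x -> exists2 k, (k < n.+1)%N & cell n k x.
Proof.
rewrite /= in_itv/= => /andP[ax xb].
have ex : exists k, x <= grid n k.+1 by exists n; rewrite grid_last.
have [k xk mk] := ex_minnP ex; exists k.
  by rewrite ltnS; apply: mk; rewrite grid_last.
rewrite /cell/= in_itv/= xk andbT; case: k mk {xk} => [|k] mk.
  by rewrite grid0.
by rewrite ltNge; apply/negP => /mk; rewrite ltnn.
Qed.

Lemma stepE n F k x : (k < n.+1)%N -> cell n k x -> step n F x = F k x.
Proof.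
move=> kn ck; rewrite /step (bigD1 (Ordinal kn))//= big1 ?addr0; last first.
  move=> j jk; rewrite indicE memNset ?mulr0// => cj.
  by move: jk; rewrite (_ : j = Ordinal kn) ?eqxx//; apply/val_inj/(cell_uniq cj ck).
by rewrite indicE mem_set ?mulr1.
Qed.

Lemma measurable_cell n k : measurable (cell n k : set (measurableTypeR R)).
Proof. exact: measurable_itv. Qed.

(** The cells containing [x] shrink to [x], with left end strictly on the left of
[x] and right end on its right or at [x]: only left limits of what is evaluated
at the left end, and right limits at the right end, enter. *)
Lemma step_cvg (F : nat -> nat -> R -> R) (x l : R) : D x ->
  (forall e, 0 < e -> exists2 d, 0 < d & forall n k, (k < n.+1)%N ->
     x - d < grid n k -> grid n k < x -> x <= grid n k.+1 -> grid n k.+1 < x + d ->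
     `|F n k x - l| <= e) ->
  step n (F n) x @[n --> \oo] --> l.
Proof.
move=> Dx H; apply/cvgrPdist_le => e e0; have [d d0 Hd] := H _ e0.
near=> n; have [k kn ck] := cell_ex n Dx; rewrite (stepE _ kn ck) distrC.
have md : (be - al) / n.+1%:R < d.
  rewrite ltr_pdivrMr// -ltr_pdivrMl// mulrC.
  apply: (lt_trans (y := n%:R)); last by rewrite ltr_nat.
  by near: n; exact: nbhs_infty_gtr.
move: (ck); rewrite /cell/= in_itv/= => /andP[h1 h2].
apply: Hd => //; rewrite gridS in h2 *.
  by rewrite ltrBlDr (le_lt_trans h2)// ltrD2l.
by rewrite ltrD.
Unshelve. all: by end_near. Qed.

End Grid.

Section StepAlgebra.
Variables (R : realType) (al be : R) (alb : al < be).
Local Notation J := (`]al, be]%classic : set R).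
Local Notation t := (grid al be).
Local Notation cell := (cell al be).
Local Notation step := (step al be).

(** Reduces every identity between step functions at [x] to the one cell that
contains [x]. *)
Lemma step_cell n x : J x -> exists2 k, (k < n.+1)%N /\ cell n k x &
  forall F, step n F x = F k x.
Proof.
move=> Jx; have [k kn ck] := cell_ex n Jx; exists k => // F.
exact: stepE.
Qed.

Lemma step_cvg_eq (F G : nat -> nat -> R -> R) x (l : R) : J x ->
  (forall n k, (k < n.+1)%N -> cell n k x -> F n k x = G n k x) ->
  step n (G n) x @[n --> \oo] --> l -> step n (F n) x @[n --> \oo] --> l.
Proof.
move=> Jx FG h; rewrite (_ : (fun n => _) = (fun n => step n (G n) x))//.
by apply/funext => n; have [k [kn ck] e] := step_cell n Jx; rewrite !e FG.
Qed.

Lemma step_cvgD (F G : nat -> nat -> R -> R) x (l m : R) : J x ->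
  step n (F n) x @[n --> \oo] --> l -> step n (G n) x @[n --> \oo] --> m ->
  step n (fun k y => F n k y + G n k y) x @[n --> \oo] --> l + m.
Proof.
move=> Jx hF hG; rewrite (_ : (fun n => _) = (fun n => step n (F n) x + step n (G n) x)).
  exact: cvgD.
by apply/funext => n; have [k _ e] := step_cell n Jx; rewrite !e.
Qed.

Lemma step_cvgM (F G : nat -> nat -> R -> R) x (l m : R) : J x ->
  step n (F n) x @[n --> \oo] --> l -> step n (G n) x @[n --> \oo] --> m ->
  step n (fun k y => F n k y * G n k y) x @[n --> \oo] --> l * m.
Proof.
move=> Jx hF hG; rewrite (_ : (fun n => _) = (fun n => step n (F n) x * step n (G n) x)).
  exact: cvgM.
by apply/funext => n; have [k _ e] := step_cell n Jx; rewrite !e.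
Qed.

Lemma step_cvg_sum (p : nat) (F : 'I_p -> nat -> nat -> R -> R) x (l : 'I_p -> R) : J x ->
  (forall i, step n (F i n) x @[n --> \oo] --> l i) ->
  step n (fun k y => \sum_i F i n k y) x @[n --> \oo] --> \sum_i l i.
Proof.
move=> Jx hF; rewrite (_ : (fun n => _) = (fun n => \sum_i step n (F i n) x)).
  elim: (index_enum _) => [|j s IH].
    by rewrite big_nil; under eq_fun do rewrite big_nil; exact: cvg_cst.
  by rewrite big_cons; under eq_fun do rewrite big_cons; exact: cvgD.
apply/funext => n; have [k _ e] := step_cell n Jx; rewrite e.
by apply: eq_bigr => i _; rewrite e.
Qed.

(** The domain [E] is the whole interval for the diffuse measures, and the set of
atoms for the counting measure, which is not sigma-finite on an interval. *)
Lemma step_dominated_cvg_on (rho : {measure set (measurableTypeR R) -> \bar R})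
    (E : set (measurableTypeR R)) (F : nat -> nat -> R -> R) (f g : R -> R) :
  measurable E -> E `<=` J ->
  (forall n k, (k < n.+1)%N -> measurable_fun E (F n k : measurableTypeR R -> R)) ->
  rho.-integrable E (EFin \o g) ->
  (\forall x \ae rho, E x -> forall n k, (k < n.+1)%N -> cell n k x -> `|F n k x| <= g x) ->
  (\forall x \ae rho, E x -> step n (F n) x @[n --> \oo] --> f x) ->
  ae_integrable rho E f /\
  \sum_(k < n.+1) \int[rho]_(x in cell n k `&` E) F n k x @[n --> \oo] -->
    \int[rho]_(x in E) f x.
Proof.
move=> mE EJ mF ig bF cF.
have mFi n k : (k < n.+1)%N ->
    measurable_fun E ((fun x => F n k x * \1_(cell n k) x) : measurableTypeR R -> R).
  by move=> kn; apply: measurable_funM; [exact: mF|apply: measurable_indic; exact: measurable_cell].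
have iFi n k : (k < n.+1)%N ->
    rho.-integrable E (EFin \o (fun x => F n k x * \1_(cell n k) x)).
  move=> kn; apply: (ae_dominated_integrable _ _ ig) => //; first exact: mFi.
  apply: (ae_imp bF) => x bx Ex.
  rewrite indicE; have [xc|xc] := boolP (x \in cell n k).
    by rewrite mulr1; apply: bx => //; exact: set_mem.
  have [j jn cj] := cell_ex n (EJ _ Ex).
  by rewrite mulr0 normr0 (le_trans _ (bx Ex _ _ jn cj)).
have mS n : measurable_fun E (step n (F n) : measurableTypeR R -> R).
  by apply: measurable_sum => k; exact: mFi.
have bS : \forall x \ae rho, E x -> forall n, `|step n (F n) x| <= g x.
  apply: (ae_imp bF) => x bx Ex n; have [k [kn ck] e] := step_cell n (EJ _ Ex).
  by rewrite e; exact: (bx Ex).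
have [ai c] := dominated_Rintegral_cvg mE mS ig bS cF.
split => //; apply: cvg_trans c; apply: near_eq_cvg; apply: nearW => n.
rewrite /step /Rintegral; under eq_integral do rewrite -sumEFin.
rewrite integral_sum//; last by move=> k; exact: iFi.
rewrite -sum_fine//; last by move=> k _; apply: integrable_fin_num => //; exact: iFi.
apply: eq_bigr => k _; congr fine; rewrite setIC integral_mkcondr; apply: eq_integral => x _.
by rewrite indicE /patch; case: ifPn => _; rewrite ?mulr1 ?mulr0.
Qed.

Lemma step_dominated_cvg (rho : {measure set (measurableTypeR R) -> \bar R})
    (F : nat -> nat -> R -> R) (f g : R -> R) :
  (forall n k, (k < n.+1)%N ->
    measurable_fun (J : set (measurableTypeR R)) (F n k : measurableTypeR R -> R)) ->
  rho.-integrable J (EFin \o g) ->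
  (\forall x \ae rho, J x -> forall n k, (k < n.+1)%N -> cell n k x -> `|F n k x| <= g x) ->
  (\forall x \ae rho, J x -> step n (F n) x @[n --> \oo] --> f x) ->
  ae_integrable rho J f /\
  \sum_(k < n.+1) \int[rho]_(x in cell n k) F n k x @[n --> \oo] -->
    \int[rho]_(x in J) f x.
Proof.
move=> mF ig bF cF.
have mJ : measurable (J : set (measurableTypeR R)) by exact: measurable_itv.
have [ai c] := step_dominated_cvg_on mJ (@subset_refl _ J) mF ig bF cF.
split => //; apply: cvg_trans c; apply: near_eq_cvg; apply: nearW => n.
by apply: eq_bigr => k _; rewrite setIidl//; exact: (sub_cell alb (ltn_ord k)).
Qed.

End StepAlgebra.

(** * Integrals of functions with small support and test functions *)

Section Support.
Variables (R : realType) (rho : {measure set (measurableTypeR R) -> \bar R}).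

Lemma Rintegral_support (A D : set R) (f : R -> R) : D `<=` A ->
  (forall x, A x -> ~ D x -> f x = 0) ->
  \int[rho]_(x in A) f x = \int[rho]_(x in D) f x.
Proof.
move=> DA f0; rewrite Rintegral_mkcond [RHS]Rintegral_mkcond.
congr (Rintegral _ _ _); apply/funext => x; rewrite /patch.
have [xD|xD] := boolP (x \in D); first by rewrite mem_set//; apply: DA; exact: set_mem.
by case: ifPn => // xA; apply: f0; [exact: set_mem|move: xD; rewrite notin_setE].
Qed.

Lemma ae_integrable_support (A D : set R) (f : R -> R) :
  measurable (A : set (measurableTypeR R)) ->
  measurable (D : set (measurableTypeR R)) -> D `<=` A ->
  (forall x, A x -> ~ D x -> f x = 0) ->
  ae_integrable rho D f -> ae_integrable rho A f.
Proof.
move=> mA mD DA f0 [g [ig fg]]; exists (g \_ D); split.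
  rewrite -restrict_EFin; apply: (integrableS measurableT) => //.
  by apply/(integrable_mkcond _ mD).
apply: (ae_imp fg) => x fgx Ax; rewrite /patch; case: ifPn => xD.
  by apply: fgx; exact: set_mem.
by apply: f0 => //; move: xD; rewrite notin_setE.
Qed.

End Support.

Section Bounded.
Variable R : realType.

Lemma continuous_bounded_itv (f : R -> R) al be : continuous f ->
  exists2 M, 0 <= M & forall x, al <= x <= be -> `|f x| <= M.
Proof.
move=> cf; have [ab|ba] := leP al be; last first.
  by exists 0 => // x /andP[h1 h2]; have := le_lt_trans (le_trans h1 h2) ba; rewrite ltxx.
have cn : {within `[al, be], continuous (fun x => `|f x|)}.
  apply: continuous_subspaceT => x; apply: continuous_comp; first exact: cf.
  exact: norm_continuous.
have [c cab hc] := EVT_max ab cn; exists `|f c| => // x xab; exact: hc.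
Qed.

Lemma C01_continuous (a b : R) phi : C01 a b phi -> continuous phi.
Proof.
by move=> [dphi _ _ _] x; apply/differentiable_continuous/derivable1_diffP.
Qed.

(** Extreme points of the compact support; the right end is moved towards [b]
so that the interval is not degenerate. *)
Lemma C01_support (a b : R) phi : a < b -> C01 a b phi ->
  exists al0 be0, [/\ a < al0, al0 < be0, be0 < b &
    forall x, ~ (al0 <= x <= be0) -> phi x = 0].
Proof.
move=> ab [_ _]; set K := closure _ => cK KI.
have sK x : phi x != 0 -> K x by move=> h; apply: subset_closure.
have [K0|/set0P K0] := eqVneq K set0.
  exists (a + (b - a) / 3%:R), (a + (b - a) / 3%:R * 2); split; [lra..|move=> x _].
  by apply/eqP/negPn/negP => /sK; rewrite K0.
have [c Kc hc] := compact_EVT_max (f := id) K0 cK (continuous_subspaceT (fun=> cvg_id)).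
have [e Ke he] := compact_EVT_min (f := id) K0 cK (continuous_subspaceT (fun=> cvg_id)).
have := KI _ (set_mem Kc); have := KI _ (set_mem Ke).
rewrite /= !in_itv/= => /andP[ae _] /andP[_ cb].
exists e, ((c + b) / 2); split => //.
- by rewrite (le_lt_trans (hc _ Ke))// midf_lt.
- by rewrite midf_lt.
- move=> x xK; apply/eqP/negPn/negP => /sK /mem_set Kx; apply: xK.
  by rewrite (he _ Kx)/= (le_trans (hc _ Kx))// ltW// midf_lt.
Qed.

End Bounded.

(** * Riemann sums for functions and for charges *)

Section RiemannSums.
Variables (R : realType) (al be : R) (alb : al < be).
Local Notation D := (`]al, be]%classic : set R).
Local Notation t := (grid al be).
Local Notation cell := (cell al be).
Local Notation step := (step al be).

Lemma summation_by_parts (p F : nat -> R) m : p 0%N = 0 -> p m = 0 ->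
  \sum_(k < m) p k * (F k.+1 - F k) = - \sum_(k < m) (p k.+1 - p k) * F k.+1.
Proof.
move=> p0 pm; apply/eqP; rewrite -subr_eq0 opprK -big_split/=.
rewrite (eq_bigr (fun k : 'I_m => p k.+1 * F k.+1 - p k * F k)); last by move=> k _; ring.
rewrite -(big_mkord xpredT (fun k => p k.+1 * F k.+1 - p k * F k)).
by rewrite telescope_sumr// p0 pm !mul0r subrr.
Qed.

(** Summation by parts and the fundamental theorem of calculus for [phi] turn the
sum into minus the integral of [phi'] times the step function
[F (t n k.+1)], which is bounded and converges wherever [F] is continuous. *)
Lemma Riemann_Stieltjes_cvg (phi F : R -> R) (K : R) :
  (forall x, derivable phi x 1) -> continuous (derive1 phi) ->
  phi al = 0 -> phi be = 0 ->
  (forall x, al <= x <= be -> `|F x| <= K) ->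
  (\forall x \ae leb, D x -> {for x, continuous F}) ->
  \sum_(k < n.+1) phi (t n k) * (F (t n k.+1) - F (t n k)) @[n --> \oo] -->
    - \int[leb]_(x in D) (derive1 phi x * F x).
Proof.
move=> dphi cphi phial phibe FK cF.
have [M M0 hM] := continuous_bounded_itv al be cphi.
have mphi : measurable_fun [set: measurableTypeR R] (derive1 phi : measurableTypeR R -> R).
  exact: continuous_measurable_fun.
have mD : measurable (D : set (measurableTypeR R)) by exact: measurable_itv.
have Dlty : (leb (D : set R) < +oo)%E.
  by rewrite lebesgue_measure_itv/= lte_fin alb ltry.
have [_ c] := @step_dominated_cvg R al be alb leb
  (fun n k x => derive1 phi x * F (t n k.+1)) (fun x => derive1 phi x * F x)
  (cst (M * K))
  (ltac:(move=> n k kn; apply: measurable_funM => //; exact: measurable_funTS))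
  (ltac:(apply: measurable_bounded_integrable => //; exact: bounded_cst))
  (ltac:(apply: aeW => x /= xD n k kn ck; rewrite normrM ler_pM//;
     [apply: hM; move: xD; rewrite in_itv/= => /andP[/ltW -> ->]//
     |apply: FK; exact: grid_bounds]))
  (ltac:(apply: (ae_imp cF) => x cFx Dx; apply: step_cvg => // e e0;
     have := cFx Dx; move=> /cvgrPdist_lt/(_ (e / (1 + `|derive1 phi x|)));
     have p0 : 0 < 1 + `|derive1 phi x| by [rewrite ltr_wpDr];
     rewrite divr_gt0// => /(_ isT)[d d0 hd]; exists d => // n k kn h1 h2 h3 h4;
     rewrite -mulrBr normrM distrC;
     have hF : `|F x - F (t n k.+1)| < e / (1 + `|derive1 phi x|)
       by [apply: hd => /=; rewrite distrC ger0_norm ?subr_ge0// ltrBlDl];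
     apply: (@le_trans _ _ ((1 + `|derive1 phi x|) * (e / (1 + `|derive1 phi x|))));
       [by rewrite ler_pM// ?lerDr// ltW| by rewrite mulrC divfK// gt_eqF])).
have -> : (fun n => \sum_(k < n.+1) phi (t n k) * (F (t n k.+1) - F (t n k))) =
    (fun n => - \sum_(k < n.+1)
       \int[leb]_(x in cell n k) (derive1 phi x * F (t n k.+1))).
  apply/funext => n.
  rewrite (@summation_by_parts (phi \o t n) (F \o t n))/= ?grid0 ?grid_last//.
  congr (- _); apply: eq_bigr => k _.
  have lt : t n k < t n k.+1 by exact: lt_grid.
  have ip : leb.-integrable `[t n k, t n k.+1] (EFin \o derive1 phi).
    apply: continuous_compact_integrable; first exact: segment_compact.
    exact: continuous_subspaceT.
  have ip' : leb.-integrable (cell n k) (EFin \o derive1 phi).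
    apply: (integrableS _ _ _ ip); [exact: measurable_itv|exact: measurable_itv|].
    exact: subset_itv_oc_cc.
  rewrite RintegralZr//; last exact: measurable_cell.
  congr (_ * _); rewrite Rintegral_itv_obnd_cbnd//.
  rewrite /Rintegral (continuous_FTC2 (F := phi)); [by []|by []| | |by []].
  - exact: continuous_subspaceT.
  - have cp : continuous phi by move=> x; apply/differentiable_continuous/derivable1_diffP.
    split; [by move=> x _|exact: cvg_at_right_filter (cp _)|exact: cvg_at_left_filter (cp _)].
exact: cvgN.
Qed.

Section Charges.
Implicit Type nu : signedR R.

Lemma charge_jordan nu (A : set (measurableTypeR R)) : measurable A ->
  fine (nu A) = fine (jordan_pos (hahnP nu) A) - fine (jordan_neg (hahnP nu) A).
Proof.
move=> mA; rewrite (jordan_decomp (hahnP nu) mA) /cadd/= cscaleN1 fineB//;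
  exact: fin_num_measure.
Qed.

Lemma ae_tvar_pos nu (P : R -> Prop) : (\forall x \ae tvar nu, P x) ->
  \forall x \ae jordan_pos (hahnP nu), P x.
Proof.
move=> [Z [mZ Z0 PZ]]; exists Z; split => //; apply/eqP.
by rewrite eq_le measure_ge0 andbT -Z0 /tvar /charge_variation/= leeDl.
Qed.

Lemma ae_tvar_neg nu (P : R -> Prop) : (\forall x \ae tvar nu, P x) ->
  \forall x \ae jordan_neg (hahnP nu), P x.
Proof.
move=> [Z [mZ Z0 PZ]]; exists Z; split => //; apply/eqP.
by rewrite eq_le measure_ge0 andbT -Z0 /tvar /charge_variation/= leeDr.
Qed.

Lemma finite_measure_step_cvg
    (rho : {finite_measure set (measurableTypeR R) -> \bar R})
    (c : nat -> nat -> R) (f : R -> R) (K : R) :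
  (forall n k, (k < n.+1)%N -> `|c n k| <= K) ->
  (\forall x \ae rho, D x -> step n (fun k _ => c n k) x @[n --> \oo] --> f x) ->
  ae_integrable rho D f /\
  \sum_(k < n.+1) c n k * fine (rho (cell n k)) @[n --> \oo] --> \int[rho]_(x in D) f x.
Proof.
move=> cK cf.
have mD : measurable (D : set (measurableTypeR R)) by exact: measurable_itv.
have [ai h] := @step_dominated_cvg R al be alb rho (fun n k _ => c n k) f (cst K)
  (fun n k _ => measurable_cst (c n k)) (finite_measure_integrable_cst _ _ mD)
  (aeW _ (fun _ _ n k kn _ => cK n k kn)) cf.
split => //; apply: cvg_trans h; apply: near_eq_cvg; apply: nearW => n.
by apply: eq_bigr => k _; rewrite Rintegral_cst//; exact: measurable_cell.
Qed.

(** Apply the measure case to both parts of the Jordan decomposition; a null set of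
the total variation is a null set of both. *)
Lemma charge_step_cvg nu (c : nat -> nat -> R) (f : R -> R) (K : R) :
  (forall n k, (k < n.+1)%N -> `|c n k| <= K) ->
  (\forall x \ae tvar nu, D x -> step n (fun k _ => c n k) x @[n --> \oo] --> f x) ->
  ae_integrable (tvar nu) D f /\
  \sum_(k < n.+1) c n k * fine (nu (cell n k)) @[n --> \oo] --> cintegral nu D f.
Proof.
move=> cK cf.
have [_ hp] := finite_measure_step_cvg cK (ae_tvar_pos cf).
have [_ hn] := finite_measure_step_cvg cK (ae_tvar_neg cf).
have mD : measurable (D : set (measurableTypeR R)) by exact: measurable_itv.
have iK : (tvar nu).-integrable D (EFin \o cst K).
  apply: measurable_bounded_integrable => //; last exact: bounded_cst.
  by rewrite /tvar /charge_variation/= lte_add_pinfty// ltey_eq fin_num_measure.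
have [ai _] := @step_dominated_cvg R al be alb (tvar nu) (fun n k _ => c n k) f (cst K)
  (fun n k _ => measurable_cst (c n k)) iK
  (aeW _ (fun _ _ n k kn _ => cK n k kn)) cf.
split => //.
rewrite (_ : (fun n => _) = (fun n =>
    \sum_(k < n.+1) c n k * fine (jordan_pos (hahnP nu) (cell n k)) -
    \sum_(k < n.+1) c n k * fine (jordan_neg (hahnP nu) (cell n k)))).
  exact: cvgB hp hn.
apply/funext => n; rewrite -sumrB; apply: eq_bigr => k _.
by rewrite charge_jordan ?mulrBr//; exact: measurable_cell.
Qed.

Lemma step_continuous_cvg (phi : R -> R) x : continuous phi -> D x ->
  step n (fun k _ => phi (t n k)) x @[n --> \oo] --> phi x.
Proof.
move=> cphi Dx; apply: step_cvg => // e e0.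
have := cphi x; move=> /cvgrPdist_lt/(_ _ e0)[d d0 hd].
exists d => // n k kn h1 h2 h3 h4; rewrite distrC ltW//; apply: hd => /=.
by rewrite ger0_norm ?subr_ge0 ?ltW// ltrBlDl -ltrBlDr.
Qed.

Lemma charge_test_cvg nu (phi : R -> R) : continuous phi ->
  \sum_(k < n.+1) phi (t n k) * fine (nu (cell n k)) @[n --> \oo] --> cintegral nu D phi.
Proof.
move=> cphi; have [K _ hK] := continuous_bounded_itv al be cphi.
have [] := @charge_step_cvg nu (fun n k => phi (t n k)) phi K => //.
- by move=> n k kn; apply: hK; apply: grid_bounds => //; exact: ltnW.
- by apply: aeW => x Dx; exact: step_continuous_cvg.
Qed.

Lemma cintegral_support nu (A B : set R) (f : R -> R) : B `<=` A ->
  (forall x, A x -> ~ B x -> f x = 0) -> cintegral nu A f = cintegral nu B f.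
Proof. by move=> BA f0; rewrite /cintegral !(Rintegral_support _ BA). Qed.

End Charges.

End RiemannSums.

(** * Explicit test functions whose derivatives approximate indicators *)

Section Trapezoid.
Variable R : realType.
Implicit Types t e s x y : R.

Definition ramp t : R := Num.max 0 t.
Definition sqramp t : R := ramp t ^+ 2.

Lemma ramp_pos t : 0 <= t -> ramp t = t.
Proof. by move=> t0; apply/max_idPr. Qed.

Lemma ramp_neg t : t <= 0 -> ramp t = 0.
Proof. by move=> t0; apply/max_idPl. Qed.

Lemma continuous_ramp : continuous (ramp : R -> R).
Proof.
move=> t; rewrite (_ : ramp = (cst 0 \max id)); last by apply/funext.
by apply: continuous_max; [exact: cst_continuous|exact: cvg_id].
Qed.

Lemma ramp_lip t s : 0 <= s -> 0 <= ramp t - ramp (t - s) <= s.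
Proof.
move=> s0; have [t0|t0] := leP 0 t; last first.
  by rewrite !ramp_neg ?subrr ?lexx//; lra.
rewrite (ramp_pos t0); have [te|te] := leP 0 (t - s).
  by rewrite ramp_pos//; lra.
by rewrite ramp_neg; lra.
Qed.

Lemma is_derive_sqramp t : is_derive t 1 sqramp (2 * ramp t).
Proof.
have [t0|t0|->] := ltgtP t 0.
- apply: (@near_eq_is_derive _ _ _ (cst 0)).
    near=> z; rewrite /sqramp ramp_neg ?expr0n//.
    by apply/ltW; near: z; exact: lt_nbhsl.
  by rewrite (ramp_neg (ltW t0)) mulr0; exact: is_derive_cst.
- apply: (@near_eq_is_derive _ _ _ (fun z : R => z ^+ 2)).
    near=> z; rewrite /sqramp ramp_pos//.
    by apply/ltW; near: z; exact: lt_nbhsr.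
  rewrite ramp_pos; last exact: ltW.
  have /is_derive_eq := is_deriveX 2 (is_derive_id (V := R^o) t 1).
  by apply; rewrite /= expr1 [RHS]/GRing.mul/= -[LHS]/(_ * _) mulr1.
have c : h^-1 *: (sqramp (h *: (1 : R) + 0) - sqramp 0) @[h --> 0^'] --> (0 : R).
  apply/cvgrPdist_le => e e0; near=> h.
  rewrite sub0r normrN addr0 [h *: _]mulr1 {2}/sqramp ramp_pos// expr0n subr0.
  have h0 : h != 0 by near: h; exact: nbhs_dnbhs_neq.
  have he : `|h| <= e by near: h; exact: dnbhs0_le.
  rewrite [_ *: _]/GRing.scale/= normrM normfV ler_pdivrMl ?normr_gt0//.
  rewrite /sqramp; have [h1|h1] := leP 0 h.
    by rewrite ramp_pos// expr2 normrM ler_wpM2l.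
  by rewrite ramp_neg ?expr0n ?normr0 ?mulr_ge0//; exact: ltW.
apply: DeriveDef; first by apply/cvg_ex; exists 0; exact: c.
by rewrite ramp_pos// mulr0; apply/cvg_lim => //; exact: c.
Unshelve. all: by end_near. Qed.

Lemma is_derive_sqramp_shift s t :
  is_derive t 1 (fun t => sqramp (t - s)) (2 * ramp (t - s)).
Proof.
have d : is_derive t 1 (fun t : R => t - s) 1.
  have /is_derive_eq := is_deriveB (is_derive_id (V := R^o) t 1) (is_derive_cst (W := R^o) s t 1).
  by apply; rewrite subr0.
have /is_derive_eq := @is_derive1_comp _ sqramp (fun t => t - s) t _ _ (is_derive_sqramp (t - s)) d.
by apply; rewrite mulr1.
Qed.

(** A trapezoid of height 1, tending to the indicator of ]0, e] as [s] tends to [0], and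
its primitive; written with the positive part so that the primitive is given by
the same formula with half its square, which is continuously differentiable. *)
Definition bump s e t : R :=
  s^-1 * (ramp t - ramp (t - s) - ramp (t - e) + ramp (t - (e + s))).
Definition ibump s e t : R :=
  s^-1 / 2 * (sqramp t - sqramp (t - s) - sqramp (t - e) + sqramp (t - (e + s))).

Lemma continuous_bump s e : continuous (bump s e).
Proof.
move=> t; apply: cvgM; first exact: cvg_cst.
have c r : ramp (x - r) @[x --> t] --> ramp (t - r).
  apply: (continuous_comp (f := fun x : R => x - r) (g := ramp)).
    by apply: cvgB; [exact: cvg_id|exact: cvg_cst].
  exact: continuous_ramp.
apply: cvgD; last exact: c.
apply: cvgB; last exact: c.
apply: cvgB; last exact: c.
exact: continuous_ramp.
Qed.

Lemma is_derive_ibump s e t : is_derive t 1 (ibump s e) (bump s e t).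
Proof.
have h := is_deriveZ (s^-1 / 2) (is_deriveD (is_deriveB (is_deriveB
  (is_derive_sqramp t) (is_derive_sqramp_shift s t)) (is_derive_sqramp_shift e t))
  (is_derive_sqramp_shift (e + s) t)).
have /is_derive_eq := h; apply.
rewrite /bump [LHS]/GRing.scale/=.
by move: (s^-1) => i; field.
Qed.

Lemma bump_le1 s e t : 0 < s -> `|bump s e t| <= 1.
Proof.
move=> s0; rewrite /bump normrM gtr0_norm ?invr_gt0// ler_pdivrMl// mulr1.
have /andP[h1 h2] := ramp_lip t (ltW s0).
have /andP[h3 h4] := ramp_lip (t - e) (ltW s0).
have -> : t - (e + s) = t - e - s by ring.
by rewrite ler_norml; apply/andP; split; lra.
Qed.

Lemma ibump_left s e t : 0 < s -> 0 <= e -> t <= 0 -> ibump s e t = 0.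
Proof.
move=> s0 e0 t0; rewrite /ibump /sqramp !ramp_neg; [|lra..].
by rewrite expr0n/= ?subrr ?addr0 ?mulr0.
Qed.

Lemma ibump_right s e t : 0 < s -> 0 <= e -> e + s <= t -> ibump s e t = e.
Proof.
move=> s0 e0 t0; rewrite /ibump /sqramp !ramp_pos; [|lra..].
by field; rewrite gt_eqF.
Qed.

Lemma bump_cvg e t : 0 < e ->
  bump m.+1%:R^-1 e t @[m --> \oo] --> (\1_(`]0, e]%classic) t : R).
Proof.
move=> e0.
have inv (r : R) : 0 < r -> \forall m \near \oo, m.+1%:R^-1 < r.
  move=> r0; near=> m; rewrite invf_plt ?posrE//.
  by apply: (@lt_trans _ _ m%:R); [near: m; exact: nbhs_infty_gtr|rewrite ltr_nat].
have r (z : R) : m.+1%:R^-1^-1 * (ramp z - ramp (z - m.+1%:R^-1)) @[m --> \oo] -->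
    (\1_(`]0, +oo[%classic) z : R).
  have [z0|z0] := leP z 0.
    rewrite indicE memNset; last by rewrite /= in_itv/= andbT ltNge z0.
    apply: cvg_near_cst; near=> m; have : 0 <= m.+1%:R^-1 :> R by rewrite invr_ge0.
    by move: m.+1%:R^-1 => i i0; rewrite !ramp_neg ?subrr ?mulr0//; lra.
  rewrite indicE mem_set; last by rewrite /= in_itv/= andbT z0.
  apply: cvg_near_cst; near=> m.
  have : m.+1%:R^-1 < z by near: m; exact: inv.
  have : 0 < m.+1%:R^-1 :> R by rewrite invr_gt0.
  move: m.+1%:R^-1 => i i0 iz.
  by rewrite !ramp_pos ?subKr ?mulVf ?gt_eqF//; lra.
have -> : (fun m => bump m.+1%:R^-1 e t) = (fun m => m.+1%:R^-1^-1 * (ramp t - ramp (t - m.+1%:R^-1)) -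
    m.+1%:R^-1^-1 * (ramp (t - e) - ramp (t - e - m.+1%:R^-1))).
  by apply/funext => m; rewrite /bump opprD addrA; move: (m.+1%:R^-1) => i; ring.
have -> : (\1_(`]0, e]%classic) t : R) = \1_(`]0, +oo[%classic) t - \1_(`]0, +oo[%classic) (t - e).
  rewrite !indicE !mem_setE !in_itv/= !andbT subr_gt0.
  by have [te|te] := leP t e; have [t0|t0] := ltP 0 t => //=; rewrite ?subr0 ?subrr//; lra.
exact: cvgB (r t) (r (t - e)).
Unshelve. all: by end_near. Qed.

(** Both primitives are [0] on the far left and [e] on the far right, hence their
difference has compact support. *)
Lemma C01_bump (a b s e x y : R) : 0 < s -> 0 <= e -> a < x -> a < y ->
  x + e + s < b -> y + e + s < b ->
  C01 a b (fun t => ibump s e (t - x) - ibump s e (t - y)) /\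
  derive1 (fun t => ibump s e (t - x) - ibump s e (t - y)) =
    (fun t => bump s e (t - x) - bump s e (t - y)).
Proof.
move=> s0 e0 ax ay xb yb; set phi := fun t => _.
have sh z t : is_derive t 1 (fun t => ibump s e (t - z)) (bump s e (t - z)).
  have d : is_derive t 1 (fun t : R => t - z) 1.
    have /is_derive_eq := is_deriveB (is_derive_id (V := R^o) t 1) (is_derive_cst (W := R^o) z t 1).
    by apply; rewrite subr0.
  have /is_derive_eq := @is_derive1_comp _ (ibump s e) (fun t => t - z) t _ _ (is_derive_ibump s e (t - z)) d.
  by apply; rewrite mulr1.
have d t : is_derive t 1 phi (bump s e (t - x) - bump s e (t - y)).
  exact: is_deriveB (sh x t) (sh y t).
have dE : derive1 phi = (fun t => bump s e (t - x) - bump s e (t - y)).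
  by apply/funext => t; rewrite derive1E; exact: derive_val.
pose lo := Num.min x y; pose hi := Num.max x y + e + s.
have supp : [set t | phi t != 0] `<=` `[lo, hi]%classic.
  move=> t /=; apply: contraNT; rewrite in_itv/= negb_and -!ltNge => /orP[h|h].
    move: h; rewrite /lo lt_min => /andP[tx ty].
    by rewrite /phi !ibump_left ?subrr//; lra.
  have hx : x + e + s <= t.
    by apply: le_trans (ltW h); rewrite !lerD2r le_max lexx.
  have hy : y + e + s <= t.
    by apply: le_trans (ltW h); rewrite !lerD2r le_max lexx orbT.
  by rewrite /phi !ibump_right ?subrr//; lra.
have csupp : closure [set t | phi t != 0] `<=` `[lo, hi]%classic.
  rewrite [X in _ `<=` X](closure_id _).1; last exact: itv_closed.
  exact: closureS.
split; last exact: dE.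
split.
- by move=> t; apply: ex_derive.
- rewrite dE => t.
  have c z : bump s e (r - z) @[r --> t] --> bump s e (t - z).
    apply: (continuous_comp (f := fun x : R => x - z) (g := bump s e)).
      by apply: cvgB; [exact: cvg_id|exact: cvg_cst].
    exact: continuous_bump.
  by apply: cvgB; exact: c.
- apply: (subclosed_compact _ (@segment_compact _ lo hi)) => //.
  exact: closed_closure.
- move=> t /csupp /=; rewrite !in_itv/= => /andP[lot hit].
  have alo : a < lo by rewrite /lo lt_min ax ay.
  have hib : hi < b by rewrite /hi; case: (leP x y).
  by rewrite (lt_le_trans alo lot) (le_lt_trans hit hib).
Qed.

End Trapezoid.

(** * Finite measures on the line: small intervals and atoms *)

Section FiniteMeasures.
Import finmap.
Variable R : realType.
Local Open Scope ereal_scope.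

Lemma le_measureT (mu : {measure set (measurableTypeR R) -> \bar R})
    (A : set (measurableTypeR R)) : measurable A -> mu A <= mu setT.
Proof. move=> mA; apply: le_measure; [exact/mem_set|exact/mem_set/measurableT|].
exact: subsetT. Qed.

Lemma measure_shrink (mu : {measure set (measurableTypeR R) -> \bar R})
    (F : (set R)^nat) (e : R) : mu setT < +oo -> (0 < e)%R ->
  (forall i, measurable (F i : set (measurableTypeR R))) -> nonincreasing_seq F ->
  \bigcap_i F i = set0 -> exists i, mu (F i) < e%:E.
Proof.
move=> muT e0 mF nF F0.
have c : mu \o F @ \oo --> mu (\bigcap_i F i).
  apply: nonincreasing_cvg_mu => //; last by rewrite F0.
  by apply: le_lt_trans muT; apply: le_measureT; exact: mF.
rewrite F0 measure0 in c.
move/fine_cvgP : c => [fin c']; have lt := cvgr_lt _ c' _ e0.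
have [N _ hN] := filterI fin (lt _).
exists N; have [h1 h2] := hN N (leqnn N).
by rewrite -[mu _]fineK// lte_fin.
Qed.

Lemma archi_inv (r : R) : (0 < r)%R -> exists n, (n.+1%:R^-1 < r)%R.
Proof.
move=> r0; have [n hn] : exists n : nat, (r^-1 < n%:R)%R.
  by exists (Num.truncn r^-1).+1; exact: truncnS_gt.
exists n; rewrite invf_plt ?posrE//.
by apply: lt_trans hn _; rewrite ltr_nat.
Qed.

(** The intervals ]x, x + 1/n] decrease to the empty set. *)
Lemma measure_right_shrink (mu : {measure set (measurableTypeR R) -> \bar R})
  (x e : R) : mu setT < +oo -> (0 < e)%R ->
  exists2 d, (0 < d)%R & mu `]x, (x + d)%R]%classic < e%:E.
Proof.
move=> muT e0.
have [i hi] := @measure_shrink mu (fun n => `]x, (x + n.+1%:R^-1)%R]%classic) e muT e0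
  (fun i => measurable_itv _)
  (ltac:(move=> m n mn; apply/subsetPset => t /=; rewrite !in_itv/= => /andP[-> /le_trans];
    apply; rewrite lerD2l lef_pV2 ?posrE// ler_nat ltnS; exact: mn))
  (ltac:(rewrite -subset0 => t h; have /= := h 0%N I; rewrite in_itv/= => /andP[xt _];
    have [n hn] := archi_inv (r := t - x) (ltac:(by rewrite subr_gt0));
    have /= := h n I; rewrite in_itv/= xt/= leNgt -ltrBrDl hn//)).
by exists (i.+1%:R^-1)%R => //; rewrite invr_gt0.
Qed.

Lemma measure_left_shrink (mu : {measure set (measurableTypeR R) -> \bar R})
  (x e : R) : mu setT < +oo -> (0 < e)%R ->
  exists2 d, (0 < d)%R & mu `](x - d)%R, x[%classic < e%:E.
Proof.
move=> muT e0.
have [i hi] := @measure_shrink mu (fun n => `](x - n.+1%:R^-1)%R, x[%classic) e muT e0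
  (fun i => measurable_itv _)
  (ltac:(move=> m n mn; apply/subsetPset => t /=; rewrite !in_itv/= => /andP[h ->];
    rewrite andbT (le_lt_trans _ h)// lerD2l lerN2 lef_pV2 ?posrE// ler_nat ltnS; exact: mn))
  (ltac:(rewrite -subset0 => t h; have /= := h 0%N I; rewrite in_itv/= => /andP[_ tx];
    have [n hn] := archi_inv (r := x - t) (ltac:(by rewrite subr_gt0));
    have /= := h n I; rewrite in_itv/= tx andbT ltrBlDr -ltrBlDl ltNge (ltW hn)//)).
by exists (i.+1%:R^-1)%R => //; rewrite invr_gt0.
Qed.

(** At most finitely many atoms have mass at least [1 / (n + 1)], as the total mass
is finite. *)
Lemma countable_atoms (mu : {measure set (measurableTypeR R) -> \bar R}) :
  mu setT < +oo -> countable [set x : R | mu [set x] != 0].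
Proof.
move=> muT.
have -> : [set x : R | mu [set x] != 0] =
    \bigcup_n [set x : R | n.+1%:R^-1%:E <= mu [set x]].
  apply/seteqP; split => [x /= x0|x [n _ /=] h].
    have p0 : 0 < mu [set x] by rewrite lt0e x0 measure_ge0.
    have [r|] := @eqVneq _ (mu [set x]) +oo.
      by exists 0%N => //=; rewrite r leey.
    rewrite -ltey => f.
    have [n hn] := archi_inv (r := fine (mu [set x])) (fine_gt0 (introT andP (conj p0 f))).
    by exists n => //=; rewrite -[mu _]fineK ?lee_fin ?(ltW hn)// ge0_fin_numE.
  by rewrite gt_eqF// (lt_le_trans _ h)// lte_fin invr_gt0.
apply: bigcup_countable => // n _; apply: finite_set_countable.
(* more than (total mass) * (n + 1) atoms would exceed the total mass *)
apply: contrapT => inf.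
have Tf : mu setT \is a fin_num by rewrite ge0_fin_numE.
pose m := (Num.truncn (fine (mu setT) * n.+1%:R)).+1.
have [B BA mB] := infinite_set_fset m inf.
have : \sum_(x \in [set` B]) mu [set x] <= mu setT.
  rewrite -(@measure_fsbig _ _ _ mu R [set` B] (fun x => [set x : R]))//.
  - apply: le_measureT; rewrite fsbig_finite//.
    by apply: bigsetU_measurable => x _; exact: measurable_set1.
  - by apply/trivIsetP => i j _ _ ij; apply/disjoints_subset => t /= -> /eqP; exact/negP.
apply/negP; rewrite -ltNge.
apply: (@lt_le_trans _ _ (\sum_(x \in [set` B]) n.+1%:R^-1%:E)); last first.
  by apply: lee_fsum => // x xB; exact: BA.
rewrite fsbig_finite//= set_fsetK sumEFin big_const_seq count_predT iter_addr_0.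
rewrite -(fineK Tf) lte_fin -[X in (_ < X)%R]mulr_natr ltr_pdivlMl// mulrC.
by apply: (lt_le_trans (truncnS_gt _)); rewrite ler_nat.
Qed.

End FiniteMeasures.

(** Uniqueness of limits, with the topology of R fixed once. *)
Lemma cvg_eq (R : realType) (u : nat -> R) (l l' : R) :
  u n @[n --> \oo] --> l -> u n @[n --> \oo] --> l' -> l = l'.
Proof. by move=> h h'; exact: (cvg_unique (@Rhausdorff R) h h'). Qed.

(** * Distribution functions of charges *)

Section ChargeValues.
Variable R : realType.
Implicit Types nu : signedR R.
Implicit Types A : set (measurableTypeR R).

Lemma charge_valU nu A B : measurable A -> measurable B -> A `&` B = set0 ->
  fine (nu (A `|` B)) = fine (nu A) + fine (nu B).
Proof. by move=> mA mB AB; rewrite chargeU// fineD//; exact: fin_num_measure. Qed.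

Lemma tvar_fin nu A : measurable A -> tvar nu A \is a fin_num.
Proof. by move=> mA; rewrite /tvar /charge_variation fin_numD !fin_num_measure. Qed.

Lemma tvarT nu : (tvar nu setT < +oo)%E.
Proof. by rewrite ltey_eq tvar_fin. Qed.

Lemma charge_le_tvar nu A : measurable A -> `|fine (nu A)| <= fine (tvar nu A).
Proof.
move=> mA; rewrite -lee_fin fineK ?tvar_fin//.
have f : nu A \is a fin_num by exact: fin_num_measure.
by rewrite -abse_EFin fineK//; exact: abse_charge_variation.
Qed.

Lemma charge_bound nu A : measurable A -> `|fine (nu A)| <= fine (tvar nu setT).
Proof.
move=> mA; apply: (le_trans (charge_le_tvar nu mA)).
apply: fine_le; rewrite ?tvar_fin//; exact: le_measureT.
Qed.

(** Null sets in the sense of charges are stable under Borel subsets, in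
particular under intersection with the two sides of a Hahn decomposition. *)
Lemma tvar_null nu A : measurable A -> nu.-null_set A -> tvar nu A = 0%E.
Proof.
move=> mA nA; rewrite /tvar /charge_variation/= jordan_posE jordan_negE.
rewrite cjordan_posE cjordan_negE /crestr0 mem_set// /crestr.
have [[mP _] [mN _] _ _] := hahnP nu.
by rewrite !nA ?oppe0 ?adde0//; apply: measurableI.
Qed.

Lemma no_atoms_tvar nu : no_atoms nu -> no_atoms (tvar nu).
Proof.
move=> na x; apply: tvar_null; first exact: measurable_set1.
move=> B mB Bx; have [->|->] : B = set0 \/ B = [set x] by exact: subset_set1.
  exact: charge0.
exact: na.
Qed.

Definition cdf nu (x : R) : R := fine (nu `]-oo, x]%classic).
Definition lcdf nu (x : R) : R := fine (nu `]-oo, x[%classic).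

Lemma cdfB nu x y : x <= y -> cdf nu y - cdf nu x = fine (nu `]x, y]%classic).
Proof.
move=> xy; rewrite /cdf (_ : `]-oo, y]%classic = `]-oo, x] `|` `]x, y]); last first.
  by rewrite -itv_bndbnd_setU// bnd_simp.
rewrite charge_valU; [by rewrite addrC addKr|exact: measurable_itv|exact: measurable_itv|].
rewrite -subset0 => t /= []; rewrite !in_itv/= => h /andP[h2 _].
by have := lt_le_trans h2 h; rewrite ltxx.
Qed.

Lemma cdf_lcdfB nu x y : x < y -> lcdf nu y - cdf nu x = fine (nu `]x, y[%classic).
Proof.
move=> xy; rewrite /cdf /lcdf (_ : `]-oo, y[%classic = `]-oo, x] `|` `]x, y[); last first.
  by rewrite -itv_bndbnd_setU// bnd_simp// ltW.
rewrite charge_valU; [by rewrite addrC addKr|exact: measurable_itv|exact: measurable_itv|].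
rewrite -subset0 => t /= []; rewrite !in_itv/= => h /andP[h2 _].
by have := lt_le_trans h2 h; rewrite ltxx.
Qed.

Lemma cdf_jump nu x : cdf nu x - lcdf nu x = fine (nu [set x]).
Proof.
rewrite /cdf /lcdf (_ : `]-oo, x]%classic = `]-oo, x[ `|` [set x]); last first.
  by rewrite setUitv1 ?bnd_simp.
rewrite charge_valU; [by rewrite addrC addKr|exact: measurable_itv|exact: measurable_set1|].
by rewrite -subset0 => t /= [] /[swap] ->; rewrite in_itv/= ltxx.
Qed.

Lemma cdf_bounded nu x : `|cdf nu x| <= fine (tvar nu setT).
Proof. by apply: charge_bound; exact: measurable_itv. Qed.

Lemma cdf_right nu x e : 0 < e ->
  exists2 d, 0 < d & forall y, x <= y -> y < x + d -> `|cdf nu y - cdf nu x| < e.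
Proof.
move=> e0; have [d d0 hd] := measure_right_shrink x (tvarT nu) e0.
exists d => // y xy yd; rewrite cdfB//.
apply: (le_lt_trans (charge_le_tvar nu (measurable_itv _))).
rewrite -lte_fin fineK ?tvar_fin//.
apply: le_lt_trans hd; apply: le_measure; rewrite ?inE; [exact: measurable_itv..|].
by move=> t /=; rewrite !in_itv/= => /andP[-> /le_trans]; apply; exact: ltW.
Qed.

Lemma cdf_left nu x e : 0 < e ->
  exists2 d, 0 < d & forall y, y < x -> x - d < y -> `|cdf nu y - lcdf nu x| < e.
Proof.
move=> e0; have [d d0 hd] := measure_left_shrink x (tvarT nu) e0.
exists d => // y xy yd; rewrite distrC cdf_lcdfB//.
apply: (le_lt_trans (charge_le_tvar nu (measurable_itv _))).
rewrite -lte_fin fineK ?tvar_fin//.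
apply: le_lt_trans hd; apply: le_measure; rewrite ?inE; [exact: measurable_itv..|].
by move=> t /=; rewrite !in_itv/= => /andP[h ->]; rewrite andbT (lt_trans yd).
Qed.

Lemma cdf_continuous nu x : fine (nu [set x]) = 0 -> {for x, continuous (cdf nu)}.
Proof.
rewrite -cdf_jump => /subr0_eq j; apply/cvgrPdist_lt => e e0.
have [d1 d10 h1] := cdf_right nu x e0; have [d2 d20 h2] := cdf_left nu x e0.
exists (Num.min d1 d2) => /=; first by rewrite lt_min d10.
move=> y /=; rewrite lt_min => /andP[y1 y2]; rewrite distrC.
have [xy|yx] := leP x y.
  by apply: h1 => //; rewrite -ltrBlDl; apply: le_lt_trans y1; rewrite distrC ler_norm.
by rewrite j; apply: h2 => //; rewrite ltrBlDr -ltrBlDl; apply: le_lt_trans y2; rewrite ler_norm.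
Qed.

Lemma countable_charge_atoms nu : countable [set x : R | fine (nu [set x]) != 0].
Proof.
apply: sub_countable (countable_atoms (tvarT nu)); apply: subset_card_le => x /=.
apply: contraNN => /eqP h; rewrite -normr_eq0 eq_le normr_ge0 andbT.
by rewrite (le_trans (charge_le_tvar _ _))// [tvar _ _]h.
Qed.

Lemma leb_off_countable (C : set R) : countable C -> \forall x \ae leb, ~ C x.
Proof.
move=> cC; exists C; split; first exact: countable_measurable_real.
  exact: countable_lebesgue_measure0.
by move=> x /= /contrapT.
Qed.

(** A difference of two nondecreasing functions, by the Jordan decomposition. *)
Lemma measurable_cdf nu : measurable_fun [set: measurableTypeR R] (cdf nu : measurableTypeR R -> R).
Proof.
have mono (mu : {finite_measure set (measurableTypeR R) -> \bar R}) :
    measurable_fun [set: measurableTypeR R] ((fun x => fine (mu `]-oo, x]%classic)) : measurableTypeR R -> R).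
  apply: nondecreasing_measurable => // x y xy.
  apply: fine_le; [exact: fin_num_measure..|].
  apply: le_measure; rewrite ?inE; [exact: measurable_itv..|].
  by move=> t /=; rewrite !in_itv/= => /le_trans; apply.
rewrite (_ : cdf nu = fun x => fine (jordan_pos (hahnP nu) `]-oo, x]%classic)
   - fine (jordan_neg (hahnP nu) `]-oo, x]%classic)).
  by apply: measurable_funB; exact: mono.
by apply/funext => x; rewrite /cdf charge_jordan//; exact: measurable_itv.
Qed.

End ChargeValues.

(** * Structure of BV functions of one variable *)

Section BVStructure.
Variables (R : realType) (a b : R) (ab : a < b).
Local Notation I := (`]a, b[%classic : set R).

Lemma derive1_support (phi : R -> R) (al be : R) :
  (forall x, ~ (al <= x <= be) -> phi x = 0) ->
  forall x, ~ (al <= x <= be) -> derive1 phi x = 0.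
Proof.
move=> phi0 x xab; rewrite derive1E (@near_eq_derive _ _ _ phi (cst 0)) ?derive_cst//.
have : (x < al) || (be < x).
  by rewrite -[_ || _]negbK negb_or -!leNgt; exact/negP.
move=> /orP[h|h]; near=> z; apply: phi0.
  have h2 : z < al by near: z; exact: lt_nbhsl.
  by rewrite leNgt h2.
have h2 : be < z by near: z; exact: lt_nbhsr.
by rewrite andbC leNgt h2.
Unshelve. all: by end_near. Qed.

(** Both sides are limits of the same sums, by [Riemann_Stieltjes_cvg] and
[charge_test_cvg]. *)
Lemma BV_integration_by_parts (phi F : R -> R) (nu : signedR R) (K : R) :
  C01 a b phi -> (forall x, I x -> `|F x| <= K) ->
  (\forall x \ae leb, I x -> {for x, continuous F}) ->
  (forall x y, a < x -> x <= y -> y < b -> F y - F x = fine (nu `]x, y]%classic)) ->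
  \int[leb]_(x in I) (derive1 phi x * F x) = - cintegral nu I phi.
Proof.
move=> hphi FK cF Fnu.
have [al0 [be0 [h1 h2 h3 supp]]] := C01_support ab hphi.
pose al := (a + al0) / 2; pose be := (be0 + b) / 2.
have [aal alal0] : a < al /\ al < al0 by rewrite /al !midf_lt.
have [be0be beb] : be0 < be /\ be < b by rewrite /be !midf_lt.
have alb : al < be by lra.
have DI : `]al, be]%classic `<=` I.
  by move=> x /=; rewrite !in_itv/= => /andP[x1 x2]; rewrite (lt_trans aal x1) (le_lt_trans x2).
have off x : ~ (`]al, be]%classic : set R) x -> ~ (al0 <= x <= be0).
  move=> xD xab; apply: xD; move: xab => /andP[x1 x2]; rewrite /= in_itv/=.
  by rewrite (lt_le_trans alal0 x1)/= ltW// (le_lt_trans x2).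
have phial : phi al = 0 by apply: supp; rewrite (leNgt _ al) alal0.
have phibe : phi be = 0 by apply: supp; rewrite andbC (leNgt be) be0be.
have [dphi cphi _ _] := hphi.
have FK' x : al <= x <= be -> `|F x| <= K.
  move=> /andP[x1 x2]; apply: FK; rewrite /= in_itv/=.
  by rewrite (lt_le_trans aal x1) (le_lt_trans x2).
have c1 := @Riemann_Stieltjes_cvg R al be alb phi F K dphi cphi phial phibe FK'
  (ae_imp cF (fun x h Dx => h (DI _ Dx))).
have c2 := @charge_test_cvg R al be alb nu phi (C01_continuous hphi).
rewrite (Rintegral_support _ DI); last first.
  by move=> x _ /off xD; rewrite (derive1_support supp) ?mul0r.
rewrite (cintegral_support _ DI); last by move=> x _ /off; exact: supp.
rewrite -[LHS]opprK; congr (- _).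
apply: (cvg_eq c1); apply: cvg_trans c2; apply: near_eq_cvg; apply: nearW => n.
apply: eq_bigr => k _; congr (_ * _); rewrite Fnu//.
- by apply: (lt_le_trans aal); have /andP[] := grid_bounds alb (ltnW (ltn_ord k)).
- by apply: le_grid.
- by apply: le_lt_trans beb; have /andP[] := grid_bounds alb (ltn_ord k).
Qed.

Lemma integration_by_parts_cdf (nu : signedR R) (phi : R -> R) : C01 a b phi ->
  \int[leb]_(x in I) (derive1 phi x * cdf nu x) = - cintegral nu I phi.
Proof.
move=> hphi; apply: (@BV_integration_by_parts phi (cdf nu) nu (fine (tvar nu setT))) => //.
- by move=> x _; exact: cdf_bounded.
- apply: (ae_imp (leb_off_countable (countable_charge_atoms nu))) => x xA _.
  by apply: cdf_continuous; apply: contrapT => /eqP.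
- by move=> x y _ xy _; exact: cdfB.
Qed.

Lemma leb_I_lty : (leb I < +oo)%E.
Proof. by rewrite lebesgue_measure_itv/= lte_fin ab ltry. Qed.

Lemma measurable_I : measurable (I : set (measurableTypeR R)).
Proof. exact: measurable_itv. Qed.

(** The derivative of the difference of two shifted primitives of trapezoids tends
boundedly to the difference of the indicators of the two intervals, and its
integral against [g] vanishes. *)
Lemma box_average_const (g : R -> R) : leb.-integrable I (EFin \o g) ->
  (forall phi, C01 a b phi -> \int[leb]_(x in I) (derive1 phi x * g x) = 0) ->
  forall x y e, 0 < e -> a < x -> a < y -> x + e < b -> y + e < b ->
  \int[leb]_(z in `]x, x + e]) g z = \int[leb]_(z in `]y, y + e]) g z.
Proof.
move=> ig g0 x y e e0 ax ay xb yb.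
have mI := measurable_I.
have mg : measurable_fun (I : set (measurableTypeR R)) (g : measurableTypeR R -> R).
  by apply/measurable_EFinP; exact: measurable_int ig.
pose P (m : nat) z := bump m.+1%:R^-1 e (z - x) - bump m.+1%:R^-1 e (z - y).
have mP m : measurable_fun [set: measurableTypeR R] (P m : measurableTypeR R -> R).
  apply: continuous_measurable_fun => z.
  have c w : bump m.+1%:R^-1 e (r - w) @[r --> z] --> bump m.+1%:R^-1 e (z - w).
    apply: (continuous_comp (f := fun x : R => x - w) (g := bump m.+1%:R^-1 e)).
      by apply: cvgB; [exact: cvg_id|exact: cvg_cst].
    exact: continuous_bump.
  by apply: cvgB; exact: c.
have Pb m z : `|P m z| <= 2.
  rewrite (le_trans (ler_normB _ _))//.
  by rewrite (_ : (2 : R) = 1 + 1)// lerD// bump_le1// invr_gt0.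
have sh w z : (\1_(`]0, e]%classic) (z - w) : R) = \1_(`]w, (w + e)]%classic) z.
  by rewrite !indicE !mem_setE !in_itv/= subr_gt0 lerBlDl.
have cP z : P m z @[m --> \oo] --> (\1_(`]x, (x + e)]%classic) z - \1_(`]y, (y + e)]%classic) z : R).
  by rewrite -!sh; apply: cvgB; exact: bump_cvg.
have ig2 : leb.-integrable I (EFin \o (fun z => 2 * `|g z|)).
  apply: (@integrableZl _ _ _ _ _ mI 2 (abse \o (EFin \o g))).
  exact: integrable_abse.
have Pgb : \forall z \ae leb, I z -> forall m, `|P m z * g z| <= 2 * `|g z|.
  by apply: aeW => z _ m; rewrite normrM ler_wpM2r.
have Pgc : \forall z \ae leb, I z -> P m z * g z @[m --> \oo] -->
    (\1_(`]x, (x + e)]%classic) z - \1_(`]y, (y + e)]%classic) z) * g z.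
  by apply: aeW => z _; exact: cvgM (cP z) (cvg_cst _).
have [_ c] := @dominated_Rintegral_cvg R leb I mI (fun m z => P m z * g z)
  (fun z => (\1_(`]x, (x + e)]%classic) z - \1_(`]y, (y + e)]%classic) z) * g z)
  (fun z => 2 * `|g z|)
  (fun m => measurable_funM (measurable_funTS (mP m)) mg) ig2
  Pgb Pgc.
(* for large m both trapezoids are supported in I *)
have z0 : \forall m \near \oo, \int[leb]_(z in I) (P m z * g z) = 0.
  near=> m.
  have hm : m.+1%:R^-1 < Num.min (b - (x + e)) (b - (y + e)).
    near: m; have [N hN] := archi_inv (r := Num.min (b - (x + e)) (b - (y + e)))
      (ltac:(by rewrite lt_min !subr_gt0 xb yb)).
    exists N => // m /= Nm; apply: le_lt_trans hN.
    by rewrite lef_pV2 ?posrE// ler_nat ltnS.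
  move: hm; rewrite lt_min => /andP[hx hy].
  have [C E] := @C01_bump R a b m.+1%:R^-1 e x y (ltac:(by rewrite invr_gt0)) (ltW e0) ax ay
    (ltac:(by rewrite -ltrBrDl)) (ltac:(by rewrite -ltrBrDl)).
  by have := g0 _ C; rewrite E.
have c0 : \int[leb]_(z in I) (P m z * g z) @[m --> \oo] --> (0 : R).
  exact: cvg_near_cst.
have := cvg_eq c c0.
have sub w : a < w -> w + e < b -> `]w, w + e]%classic `<=` I.
  move=> aw wb z /=; rewrite !in_itv/= => /andP[z1 z2].
  by rewrite (lt_trans aw z1) (le_lt_trans z2).
have iw w : a < w -> w + e < b ->
    leb.-integrable I (EFin \o (fun z => \1_(`]w, (w + e)]%classic) z * g z)).
  move=> aw wb; apply: (@le_integrable _ _ _ _ _ mI _ (EFin \o g)) => //.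
    apply/measurable_EFinP; apply: measurable_funM => //.
  move=> z _; rewrite lee_fin normrM indicE; case: (_ \in _) => /=.
    by rewrite normr1 mul1r.
  by rewrite normr0 mul0r.
have e1 w : a < w -> w + e < b ->
    \int[leb]_(z in I) (\1_(`]w, (w + e)]%classic) z * g z) = \int[leb]_(z in `]w, w + e]) g z.
  move=> aw wb; rewrite (Rintegral_support _ (sub w aw wb)).
    by apply: eq_Rintegral => z zw; rewrite indicE zw mul1r.
  by move=> z _ zw; rewrite indicE memNset// mul0r.
under eq_Rintegral do rewrite mulrBl.
rewrite RintegralB//; [|exact: iw..].
by rewrite !e1// => /subr0_eq.
Unshelve. all: by end_near. Qed.

(** By [box_average_const] the increments of the primitive of [g] do not depend on
the base point, so its difference quotients have the same limits at all points;
at almost every point this limit is [g], by Lebesgue differentiation. *)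
Lemma du_Bois_Reymond (g : R -> R) : leb.-integrable I (EFin \o g) ->
  (forall phi, C01 a b phi -> \int[leb]_(x in I) (derive1 phi x * g x) = 0) ->
  exists c, \forall x \ae leb, I x -> g x = c.
Proof.
move=> ig g0; have box := box_average_const ig g0.
have mI := measurable_I.
pose gg := g \_ I.
have igg : leb.-integrable setT (EFin \o gg).
  by rewrite -restrict_EFin; apply/(integrable_mkcond _ mI).
pose F y := \int[leb]_(t in `]-oo, y]) gg t.
have igy y : leb.-integrable `]-oo, y] (EFin \o gg).
  by apply: integrableS igg.
have FB x e : 0 < e -> a < x -> x + e < b -> F (x + e) - F x = \int[leb]_(z in `]x, x + e]) g z.
  move=> e0 ax xb; rewrite /F Rintegral_itvB//; last by rewrite bnd_simp lerDl ltW.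
  apply: eq_Rintegral => z; rewrite inE/= in_itv/= => /andP[z1 z2].
  by rewrite /gg /patch mem_set//= in_itv/= (lt_trans ax z1) (le_lt_trans z2).
(* difference quotients at any point are compared with those at the midpoint *)
pose m := (a + b) / 2.
have [am mb] : a < m /\ m < b by rewrite !midf_lt.
have nearF x : I x -> \forall h \near (0 : R)^', F (h + x) - F x = F (h + m) - F m.
  rewrite /= in_itv/= => /andP[ax xb].
  pose r := Num.min (Num.min (x - a) (b - x)) (Num.min (m - a) (b - m)).
  have r0 : 0 < r by rewrite !lt_min !subr_gt0 ax xb am mb.
  near=> h.
  have hr : `|h| < r by near: h; exact: dnbhs0_lt.
  move: hr; rewrite !lt_min => /andP[/andP[h1 h2] /andP[h3 h4]].
  have [h0|h0|->] := ltgtP h 0; last by rewrite !add0r !subrr.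
    rewrite (ltr0_norm h0) in h1 h3.
    have nh0 : 0 < - h by rewrite oppr_gt0.
    have ex := FB (x + h) (- h) nh0; have em := FB (m + h) (- h) nh0.
    have bx := box (x + h) (m + h) (- h) nh0.
    rewrite !addrK in ex em bx.
    rewrite !(addrC h) -[LHS]opprB -[RHS]opprB ex ?em//; [|lra..].
    by congr (- _); apply: bx => //; lra.
  rewrite (gtr0_norm h0) in h2 h4.
  rewrite !(addrC h) !FB//; [|lra..].
  by apply: box => //; lra.
exists (derive1 F m).
have ft := @FTC1Ny R gg igy (integrable_locally_restrict mI ig).
apply: (ae_imp ft) => x [_ Fx] Ix.
have -> : g x = gg x by rewrite /gg /patch mem_set.
rewrite -Fx /derive1; congr lim; rewrite eqEsubset; split; apply: near_eq_cvg;
  near=> h; congr (_ *: _); last apply/esym; near: h; exact: nearF.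
Unshelve. all: by end_near. Qed.

Lemma integrable_bounded_mul (A : set R) (h g : R -> R) M :
  measurable (A : set (measurableTypeR R)) ->
  measurable_fun (A : set (measurableTypeR R)) (h : measurableTypeR R -> R) ->
  (forall x, A x -> `|h x| <= M) -> leb.-integrable A (EFin \o g) ->
  leb.-integrable A (EFin \o (fun x => h x * g x)).
Proof.
move=> mA mh hM ig; apply: (@integrableMr _ _ _ _ _ mA h (EFin \o g)) => //.
exists M; split; first exact: num_real.
by move=> M' MM' x Ax; apply: (le_trans (hM x Ax)); exact: ltW.
Qed.

Lemma integrable_cdf (nu : signedR R) : leb.-integrable I (EFin \o cdf nu).
Proof.
apply: measurable_bounded_integrable; [exact: measurable_I|exact: leb_I_lty| |].
  by apply: measurable_funTS; exact: measurable_cdf.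
exists (fine (tvar nu setT)); split; first exact: num_real.
by move=> M' MM' x _; apply: (le_trans (cdf_bounded nu x)); exact: ltW.
Qed.

(** The distribution function of [nu] has distributional derivative [nu] on the
interval, so the du Bois-Reymond lemma applies to the difference. *)
Lemma BV_ae_cdf (u : R -> R) (nu : signedR R) : leb.-integrable I (EFin \o u) ->
  is_distributional_derivative a b u nu ->
  exists c, \forall x \ae leb, I x -> u x = c + cdf nu x.
Proof.
move=> iu [_ hnu]; have mI := measurable_I; have ic := integrable_cdf nu.
have [] := @du_Bois_Reymond (fun x => u x - cdf nu x).
- exact: (@integrableB _ _ _ _ _ mI (EFin \o u) (EFin \o cdf nu)).
- move=> phi hphi; have [dphi cphi _ _] := hphi.
  have [M M0 hM] := continuous_bounded_itv a b cphi.
  have mphi : measurable_fun (I : set (measurableTypeR R)) (derive1 phi : measurableTypeR R -> R).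
    by apply: measurable_funTS; exact: continuous_measurable_fun.
  have hM' x : I x -> `|derive1 phi x| <= M.
    by rewrite /= in_itv/= => /andP[x1 x2]; apply: hM; rewrite !ltW.
  under eq_Rintegral do rewrite mulrBr.
  rewrite RintegralB//; [|exact: integrable_bounded_mul hM' _..].
  by rewrite hnu// integration_by_parts_cdf// subrr.
- move=> c hc; exists c; apply: (ae_imp hc) => x hx Ix.
  by rewrite -(hx Ix) subrK.
Qed.

Lemma average_near (A : set R) (u : R -> R) (l e : R) :
  measurable (A : set (measurableTypeR R)) -> (0 < leb A < +oo)%E ->
  leb.-integrable A (EFin \o u) -> 0 <= e ->
  (\forall x \ae leb, A x -> `|u x - l| <= e) ->
  `|(fine (leb A))^-1 * (\int[leb]_(x in A) u x) - l| <= e.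
Proof.
move=> mA /andP[A0 Aoo] iu e0 hu.
have m0 : 0 < fine (leb A) by apply: fine_gt0; rewrite A0.
have il (k : R) : leb.-integrable A (EFin \o cst k).
  by apply: measurable_bounded_integrable => //; exact: bounded_cst.
have -> : l = (fine (leb A))^-1 * (\int[leb]_(x in A) (cst l) x).
  by rewrite Rintegral_cst// mulrCA mulVf ?mulr1// gt_eqF.
rewrite -mulrBr -RintegralB// normrM gtr0_norm ?invr_gt0// ler_pdivrMl//.
have iul : leb.-integrable A (EFin \o (fun x => u x - l)).
  exact: (@integrableB _ _ _ _ _ mA (EFin \o u) (EFin \o cst l)).
apply: (le_trans (le_normr_Rintegral mA iul)).
rewrite mulrC -Rintegral_cst//; apply: fine_le.
- by apply: integrable_fin_num => //; exact: integrable_norm.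
- by apply: integrable_fin_num => //; exact: il.
apply: ae_ge0_le_integral => //.
by apply: (measurable_int leb); exact: integrable_norm.
Qed.

(** The definition of [rlim] is by means over [x, x + h]; a function close to [l]
almost everywhere on such an interval has mean close to [l]. *)
Lemma rlim_val (u : R -> R) x l : leb.-integrable I (EFin \o u) -> I x ->
  (forall e, 0 < e -> exists2 d, 0 < d &
     \forall y \ae leb, I y -> x < y -> y < x + d -> `|u y - l| <= e) ->
  rlim u x = l.
Proof.
move=> iu; rewrite /= in_itv/= => /andP[ax xb] H; apply/cvg_lim => //.
apply/cvgrPdist_le => e e0; have [d d0 hd] := H _ e0; near=> h.
have h0 : 0 < h by near: h; exact: nbhs_right_gt.
have hb : h < b - x by near: h; apply: nbhs_right_lt; rewrite subr_gt0.
have hhd : h < d by near: h; exact: nbhs_right_lt.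
have lA : leb `[x, (x + h)]%classic = h%:E.
  by rewrite lebesgue_measure_itv/= lte_fin ltrDl h0 -EFinB addrC addKr.
have := @average_near `[x, (x + h)]%classic u l e (measurable_itv _).
rewrite lA/= distrC; apply.
- by rewrite lte_fin h0 ltry.
- apply: integrableS iu; [exact: measurable_I|exact: measurable_itv|].
  by move=> y /=; rewrite !in_itv/= => /andP[y1 y2]; apply/andP; split; lra.
- exact: ltW.
- apply: (ae_imp2 hd (leb_off_countable (countable1 x))) => y h1 h2.
  rewrite /= in_itv/= => /andP[y1 y2]; apply: h1.
  + by rewrite /= in_itv/=; apply/andP; split; lra.
  + by rewrite lt_neqAle y1 andbT; apply/eqP => xy; apply: h2.
  + lra.
Unshelve. all: by end_near. Qed.

Lemma llim_val (u : R -> R) x l : leb.-integrable I (EFin \o u) -> I x ->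
  (forall e, 0 < e -> exists2 d, 0 < d &
     \forall y \ae leb, I y -> y < x -> x - d < y -> `|u y - l| <= e) ->
  llim u x = l.
Proof.
move=> iu; rewrite /= in_itv/= => /andP[ax xb] H; apply/cvg_lim => //.
apply/cvgrPdist_le => e e0; have [d d0 hd] := H _ e0; near=> h.
have h0 : 0 < h by near: h; exact: nbhs_right_gt.
have hb : h < x - a by near: h; apply: nbhs_right_lt; rewrite subr_gt0.
have hhd : h < d by near: h; exact: nbhs_right_lt.
have lA : leb `[(x - h), x]%classic = h%:E.
  by rewrite lebesgue_measure_itv/= lte_fin ltrBlDr ltrDl h0 -EFinB subKr.
have := @average_near `[(x - h), x]%classic u l e (measurable_itv _).
rewrite lA/= distrC; apply.
- by rewrite lte_fin h0 ltry.
- apply: integrableS iu; [exact: measurable_I|exact: measurable_itv|].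
  by move=> y /=; rewrite !in_itv/= => /andP[y1 y2]; apply/andP; split; lra.
- exact: ltW.
- apply: (ae_imp2 hd (leb_off_countable (countable1 x))) => y h1 h2.
  rewrite /= in_itv/= => /andP[y1 y2]; apply: h1.
  + by rewrite /= in_itv/=; apply/andP; split; lra.
  + by rewrite lt_neqAle y2 andbT; apply/eqP => xy; apply: h2.
  + lra.
Unshelve. all: by end_near. Qed.

Lemma Dist_spec (u : R -> R) : BV a b u -> is_distributional_derivative a b u (Dist a b u).
Proof.
move=> [_ ex]; rewrite /Dist /choose_or; case: pselect => // h; exact: (projT2 (cid h)).
Qed.

(** The constant is the same in all three formulas, which makes the distribution
function a representative from which both one-sided limits can be read. *)
Lemma BV_limits (u : R -> R) : BV a b u -> exists c,
  [/\ forall x, I x -> rlim u x = c + cdf (Dist a b u) x,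
      forall x, I x -> llim u x = c + lcdf (Dist a b u) x &
      \forall x \ae leb, I x -> u x = c + cdf (Dist a b u) x].
Proof.
move=> hu; have [iu _] := hu; have [c hc] := BV_ae_cdf iu (Dist_spec hu).
exists c; split => // x Ix.
- apply: rlim_val => // e e0; have [d d0 hd] := cdf_right (Dist a b u) x e0.
  exists d => //; apply: (ae_imp hc) => y hy Iy xy yd.
  by rewrite (hy Iy) opprD addrACA subrr add0r ltW// hd// ltW.
- apply: llim_val => // e e0; have [d d0 hd] := cdf_left (Dist a b u) x e0.
  exists d => //; apply: (ae_imp hc) => y hy Iy xy yd.
  by rewrite (hy Iy) opprD addrACA subrr add0r ltW// hd.
Qed.

End BVStructure.

(** * Lebesgue decomposition *)

Section LebesgueDecomposition.
Variable R : realType.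

(** Exhaustion: take [rho]-null sets whose [mu]-measures approach the supremum; no
[rho]-null set outside their union can have positive [mu]-measure. *)
Lemma maximal_null_set (rho mu : {measure set (measurableTypeR R) -> \bar R}) :
  (mu setT < +oo)%E ->
  exists Z : set (measurableTypeR R), [/\ measurable Z, rho Z = 0%E &
    forall A, measurable A -> rho A = 0%E -> mu (A `\` Z) = 0%E].
Proof.
move=> muT.
pose S := [set mu Z | Z in [set Z : set (measurableTypeR R) | measurable Z /\ rho Z = 0%E]].
have S0 : S (mu set0) by exists set0 => //; split => //; exact: measure0.
have Sub s : S s -> (s <= mu setT)%E by move=> [Z [mZ _] <-]; exact: le_measureT.
have supf : ereal_sup S \is a fin_num.
  rewrite ge0_fin_numE; last by apply: le_trans (ereal_sup_ubound S0); exact: measure_ge0.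
  by apply: le_lt_trans muT; exact: ge_ereal_sup.
have /choice[Zs hZs] : forall n : nat, exists Zn : set (measurableTypeR R),
    [/\ measurable Zn, rho Zn = 0%E & (ereal_sup S - n.+1%:R^-1%:E < mu Zn)%E].
  move=> n; have n0 : 0 < n.+1%:R^-1 :> R by rewrite invr_gt0.
  by have [_ [Z [mZ Z0] <-] hZ] := ub_ereal_sup_adherent n0 supf; exists Z.
pose Z := \bigcup_n Zs n.
have mZ : measurable (Z : set (measurableTypeR R)).
  by apply: bigcup_measurable => n _; have [] := hZs n.
have Z0 : rho Z = 0%E.
  apply/eqP; rewrite eq_le measure_ge0 andbT.
  apply: (le_trans (measure_sigma_subadditive _ _ mZ (@subset_refl _ _))).
    by move=> n; have [] := hZs n.
  by rewrite eseries0// => n _ _; have [] := hZs n.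
exists Z; split => // A mA A0.
have mAZ : measurable (A `\` Z : set (measurableTypeR R)) by exact: measurableD.
have AZf : mu (A `\` Z) \is a fin_num.
  by rewrite ge0_fin_numE//; apply: le_lt_trans muT; exact: le_measureT.
apply/eqP; rewrite eq_le measure_ge0 andbT leNgt; apply/negP => pos.
have [n hn] := archi_inv (fine_gt0 (introT andP (conj pos (le_lt_trans (le_measureT mu mAZ) muT)))).
have [mn n0 ltn] := hZs n.
have : S (mu (Zs n `|` (A `\` Z))).
  exists (Zs n `|` (A `\` Z)) => //; split; first exact: measurableU.
  apply: null_set_setU => //.
  apply/eqP; rewrite eq_le measure_ge0 andbT -A0.
  by apply: le_measure; rewrite ?inE//; exact: subDsetl.
move=> /ereal_sup_ubound; rewrite measureU//; last first.
  by rewrite -subset0 => x [xn [_]]; apply; exists n.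
apply/negP; rewrite -ltNge.
have nf : mu (Zs n) \is a fin_num.
  by rewrite ge0_fin_numE//; apply: le_lt_trans muT; exact: le_measureT.
move: ltn hn; rewrite -{1}(fineK supf) -{1}(fineK nf) -EFinB lte_fin => ltn hn.
apply: (@lt_le_trans _ _ (fine (mu (Zs n)) + fine (mu (A `\` Z)))%:E).
  by rewrite -(fineK supf) lte_fin; rewrite ltrBlDr in ltn; apply: lt_trans ltn _; rewrite ltrD2l.
by rewrite EFinD !fineK.
Qed.

(** Off a maximal [rho]-null set for the total variation of [nu], the charge is
dominated by [rho] and has a Radon-Nikodym density. *)
Lemma charge_lebesgue_decomposition
    (rho : {sigma_finite_measure set (measurableTypeR R) -> \bar R}) (nu : signedR R) :
  exists (Z : set (measurableTypeR R)) (g : R -> R),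
  [/\ measurable Z, rho Z = 0%E, rho.-integrable setT (EFin \o g) &
      forall A, measurable A -> nu (A `\` Z) = (\int[rho]_(x in A) (g x)%:E)%E].
Proof.
have [Z [mZ Z0 hZ]] := maximal_null_set rho (tvarT nu).
have mZC : measurable (~` Z : set (measurableTypeR R)) by exact: measurableC.
pose ac : signedR R := crestr0 nu mZC.
have acE A : measurable A -> ac A = nu (A `\` Z).
  by move=> mA; rewrite /ac/= /crestr0 mem_set// /crestr setDE.
have dom : ac `<< rho.
  apply/null_content_dominatesP => A mA A0; rewrite acE//.
  apply/eqP; rewrite -abse_eq0 eq_le abse_ge0 andbT -(hZ _ mA A0).
  by apply: abse_charge_variation; exact: measurableD.
exists Z, (fun x => fine (Radon_Nikodym ac rho x)); split => //.
- apply: eq_integrable (Radon_Nikodym_integrable dom) => // x _ /=.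
  by rewrite fineK//; exact: Radon_Nikodym_fin_num.
- move=> A mA; rewrite -acE// (Radon_Nikodym_integral dom mA).
  apply: eq_integral => x _; rewrite fineK//; exact: Radon_Nikodym_fin_num.
Qed.

Lemma finite_measure_lebesgue_decomposition
    (rho : {sigma_finite_measure set (measurableTypeR R) -> \bar R})
    (mu : {finite_measure set (measurableTypeR R) -> \bar R}) :
  exists (Z : set (measurableTypeR R)) (g : R -> R),
  [/\ measurable Z, rho Z = 0%E, rho.-integrable setT (EFin \o g) &
      forall A, measurable A -> mu (A `\` Z) = (\int[rho]_(x in A) (g x)%:E)%E].
Proof. exact: (charge_lebesgue_decomposition rho (charge_of_finite_measure mu)). Qed.

End LebesgueDecomposition.

(** * Atomic parts of charges and the decomposition of a derivative *)

Section CountableCharge.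
Variable R : realType.
Implicit Types (nu : signedR R) (C : set R).
Local Notation count := (@counting (measurableTypeR R) R).

Lemma integrable_counting_finite (mu : {finite_measure set (measurableTypeR R) -> \bar R}) C :
  countable C -> count.-integrable C (EFin \o (fun x => fine (mu [set x]))).
Proof.
move=> cC; have mC := countable_measurable_real cC.
apply/integrableP; split; first exact: measurable_fun_countable.
rewrite (eq_integral (fun x => mu [set x])); last first.
  move=> x _ /=; rewrite ger0_norm ?fine_ge0// fineK//; exact: fin_num_measure.
by rewrite integral_counting_measure// ltey_eq fin_num_measure.
Qed.

Lemma Rintegral_counting_finite (mu : {finite_measure set (measurableTypeR R) -> \bar R}) C :
  countable C -> \int[count]_(x in C) fine (mu [set x]) = fine (mu C).
Proof.
move=> cC; rewrite -integral_counting_measure//; congr fine.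
by apply: eq_integral => x _; rewrite fineK//; exact: fin_num_measure.
Qed.

Lemma charge_set1 nu x : fine (nu [set x]) =
  fine (jordan_pos (hahnP nu) [set x]) - fine (jordan_neg (hahnP nu) [set x]).
Proof. by apply: charge_jordan; exact: measurable_set1. Qed.

Lemma integrable_counting_charge nu C : countable C ->
  count.-integrable C (EFin \o (fun x => fine (nu [set x]))).
Proof.
move=> cC; have mC := countable_measurable_real cC.
under eq_fun do rewrite charge_set1.
exact: (@integrableB _ _ _ _ _ mC
  (EFin \o (fun x => fine (jordan_pos (hahnP nu) [set x])))
  (EFin \o (fun x => fine (jordan_neg (hahnP nu) [set x])))
  (integrable_counting_finite _ cC) (integrable_counting_finite _ cC)).
Qed.

Lemma Rintegral_counting_charge nu C : countable C ->
  \int[count]_(x in C) fine (nu [set x]) = fine (nu C).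
Proof.
move=> cC; have mC := countable_measurable_real cC.
under eq_Rintegral do rewrite charge_set1.
rewrite RintegralB//; [|exact: integrable_counting_finite..].
by rewrite !Rintegral_counting_finite// charge_jordan.
Qed.

Lemma charge_countable0 nu C : countable C ->
  (forall x, C x -> nu [set x] = 0%E) -> nu C = 0%E.
Proof.
move=> cC C0; have mC := countable_measurable_real cC.
rewrite -[nu C]fineK ?fin_num_measure// -Rintegral_counting_charge//.
congr EFin; rewrite -[RHS](mul0r (fine (count C))) -Rintegral_cst//.
by apply: eq_Rintegral => x /set_mem /C0 ->.
Qed.

End CountableCharge.

Section Decomposition.
Variables (R : realType) (a b : R) (ab : a < b).
Local Notation I := (`]a, b[%classic : set R).
Local Notation count := (@counting (measurableTypeR R) R).
Implicit Type u : R -> R.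

Lemma jumpE u x : BV a b u -> I x ->
  rlim u x - llim u x = fine (Dist a b u [set x]).
Proof.
move=> hu Ix; have [c [hr hl _]] := BV_limits ab hu.
by rewrite hr// hl// -cdf_jump opprD addrACA subrr add0r.
Qed.

Lemma jump_setE u : BV a b u ->
  jump_set a b u = [set x | I x /\ fine (Dist a b u [set x]) != 0].
Proof.
move=> hu; apply/seteqP; split => x [Ix h]; refine (conj Ix _).
  by rewrite -(jumpE hu Ix) subr_eq0; apply/eqP => e; apply: h; exact: esym e.
move=> e; move: h; rewrite -(jumpE hu Ix) (esym e) subrr; exact/negP/negPn.
Qed.

Lemma countable_jump_set u : BV a b u -> countable (jump_set a b u).
Proof.
move=> hu; rewrite jump_setE//; apply: sub_countable (countable_charge_atoms (Dist a b u)).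
by apply: subset_card_le => x [].
Qed.

Lemma charge_atom_out u x : BV a b u -> ~ jump_set a b u x -> Dist a b u [set x] = 0%E.
Proof.
move=> hu xJ; have [nI _] := Dist_spec hu.
have [Ix|nIx] := pselect (I x); last first.
  by apply: nI; [exact: measurable_set1|move=> _ ->].
apply/eqP; rewrite -[Dist a b u [set x]]fineK ?eqe//; last first.
  by apply: fin_num_measure; exact: measurable_set1.
by apply: contrapT => h; apply: xJ; rewrite jump_setE//; split => //; exact/negP.
Qed.

(** The absolutely continuous part is that of the Lebesgue decomposition with
respect to Lebesgue measure; the Cantor part is the restriction of [Du] to the
singular set deprived of the jump set, which contains all atoms. *)
Lemma decomposition_exists u : BV a b u -> exists p, is_decomposition a b u p.
Proof.
move=> hu; pose nu := Dist a b u; have [nI _] := Dist_spec hu.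
have [Z [g [mZ Z0 ig hg]]] := charge_lebesgue_decomposition (@lebesgue_measure R) nu.
pose J := jump_set a b u; have cJ : countable J by exact: countable_jump_set.
have mJ : measurable (J : set (measurableTypeR R)) by exact: countable_measurable_real.
have mI : measurable (I : set (measurableTypeR R)) by exact: measurable_itv.
have mK : measurable ((Z `&` I) `\` J : set (measurableTypeR R)).
  by apply: measurableD => //; exact: measurableI.
pose kappa : signedR R := crestr0 nu mK.
have kE A : measurable A -> kappa A = nu (A `&` ((Z `&` I) `\` J)).
  by move=> mA; rewrite /kappa/= /crestr0 mem_set.
exists (g, kappa); rewrite /is_decomposition/=.
have sJ (A : set R) : rsummable (A `&` J) (fun x => rlim u x - llim u x).
  have cAJ : countable (A `&` J).
    by apply: sub_countable cJ; apply: subset_card_le; exact: subIsetr.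
  apply/(integrable_counting _ cAJ).
  apply: eq_integrable (integrable_counting_charge nu cAJ) => //.
    exact: countable_measurable_real.
  by move=> x /set_mem[_ [Ix _]] /=; rewrite jumpE.
split.
- by apply: integrableS ig.
- split; [|split].
  + move=> A mA AI; rewrite kE// (_ : _ `&` _ = set0) ?charge0//.
    by rewrite -subset0 => x [Ax [[_ Ix] _]]; exact: (AI _ Ax).
  + move=> x; rewrite kE; last exact: measurable_set1.
    have [[[Zx Ix] Jx]|h] := pselect (((Z `&` I) `\` J) x).
      rewrite (_ : _ `&` _ = [set x]); first exact: charge_atom_out.
      by apply/seteqP; split => [y []//|y ->].
    rewrite (_ : _ `&` _ = set0) ?charge0//.
    by rewrite -subset0 => y [-> ].
  + exists Z; split => // A mA AZ; rewrite kE// (_ : _ `&` _ = set0) ?charge0//.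
    by rewrite -subset0 => x [Ax [[Zx _] _]]; exact: (AZ _ Ax).
- by have := sJ setT; rewrite setTI.
- move=> A mA AI.
  have cAJ : countable (A `&` J).
    by apply: sub_countable cJ; apply: subset_card_le; exact: subIsetr.
  have mAJ : measurable (A `\` J : set (measurableTypeR R)) by exact: measurableD.
  have -> : (\int[leb]_(x in A) (g x)%:E = \int[leb]_(x in A `\` J) (g x)%:E)%E.
    apply: negligible_integral => //; last exact: countable_lebesgue_measure0.
    by apply: integrableS ig.
  rewrite -hg//.
  have -> : rsum (A `&` J) (fun x => rlim u x - llim u x) = fine (nu (A `&` J)).
    rewrite -Rintegral_counting// -Rintegral_counting_charge//.
    by apply: eq_Rintegral => x /set_mem[_ [Ix _]]; rewrite jumpE.
  rewrite fineK; last by apply: fin_num_measure; exact: measurableI.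
  rewrite kE//.
  rewrite -chargeU//.
  + rewrite -chargeU//.
    * congr (Dist a b u _); apply/seteqP; split => [x Ax|x [[[[]]|[]]|[]]//].
      have [Jx|nJx] := pselect (J x); first by right.
      left; have [Zx|nZx] := pselect (Z x); last by left.
      by right; split => //; split => //; split => //; exact: AI.
    * apply: measurableU; [exact: measurableD|exact: measurableI].
    * exact: measurableI.
    * by rewrite -subset0 => x [[[[_ nJ] _]|[_ [_ nJ]]] [_ Jx]]; exact: nJ.
  + exact: measurableD.
  + exact: measurableI.
  + by rewrite -subset0 => x [[_ nZ] [_ [[Zx _] _]]]; exact: nZ.
Qed.

(** The density and the Cantor part are selected by choice, among all pairs with
these properties. *)
Lemma decomposition_spec u : BV a b u ->
  is_decomposition a b u (nabla a b u, Dcantor a b u).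
Proof.
move=> /decomposition_exists ex; rewrite /nabla /Dcantor /decomposition /choose_or.
by case: pselect => // h; case: (cid h) => -[g k].
Qed.

Lemma integrable_nabla u : BV a b u -> leb.-integrable I (EFin \o nabla a b u).
Proof. by move=> /decomposition_spec[]. Qed.

Lemma Dcantor_no_atoms u : BV a b u -> no_atoms (Dcantor a b u).
Proof. by move=> /decomposition_spec[_ [_ []]]. Qed.

(** The atoms may be summed over any countable set containing the jumps, as the
other points of it carry no mass; one set then serves all the functions of the
chain rule at once. *)
Lemma Dist_split u (C A : set (measurableTypeR R)) : BV a b u -> countable C ->
  jump_set a b u `<=` C -> measurable A -> A `<=` I ->
  fine (Dist a b u A) = \int[leb]_(x in A) nabla a b u x + fine (Dcantor a b u A)
     + \int[count]_(x in A `&` C) fine (Dist a b u [set x]).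
Proof.
move=> hu cC JC mA AI; have mC := countable_measurable_real cC.
have mI : measurable (I : set (measurableTypeR R)) by exact: measurable_itv.
have cAC : countable (A `&` C).
  by apply: sub_countable cC; apply: subset_card_le; exact: subIsetr.
have mAC : measurable (A `&` C) by exact: measurableI.
have mAD : measurable (A `\` C) by exact: measurableD.
have [ig [_ [na _]] _ H] := decomposition_spec hu.
(* on A minus C there are no jumps, and C is null for the two diffuse parts *)
rewrite Rintegral_counting_charge// -{1}[A](setUIDK A C) setUC charge_valU//; last first.
  by rewrite -subset0 => x [[_ nC] [_ Cx]]; exact: nC.
congr (_ + _).
have /= -> := H _ mAD (subset_trans (@subDsetl _ _ _) AI).
rewrite (_ : _ `&` jump_set a b u = set0); last first.
  by rewrite -subset0 => x [[_ nC] /JC Cx]; exact: nC.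
rewrite (_ : rsum set0 _ = 0); last by rewrite /rsum !esum_set0/= subrr.
rewrite adde0 fineD; last 2 first.
- by apply: integrable_fin_num => //; apply: integrableS ig => //; exact: subset_trans AI.
- exact: fin_num_measure.
congr (_ + _).
  rewrite /Rintegral -negligible_integral//; last exact: countable_lebesgue_measure0.
  by apply: integrableS ig.
rewrite -[in RHS](setUIDK A C) setUC charge_valU//; last first.
  by rewrite -subset0 => x [[_ nC] [_ Cx]]; exact: nC.
by rewrite (@charge_countable0 _ _ (A `&` C))//= addr0.
Qed.

End Decomposition.

(** * Charges and inequalities obtained from increments and integrals *)

Section StieltjesCharge.
Variables (R : realType) (a b : R) (ab : a < b).
Local Notation I := (`]a, b[%classic : set R).

Lemma Stieltjes_charge (F : R -> R) : {homo F : x y / x <= y} ->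
  (forall x e, 0 < e -> exists2 d, 0 < d & forall y, x <= y -> y < x + d -> `|F y - F x| < e) ->
  exists nu : signedR R, nu.-null_set (~` I) /\
    forall x y, a < x -> x <= y -> y < b -> fine (nu `]x, y]%classic) = F y - F x.
Proof.
move=> ndF rcF.
have rc : right_continuous F.
  move=> x; apply/cvgrPdist_lt => e e0; have [d d0 hd] := rcF x e e0; near=> y.
  rewrite distrC; apply: hd; first by near: y; exact: nbhs_right_ge.
  by near: y; apply: nbhs_right_lt; rewrite ltrDl.
pose G : cumulative R R := HB.pack_for (cumulative R R) F (isCumulative.Build R _ R F ndF rc).
pose mu := lebesgue_stieltjes_measure G.
have muE x y : x <= y -> mu `]x, y]%classic = (F y - F x)%:E.
  move=> xy; rewrite /mu /lebesgue_stieltjes_measure /measure_extension measurable_mu_extE/=; last exact: is_ocitv.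
  by rewrite wlength_itv_bnd.
have mI : measurable (I : set (measurableTypeR R)) by exact: measurable_itv.
have muI : (mu I < +oo)%E.
  apply: (@le_lt_trans _ _ (mu `]a, b]%classic)).
    by apply: le_measure; rewrite ?inE; [exact: measurable_itv..|exact: subset_itv_oo_oc].
  by rewrite muE ?ltry// ltW.
exists (charge_of_finite_measure (mfrestr mI muI)); split.
  move=> A mA AI; rewrite /charge_of_finite_measure/= /mfrestr/mrestr/=.
  by rewrite (_ : A `&` I = set0) ?measure0// -subset0 => x [/AI].
move=> x y ax xy yb; rewrite /charge_of_finite_measure/= /mfrestr /mrestr/=.
have E : `]x, y]%classic `&` I = `]x, y]%classic.
  apply/setIidPl => z /=; rewrite !in_itv/= => /andP[h1 h2].
  by rewrite (lt_trans ax h1) (le_lt_trans h2 yb).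
by rewrite E -[lebesgue_stieltjes_measure G _]/(mu _) muE.
Unshelve. all: by end_near. Qed.

End StieltjesCharge.

Section AlmostEverywhereComparison.
Variables (R : realType) (rho : {measure set (measurableTypeR R) -> \bar R}).

(** Test on the set where [f > g], deprived of [Bad]: there the nonnegative function
[f - g] has nonpositive integral. *)
Lemma ae_le_of_integrals (D Bad : set (measurableTypeR R)) (f g : R -> R) :
  measurable D -> measurable Bad -> rho Bad = 0%E ->
  rho.-integrable D (EFin \o f) -> rho.-integrable D (EFin \o g) ->
  (forall A : set (measurableTypeR R), measurable A -> A `<=` D -> A `&` Bad = set0 ->
    \int[rho]_(x in A) f x <= \int[rho]_(x in A) g x) ->
  \forall x \ae rho, D x -> f x <= g x.
Proof.
move=> mD mB B0 fi gi H.
pose h x := f x - g x.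
have hi : rho.-integrable D (EFin \o h).
  exact: (@integrableB _ _ _ _ _ mD (EFin \o f) (EFin \o g)).
have mh : measurable_fun D (h : measurableTypeR R -> R).
  by apply/measurable_EFinP; exact: measurable_int hi.
pose A := (D `&` [set x | 0 < h x]) `\` Bad.
have mA : measurable (A : set (measurableTypeR R)).
  apply: measurableD => //.
  rewrite (_ : [set x | 0 < h x] = h @^-1` `]0, +oo[%classic); first exact: mh.
  by apply/seteqP; split => x /=; rewrite in_itv/= andbT.
have AD : A `<=` D by move=> x [[]].
have AB : A `&` Bad = set0 by rewrite -subset0 => x [[_ nB] Bx]; exact: nB.
have hA := H A mA AD AB.
have fA : rho.-integrable A (EFin \o f) by apply: integrableS fi.
have gA : rho.-integrable A (EFin \o g) by apply: integrableS gi.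
have h'A : rho.-integrable A (EFin \o h) by apply: integrableS hi.
have hA0 : (\int[rho]_(x in A) `|(h x)%:E| = 0)%E.
  have -> : (\int[rho]_(x in A) `|(h x)%:E| = \int[rho]_(x in A) (h x)%:E)%E.
    by apply: eq_integral => x /set_mem[[_ /= h0] _] /=; rewrite gtr0_norm.
  apply/eqP; rewrite eq_le; apply/andP; split; last first.
    by apply: integral_ge0 => x [[_ /= h0] _]; rewrite lee_fin ltW.
  rewrite -[X in (X <= _)%E]fineK; last exact: integrable_fin_num.
  by rewrite lee_fin -[fine _]/(\int[rho]_(x in A) h x) RintegralB// subr_le0.
have mhA : measurable_fun A (EFin \o h) by exact: measurable_int h'A.
have aeA : \forall x \ae rho, A x -> (EFin \o h) x = cst 0%E x.
  by apply/(ae_eq_integral_abs rho mA mhA); exact: hA0.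
have aeB : \forall x \ae rho, ~ Bad x by exists Bad; split => // x /= /contrapT.
apply: (ae_imp2 aeA aeB) => x hx nB Dx; rewrite leNgt; apply/negP => fg.
have Ax : A x by split => //; split => //=; rewrite /h subr_gt0.
by have := hx Ax => /= -[]; apply/eqP; rewrite /h gt_eqF// subr_gt0.
Qed.

End AlmostEverywhereComparison.

(** * Functions of a row vector *)

Section RowVectors.
Variables (R : realType) (n : nat).
Implicit Types (w z v : 'rV[R]_n.+1) (f g : 'rV[R]_n.+1 -> R).

Lemma coord_le_norm w i : `|w ord0 i| <= `|w|.
Proof.
rewrite [X in _ <= X]mx_normrE.
exact: (le_bigmax _ (fun ij => `|w ij.1 ij.2|) (ord0, i)).
Qed.

Lemma norm_le_coord w r : 0 <= r -> (forall i, `|w ord0 i| <= r) -> `|w| <= r.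
Proof.
move=> r0 h; rewrite [X in X <= _]mx_normrE; apply: bigmax_le => // -[j i] _ /=.
by rewrite (ord1 j).
Qed.

Lemma enorm_le w : enorm w <= n.+1%:R * `|w|.
Proof.
have n1 : 1 <= n.+1%:R :> R by rewrite ler1n.
rewrite /enorm -(ler_pXn2r (n := 2))// ?nnegrE ?sqrtr_ge0 ?mulr_ge0//.
rewrite sqr_sqrtr; last by apply: sumr_ge0 => i _; exact: sqr_ge0.
apply: (@le_trans _ _ (n.+1%:R * `|w| ^+ 2)); last first.
  by rewrite exprMn ler_wpM2r ?sqr_ge0// expr2 ler_peMl// (le_trans ler01).
apply: (@le_trans _ _ (\sum_(i < n.+1) `|w| ^+ 2)); last first.
  by rewrite sumr_const card_ord -[leLHS]mulr_natl lexx.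
apply: ler_sum => i _.
by rewrite -real_normK ?num_real// ler_pXn2r ?nnegrE// coord_le_norm.
Qed.

Lemma coord_le_enorm w i : `|w ord0 i| <= enorm w.
Proof.
rewrite /enorm -sqrtr_sqr ler_wsqrtr// (bigD1 i)//= lerDl.
by apply: sumr_ge0 => j _; exact: sqr_ge0.
Qed.

Lemma compact_closed_ball0 r : compact [set w : 'rV[R]_n.+1 | `|w| <= r].
Proof.
apply: bounded_closed_compact.
  exists r; split; first exact: num_real.
  by move=> r' rr' w /= wr; apply: le_trans wr _; exact: ltW.
rewrite (_ : [set w | _] = (fun w : 'rV[R]_n.+1 => `|w|) @^-1` [set t | t <= r])//.
by apply: closed_comp => [w _|]; [exact: norm_continuous|exact: closed_le].
Qed.

Lemma directional_derivative_sum f v z : differentiable f z ->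
  'D_v f z = \sum_i grad f z ord0 i * v ord0 i.
Proof.
move=> df; rewrite deriveE// {1}(row_sum_delta v) linear_sum/=.
by apply: eq_bigr => i _; rewrite linearZ/= mxE deriveE// mulrC.
Qed.

Lemma MVT_row f w z : (forall x, differentiable f x) ->
  exists s, [/\ 0 <= s <= 1 & f z - f w =
    \sum_i grad f (w + s *: (z - w)) ord0 i * (z - w) ord0 i].
Proof.
move=> df; pose v := z - w; pose g (s : R) := f (w + s *: v).
have dg (s : R) : is_derive s (1 : R) g ('D_v f (w + s *: v)).
  have dv : derivable f (w + s *: v) v by exact: diff_derivable.
  have E : (fun h : R => h^-1 *: (g (h *: (1 : R) + s) - g s)) =
      (fun h : R => h^-1 *: (f (h *: v + (w + s *: v)) - f (w + s *: v))).
    apply/funext => h; rewrite /g [h *: 1]mulr1 scalerDl.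
    by rewrite addrCA.
  apply: DeriveDef; first by rewrite /derivable; under eq_fun do rewrite [_ *: _]/=; rewrite E.
  by rewrite /derive E.
have cg : {within `[0, 1], continuous g}.
  apply: continuous_subspaceT => s; apply: differentiable_continuous.
  by apply/derivable1_diffP; exact: ex_derive.
have [s s01 e] := @MVT R g (fun s => 'D_v f (w + s *: v)) 0 1 ltr01 (fun s _ => dg s) cg.
exists s; split.
  by move: s01; rewrite in_itv/= => /andP[/ltW -> /ltW ->].
have g1 : g 1 = f z by rewrite /g /v scale1r addrC subrK.
have g0 : g 0 = f w by rewrite /g scale0r addr0.
move: e; rewrite g1 g0 subr0 mulr1 => ->.
exact: directional_derivative_sum.
Qed.

Lemma segment_norm_le w z s r : 0 <= s <= 1 -> `|w| <= r -> `|z| <= r ->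
  `|w + s *: (z - w)| <= r.
Proof.
move=> /andP[s0 s1] wr zr.
rewrite (_ : w + s *: (z - w) = (1 - s) *: w + s *: z); last first.
  by rewrite scalerBr scalerBl scale1r addrCA addrC -addrA addrC.
apply: (le_trans (ler_normD _ _)); rewrite !mx_normZ !ger0_norm ?subr_ge0//.
apply: (@le_trans _ _ ((1 - s) * r + s * r)); last by rewrite -mulrDl subrK mul1r.
by apply: lerD; apply: ler_wpM2l => //; rewrite subr_ge0.
Qed.

(** Passage to the limit in difference quotients. *)
Lemma partial_dist_le f g w i K : differentiable f w -> differentiable g w ->
  (forall h : R, `|h| < 1 ->
    `|(f (h *: delta_mx ord0 i + w) - f w) - (g (h *: delta_mx ord0 i + w) - g w)| <= K * `|h|) ->
  `|grad f w ord0 i - grad g w ord0 i| <= K.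
Proof.
move=> df dg H; rewrite !mxE; set e := delta_mx ord0 i.
have cf : derivable f w e by exact: diff_derivable.
have cg : derivable g w e by exact: diff_derivable.
have c := cvgB cf cg.
have FF : Filter (dnbhs (0 : R)) by exact _.
have cn := cvg_norm (c FF).
rewrite -(cvg_lim (@Rhausdorff R) (cn FF)); apply: limr_le.
  by apply/cvg_ex; eexists; exact: cn FF.
near=> h => /=.
have h0 : h != 0 by near: h; exact: nbhs_dnbhs_neq.
have h1 : `|h| < 1 by near: h; exact: dnbhs0_lt.
rewrite [X in `|X| <= _](_ : _ = h^-1 * ((f (h *: e + w) - f w) - (g (h *: e + w) - g w)));
  last by rewrite mulrBr.
rewrite normrM normfV.
rewrite ler_pdivrMl ?normr_gt0// mulrC; exact: H.
Unshelve. all: by end_near. Qed.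

End RowVectors.

(** * One-sided representatives of BV functions *)

Section OneSidedRepresentatives.
Variables (R : realType) (a b : R) (ab : a < b).
Local Notation I := (`]a, b[%classic : set R).
Implicit Type u : R -> R.

(** The right- and left-continuous representatives of a BV function; the additive
constant is fixed by the right limit at the midpoint.  They are defined on the
whole line, and equal to the right and left limits on the interval. *)
Definition rrep u x : R :=
  rlim u ((a + b) / 2) - cdf (Dist a b u) ((a + b) / 2) + cdf (Dist a b u) x.
Definition lrep u x : R :=
  rlim u ((a + b) / 2) - cdf (Dist a b u) ((a + b) / 2) + lcdf (Dist a b u) x.

Lemma rrep_limits u : BV a b u ->
  [/\ forall x, I x -> rlim u x = rrep u x,
      forall x, I x -> llim u x = lrep u x &
      \forall x \ae leb, I x -> u x = rrep u x].
Proof.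
move=> hu; have [c [hr hl hae]] := BV_limits ab hu.
have mI : I ((a + b) / 2) by rewrite /= in_itv/= !midf_lt.
have cE : rlim u ((a + b) / 2) - cdf (Dist a b u) ((a + b) / 2) = c.
  by rewrite hr// addrK.
by rewrite /rrep /lrep cE; split.
Qed.

Lemma rrepB u x y : x <= y -> rrep u y - rrep u x = fine (Dist a b u `]x, y]%classic).
Proof. by move=> xy; rewrite -cdfB// /rrep; ring. Qed.

Lemma lrep_rrepB u x y : x < y -> lrep u y - rrep u x = fine (Dist a b u `]x, y[%classic).
Proof. by move=> xy; rewrite -cdf_lcdfB// /rrep /lrep; ring. Qed.

Lemma rrep_jump u x : rrep u x - lrep u x = fine (Dist a b u [set x]).
Proof. by rewrite -cdf_jump /rrep /lrep; ring. Qed.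

Lemma rrep_right u x e : 0 < e ->
  exists2 d, 0 < d & forall y, x <= y -> y < x + d -> `|rrep u y - rrep u x| < e.
Proof.
move=> e0; have [d d0 h] := cdf_right (Dist a b u) x e0; exists d => // y xy yd.
by rewrite /rrep opprD addrACA subrr add0r h.
Qed.

Lemma rrep_left u x e : 0 < e ->
  exists2 d, 0 < d & forall y, y < x -> x - d < y -> `|rrep u y - lrep u x| < e.
Proof.
move=> e0; have [d d0 h] := cdf_left (Dist a b u) x e0; exists d => // y xy yd.
by rewrite /rrep /lrep opprD addrACA subrr add0r h.
Qed.

Lemma rrep_bounded u : exists K, forall x, `|rrep u x| <= K /\ `|lrep u x| <= K.
Proof.
eexists => x; split; (apply: (le_trans (ler_normD _ _)); apply: lerD; first exact: lexx).
  exact: cdf_bounded.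
by apply: charge_bound; exact: measurable_itv.
Qed.

Lemma good_repr_rrep u x : BV a b u -> good_repr a b u -> I x ->
  ~ jump_set a b u x -> u x = rrep u x /\ u x = lrep u x.
Proof.
move=> hu gu Ix nJ; have [hr hl _] := rrep_limits hu.
have lr : llim u x = rlim u x := contrapT (fun h => nJ (conj Ix h)).
have [th [_ ->]] := gu x Ix.
by rewrite -(hr x Ix) -(hl x Ix) lr; split; ring.
Qed.

End OneSidedRepresentatives.

Section VectorRepresentatives.
Variables (R : realType) (a b : R) (ab : a < b) (d : nat).
Local Notation I := (`]a, b[%classic : set R).
Variables (u : R -> 'rV[R]_d.+1) (hu : BVv a b u) (hu_good : good_reprv a b u).

Definition rrepv x : 'rV[R]_d.+1 := \row_i rrep a b (coord i u) x.
Definition lrepv x : 'rV[R]_d.+1 := \row_i lrep a b (coord i u) x.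

Lemma rlimv_rrepv x : I x -> rlimv u x = rrepv x.
Proof.
move=> Ix; apply/rowP => i; rewrite !mxE.
by have [hr _ _] := rrep_limits ab (hu i); exact: hr.
Qed.

Lemma llimv_lrepv x : I x -> llimv u x = lrepv x.
Proof.
move=> Ix; apply/rowP => i; rewrite !mxE.
by have [_ hl _] := rrep_limits ab (hu i); exact: hl.
Qed.

Lemma llimvE x i : llimv u x ord0 i = llim (coord i u) x. Proof. exact: mxE. Qed.
Lemma rlimvE x i : rlimv u x ord0 i = rlim (coord i u) x. Proof. exact: mxE. Qed.

Lemma sub_jump_setv i : jump_set a b (coord i u) `<=` jump_setv a b u.
Proof.
move=> x [Ix h]; refine (conj Ix (fun e => h _)).
by rewrite -llimvE e rlimvE.
Qed.

Lemma countable_jump_setv : countable (jump_setv a b u).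
Proof.
have cU : countable (\bigcup_(i in [set: 'I_d.+1]) jump_set a b (coord i u)).
  apply: bigcup_countable => [|i _]; first exact/finite_set_countable/finite_finset.
  exact: (countable_jump_set ab (hu i)).
apply: sub_countable cU; apply: subset_card_le => x [Ix h].
have [i hi] : exists i, llim (coord i u) x <> rlim (coord i u) x.
  apply: contrapT => H; apply: h; apply: (iffLR (rowP _ _)) => i.
  exact: etrans (llimvE x i) (etrans (contrapT (fun hi => H (ex_intro _ i hi))) (esym (rlimvE x i))).
exists i; [by []|exact: (conj Ix hi)].
Qed.

(** At a point without jump both ends of the segment that must contain [u x]
coincide. *)
Lemma good_reprv_rrepv x : I x -> ~ jump_setv a b u x -> u x = rrepv x /\ rrepv x = lrepv x.
Proof.
move=> Ix nJ.
have lr : llimv u x = rlimv u x := contrapT (fun h => nJ (conj Ix h)).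
have [th [_ ->]] := hu_good Ix.
rewrite lr -scalerDl addrC subrK scale1r -(llimv_lrepv Ix) -(rlimv_rrepv Ix).
by split; [reflexivity|exact: esym lr].
Qed.

Lemma rrepv_right x e : 0 < e ->
  exists2 dl, 0 < dl & forall y, x <= y -> y < x + dl -> `|rrepv y - rrepv x| <= e.
Proof.
move=> e0; have H i := rrep_right a b (coord i u) x e0.
have /choice[f hf] : forall i, exists dl, 0 < dl /\ forall y, x <= y -> y < x + dl ->
    `|rrep a b (coord i u) y - rrep a b (coord i u) x| < e.
  by move=> i; have [dl d0 h] := H i; exists dl.
exists (\big[Num.min/1]_i f i).
  by apply: lt_bigmin => // i _; have [] := hf i.
move=> y xy yd; apply: norm_le_coord; first exact: ltW.
move=> i; rewrite !mxE; have [_ h] := hf i; apply/ltW/h => //.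
by apply: (lt_le_trans yd); rewrite lerD2l; exact: bigmin_le.
Qed.

Lemma rrepv_left x e : 0 < e ->
  exists2 dl, 0 < dl & forall y, y < x -> x - dl < y -> `|rrepv y - lrepv x| <= e.
Proof.
move=> e0; have H i := rrep_left a b (coord i u) x e0.
have /choice[f hf] : forall i, exists dl, 0 < dl /\ forall y, y < x -> x - dl < y ->
    `|rrep a b (coord i u) y - lrep a b (coord i u) x| < e.
  by move=> i; have [dl d0 h] := H i; exists dl.
exists (\big[Num.min/1]_i f i).
  by apply: lt_bigmin => // i _; have [] := hf i.
move=> y xy yd; apply: norm_le_coord; first exact: ltW.
move=> i; rewrite !mxE; have [_ h] := hf i; apply/ltW/h => //.
by apply: le_lt_trans yd; rewrite lerD2l lerN2; exact: bigmin_le.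
Qed.

Lemma rrepv_bounded : exists2 r, 0 <= r & forall x, `|rrepv x| <= r /\ `|lrepv x| <= r.
Proof.
have /choice[K hK] : forall i, exists K, forall x,
    `|rrep a b (coord i u) x| <= K /\ `|lrep a b (coord i u) x| <= K.
  by move=> i; exact: rrep_bounded.
exists (\big[Num.max/0]_i K i); first exact: bigmax_ge_id.
by move=> x; split; (apply: norm_le_coord; first exact: bigmax_ge_id) => i; rewrite !mxE;
  have [h1 h2] := hK i x; apply: (@le_trans _ _ (K i)) => //; exact: le_bigmax.
Qed.

End VectorRepresentatives.

(** * Functions whose increments are bounded by those of a measure *)

Section Increments.
Variables (R : realType) (a b : R) (ab : a < b).
Local Notation I := (`]a, b[%classic : set R).

Definition right_cts (F : R -> R) := forall x e, 0 < e ->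
  exists2 dl, 0 < dl & forall y, x <= y -> y < x + dl -> `|F y - F x| < e.

Lemma right_ctsD F G : right_cts F -> right_cts G -> right_cts (fun x => F x + G x).
Proof.
move=> hF hG x e e0; have e20 : 0 < e / 2 by rewrite divr_gt0.
have [d1 d10 h1] := hF x _ e20; have [d2 d20 h2] := hG x _ e20.
exists (Num.min d1 d2); first by rewrite lt_min d10.
move=> y xy; rewrite -ltrBlDl lt_min => /andP[y1 y2].
rewrite opprD addrACA (le_lt_trans (ler_normD _ _))// [e]splitr ltrD//.
  by apply: h1 => //; rewrite -ltrBlDl.
by apply: h2 => //; rewrite -ltrBlDl.
Qed.

Lemma right_ctsZ F k : 0 <= k -> right_cts F -> right_cts (fun x => k * F x).
Proof.
move=> k0 hF x e e0; have [d d0 h] := hF x (e / (k + 1)) (ltac:(by rewrite divr_gt0// ltr_wpDl)).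
exists d => // y xy yd; rewrite -mulrBr normrM ger0_norm//.
have := h y xy yd; rewrite ltr_pdivlMr ?ltr_wpDl// => h'.
by apply: le_lt_trans h'; rewrite mulrC ler_wpM2l// lerDl.
Qed.

Lemma right_cts_sum (J : Type) (s : seq J) (F : J -> R -> R) : (forall i, right_cts (F i)) ->
  right_cts (fun x => \sum_(i <- s) F i x).
Proof.
move=> hF; elim: s => [|j s IH].
  by move=> x e e0; exists 1 => // y _ _; rewrite !big_nil subrr normr0.
rewrite (_ : (fun x => _) = fun x => F j x + \sum_(i <- s) F i x); first exact: right_ctsD.
by apply/funext => x; rewrite big_cons.
Qed.

(** The analogue of [cdf] for measures. *)
Definition mdf (m : {measure set (measurableTypeR R) -> \bar R}) (x : R) : R :=
  fine (m `]-oo, x]%classic).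

Section Mass.
Variables (m : {measure set (measurableTypeR R) -> \bar R}).
Hypothesis fm : (m setT < +oo)%E.

Lemma mass_fin (A : set (measurableTypeR R)) : measurable A -> m A \is a fin_num.
Proof. by move=> mA; rewrite ge0_fin_numE// (le_lt_trans (le_measureT m mA)). Qed.

Lemma mass_le (A A' : set (measurableTypeR R)) : measurable A -> measurable A' ->
  A `<=` A' -> fine (m A) <= fine (m A').
Proof.
move=> mA mA' AA'; apply: fine_le; [exact: mass_fin..|].
by apply: le_measure; rewrite ?inE.
Qed.

Lemma mdfB x y : x <= y -> mdf m y - mdf m x = fine (m `]x, y]%classic).
Proof.
move=> xy; rewrite /mdf.
have -> : `]-oo, y]%classic = `]-oo, x]%classic `|` `]x, y]%classic.
  apply/seteqP; split => t /=; rewrite !in_itv/=.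
    by move=> ty; have [tx|xt] := leP t x; [left|right].
  by move=> [/le_trans|/andP[_]]; [apply|].
rewrite measureU//=; [|exact: measurable_itv..|].
  by rewrite fineD ?mass_fin//; [ring|exact: measurable_itv..].
by rewrite -subset0 => t /=; rewrite !in_itv/= => -[tx /andP[/lt_le_trans/(_ tx)]]; rewrite ltxx.
Qed.

Lemma mdf_right : right_cts (mdf m).
Proof.
move=> x e e0; have [d d0 hd] := measure_right_shrink x fm e0.
exists d => // y xy yd; rewrite mdfB// ger0_norm ?fine_ge0//.
rewrite -lte_fin fineK; last by apply: mass_fin; exact: measurable_itv.
apply: le_lt_trans hd; apply: le_measure; rewrite ?inE; [exact: measurable_itv..|].
by move=> t /=; rewrite !in_itv/= => /andP[-> /le_trans]; apply; exact: ltW.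
Qed.

End Mass.

(** [F + T] and [T] are nondecreasing and right-continuous, hence have Stieltjes
measures; their difference represents [F]. *)
Lemma charge_of_majorant F T : right_cts T ->
  (forall x y, x <= y -> `|F y - F x| <= T y - T x) ->
  exists nu : signedR R, nu.-null_set (~` I) /\
    forall x y, a < x -> x <= y -> y < b -> fine (nu `]x, y]%classic) = F y - F x.
Proof.
move=> rT FT.
have rF : right_cts F.
  move=> x e e0; have [d d0 h] := rT x e e0; exists d => // y xy yd.
  by apply: le_lt_trans (h y xy yd); apply: (le_trans (FT _ _ xy)); exact: ler_norm.
have ndT : {homo T : x y / x <= y}.
  by move=> x y xy; rewrite -subr_ge0; apply: le_trans (FT x y xy).
have ndV : {homo (fun x => F x + T x) : x y / x <= y}.
  move=> x y xy; have := FT x y xy; rewrite ler_norml => /andP[h _]; lra.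
have [nV [zV hV]] := Stieltjes_charge ab ndV (right_ctsD rF rT).
have [nT [zT hT]] := Stieltjes_charge ab ndT rT.
exists (cadd nV (copp nT)); split.
  move=> A mA AI; rewrite -[LHS]/(nV A - nT A)%E.
  by rewrite zV// zT// oppe0 adde0.
move=> x y ax xy yb.
rewrite -[LHS]/(fine (nV `]x, y]%classic - nT `]x, y]%classic)%E).
rewrite fineD ?fin_numN ?fin_num_measure//;
  [|exact: measurable_itv..].
by rewrite fineN hV// hT//; ring.
Qed.

Lemma increments_cdf (F : R -> R) (nu : signedR R) :
  (forall x y, a < x -> x <= y -> y < b -> fine (nu `]x, y]%classic) = F y - F x) ->
  exists c, forall x, I x -> F x = c + cdf nu x.
Proof.
move=> h; pose z := (a + b) / 2.
have [az zb] : a < z /\ z < b by rewrite /z !midf_lt.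
exists (F z - cdf nu z) => x /=; rewrite in_itv/= => /andP[ax xb].
have [xz|/ltW zx] := leP x z.
  by have := cdfB nu xz; rewrite h// => e; lra.
by have := cdfB nu zx; rewrite h// => e; lra.
Qed.

(** [F] is a constant plus the distribution function of [nu], and integrals do not
see the values of [v] on [C]; so [nu] is the distributional derivative. *)
Lemma BV_of_increments (v F : R -> R) (nu : signedR R) (C : set R) : countable C ->
  nu.-null_set (~` I) ->
  (forall x y, a < x -> x <= y -> y < b -> fine (nu `]x, y]%classic) = F y - F x) ->
  (forall x, I x -> ~ C x -> v x = F x) -> BV a b v.
Proof.
move=> cC zn hF vF; have [c hc] := increments_cdf hF.
have mI : measurable (I : set (measurableTypeR R)) by exact: measurable_itv.
have mC : measurable (C : set (measurableTypeR R)) by exact: countable_measurable_real.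
have iw : leb.-integrable I (EFin \o (fun x => c + cdf nu x)).
  apply: measurable_bounded_integrable => //; first exact: leb_I_lty.
    by apply: measurable_funTS; apply: measurable_funD => //; exact: measurable_cdf.
  exists (`|c| + fine (tvar nu setT)); split; first exact: num_real.
  move=> M' MM' x _; apply: le_trans (ltW MM').
  by rewrite (le_trans (ler_normD _ _))// lerD2l cdf_bounded.
have mw : measurable_fun I ((fun x => c + cdf nu x) : measurableTypeR R -> R).
  by apply/measurable_EFinP; exact: measurable_int iw.
have mv : measurable_fun I (v : measurableTypeR R -> R).
  rewrite -(setUIDK I C) measurable_funU; [split| |].
  - apply: measurable_fun_countable; apply: sub_countable cC.
    by apply: subset_card_le; exact: subIsetr.
  - apply: (@eq_measurable_fun _ _ _ _ _ (fun x => c + cdf nu x)).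
      by move=> x /set_mem[Ix nC]; rewrite -hc// vF.
    by apply: measurable_funS mw.
  - exact: measurableI.
  - exact: measurableD.
have ae : \forall x \ae leb, I x -> v x = c + cdf nu x.
  by apply: (ae_imp (leb_off_countable cC)) => x nC Ix; rewrite vF// hc.
have iv : leb.-integrable I (EFin \o v).
  apply/integrableP; split; first exact/measurable_EFinP.
  rewrite (@ae_eq_integral _ _ _ leb I (abse \o (EFin \o (fun x => c + cdf nu x))))//.
  - by have /integrableP[] := iw.
  - by apply: measurableT_comp => //; exact/measurable_EFinP.
  - by apply: measurableT_comp => //; exact/measurable_EFinP.
  - by apply: (ae_imp ae) => x h Ix; rewrite /= h.
split => //; exists nu; split => // phi hphi.
rewrite (_ : \int[leb]_(x in I) _ = \int[leb]_(x in I) (derive1 phi x * (c + cdf nu x))); last first.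
  by apply: eq_Rintegral_ae; apply: (ae_imp ae) => x h Ix; rewrite h.
apply: (BV_integration_by_parts ab (K := `|c| + fine (tvar nu setT)) hphi).
- by move=> x _; rewrite (le_trans (ler_normD _ _))// lerD2l cdf_bounded.
- apply: (ae_imp (leb_off_countable (countable_charge_atoms nu))) => x /= /negP/negPn/eqP h _.
  by apply: cvgD; [exact: cvg_cst|exact: cdf_continuous].
- by move=> x y _ xy _; rewrite -cdfB//; ring.
Qed.

End Increments.

Lemma finite_measureT (R : realType) (mu : {finite_measure set (measurableTypeR R) -> \bar R}) :
  (mu setT < +oo)%E.
Proof. by rewrite -ge0_fin_numE// fin_num_measure. Qed.

(** * Points off a countable set *)

Section OffCountable.
Variables (R : realType) (a b : R).
Local Notation I := (`]a, b[%classic : set R).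

Lemma ex_off_countable (C : set R) x y : countable C -> x < y -> exists2 t, x < t < y & ~ C t.
Proof.
move=> cC xy; apply: contrapT => H.
have sub : `]x, y[ `<=` C.
  move=> t /=; rewrite in_itv/= => txy; apply: contrapT => nC; apply: H; by exists t.
have := countable_lebesgue_measure0 (sub_countable (subset_card_le sub) cC).
by rewrite lebesgue_measure_itv/= lte_fin xy -EFinB => -[] /eqP; rewrite subr_eq0 gt_eqF.
Qed.

(** The derivatives live on the interval, which extends estimates for subsets of
the interval to all Borel sets. *)
Lemma null_off_interval (n : signedR R) (A : set (measurableTypeR R)) :
  n.-null_set (~` I) -> measurable A -> fine (n A) = fine (n (A `&` I)).
Proof.
move=> zn mA; have mI : measurable (I : set (measurableTypeR R)) by exact: measurable_itv.
have E : (A `&` I) `|` (A `\` I) = A by rewrite setUIDK.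
rewrite -{1}E charge_valU ?[n (A `\` I)]zn ?addr0//.
- exact: measurableD.
- exact: measurableI.
- exact: measurableD.
- by rewrite -subset0 => t [[_ It] [_ nIt]].
Qed.

End OffCountable.

(** * Convergence of the terms with a density in the first variable *)

Section DensityTerm.
Variables (R : realType) (a b al be : R).
Hypotheses (ab : a < b) (aal : a < al) (alb : al < be) (beb : be < b).
Local Notation I := (`]a, b[%classic : set R).
Local Notation J := (`]al, be]%classic : set R).
Local Notation t := (grid al be).
Local Notation cell := (cell al be).
Local Notation step := (step al be).
Variable d : nat.
Local Notation W := 'rV[R]_d.+1.
Variables (u : R -> W) (C : set R) (phi : R -> R) (r K : R).
Local Notation ru := (rrepv a b u).
Local Notation L w w' := (d.+1%:R * `|w - w'|).
Hypothesis r0 : 0 <= r.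
Hypothesis ru_r : forall x, `|ru x| <= r.
Hypothesis uE : forall x, I x -> ~ C x -> u x = ru x.
Hypothesis cphi : continuous phi.
Hypothesis phiK : forall x, al <= x <= be -> `|phi x| <= K.

Lemma sub_JI : J `<=` I.
Proof.
by move=> x /=; rewrite !in_itv/= => /andP[h1 h2]; rewrite (lt_trans aal)// (le_lt_trans h2).
Qed.

Lemma phi_grid n k : (k < n.+1)%N -> `|phi (t n k)| <= K.
Proof. by move=> kn; apply: phiK; apply: grid_bounds => //; exact: ltnW. Qed.

Lemma step_rrepv_right (h : W -> R) x : J x -> continuous h ->
  step n (fun k _ => h (ru (t n k.+1))) x @[n --> \oo] --> h (ru x).
Proof.
move=> Jx ch; apply: step_cvg => // e e0.
have /cvgrPdist_lt/(_ _ e0)/nbhs_ballP[e1 e10 he1] := ch (ru x).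
have e120 : 0 < e1 / 2 by rewrite divr_gt0.
have [dl dl0 hdl] := rrepv_right a b u x e120.
exists dl => // n k kn _ _ h3 h4; rewrite distrC ltW//; apply: he1.
rewrite -ball_normE/= distrC (le_lt_trans (hdl _ h3 h4))//.
by rewrite ltr_pdivrMr// ltr_pMr// ltr1n.
Qed.

(** [h w] is the density of the [rho]-part of [D_xB(., w)] and [H] its version
continuous in [w]; they agree for almost every [x] simultaneously at the
countably many values [ru (t n k.+1)].  The Lipschitz bound with constant [m],
used between [0] and these values, gives an integrable majorant. *)
Lemma density_term_cvg (rho : {measure set (measurableTypeR R) -> \bar R})
    (h : W -> R -> R) (m : R -> R) (H : R -> W -> R) :
  (forall w, rho.-integrable I (EFin \o h w)) -> rho.-integrable I (EFin \o m) ->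
  (forall w w', `|w| <= r + 1 -> `|w'| <= r + 1 ->
    \forall x \ae rho, I x -> `|h w x - h w' x| <= L w w' * m x) ->
  (forall w, H^~ w = h w %[ae rho in I]) ->
  (\forall x \ae rho, I x -> continuous (H x)) ->
  (\forall x \ae rho, ~ C x) ->
  ae_integrable rho J (fun x => phi x * H x (u x)) /\
  \sum_(k < n.+1) phi (t n k) * \int[rho]_(x in cell n k) h (ru (t n k.+1)) x @[n --> \oo]
    --> \int[rho]_(x in J) (phi x * H x (u x)).
Proof.
move=> ih im hL Hh Hc nC.
have mJ : measurable (J : set (measurableTypeR R)) by exact: measurable_itv.
have mI : measurable (I : set (measurableTypeR R)) by exact: measurable_itv.
have JI := sub_JI.
pose g x := K * (`|h 0 x| + d.+1%:R * r * `|m x|).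
have ig : rho.-integrable J (EFin \o g).
  apply: (integrableS mI mJ JI).
  have i1 : rho.-integrable I (EFin \o (fun x => `|h 0 x|)) by exact: (integrable_abse (ih 0)).
  have i2 : rho.-integrable I (EFin \o (fun x => `|m x|)) by exact: (integrable_abse im).
  have i3 := @integrableZl _ _ _ rho I mI (d.+1%:R * r) _ i2.
  have i4 := @integrableD _ _ _ rho I mI _ _ i1 i3.
  exact: (@integrableZl _ _ _ rho I mI K _ i4).
have bnd : \forall x \ae rho, I x -> forall n k,
    `|h (ru (t n k.+1)) x| <= `|h 0 x| + d.+1%:R * r * `|m x|.
  have : forall n k, \forall x \ae rho, I x ->
      `|h (ru (t n k.+1)) x| <= `|h 0 x| + d.+1%:R * r * `|m x|.
    move=> n k; set w := ru _; have wr : `|w| <= r by exact: ru_r.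
    have wr1 : `|w| <= r + 1 by rewrite (le_trans wr)// lerDl.
    have z1 : `|0 : W| <= r + 1 by rewrite normr0 addr_ge0.
    have := hL w 0 wr1 z1.
    move=> /ae_imp; apply => x /[apply]; rewrite subr0 => hx.
    rewrite -[h w x](subrK (h 0 x)) addrC (le_trans (ler_normD _ _))// lerD2l.
    apply: (le_trans hx); apply: (@le_trans _ _ (d.+1%:R * `|w| * `|m x|)).
      by rewrite ler_wpM2l ?mulr_ge0// ler_norm.
    by rewrite ler_wpM2r// ler_wpM2l.
  move=> hb; have := ae_all (fun n => ae_all (hb n)).
  by move=> /ae_imp; apply => x hx Ix n k; exact: hx.
have Hall : \forall x \ae rho, I x -> forall n k, H x (ru (t n k.+1)) = h (ru (t n k.+1)) x.
  have hb n k := Hh (ru (t n k.+1)).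
  have := ae_all (fun n => ae_all (hb n)).
  by move=> /ae_imp; apply => x hx Ix n k; exact: hx.
have [ai c] := @step_dominated_cvg R al be alb rho
  (fun n k x => phi (t n k) * h (ru (t n k.+1)) x) (fun x => phi x * H x (ru x)) g
  (fun n k _ => ltac:(apply: measurable_funM => //; apply: (measurable_funS mI JI);
     apply/measurable_EFinP; exact: measurable_int (ih _))) ig
  (ltac:(apply: (ae_imp bnd) => x hx Jx n k kn _; rewrite normrM;
     apply: ler_pM => //; [exact: phi_grid|apply: hx; exact: JI]))
  (ltac:(apply: (ae_imp2 Hall Hc) => x hx hc Jx;
     apply: (step_cvg_eq alb (G := fun n k y => phi (t n k) * H y (ru (t n k.+1)))) => //;
     [by move=> n k kn _; rewrite hx//; exact: JI
     |apply: step_cvgM => //; [exact: step_continuous_cvg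
       |by apply: (@step_rrepv_right (H x)) => //; apply: hc; exact: JI]])).
have ueq : (fun x => phi x * H x (u x)) = (fun x => phi x * H x (ru x)) %[ae rho in J].
  by apply: (ae_imp nC) => x nCx Jx; rewrite /= uE//; exact: JI.
split.
  have [f [if_ ef]] := ai; exists f; split => //.
  by apply: (ae_imp2 ueq ef) => x e1 e2 Jx; rewrite e1// e2.
rewrite (eq_Rintegral_ae ueq); apply: cvg_trans c; apply: near_eq_cvg; apply: nearW => n.
apply: eq_bigr => k _; rewrite RintegralZl//; first exact: measurable_cell.
apply: (integrableS mI) (ih _); first exact: measurable_cell.
by move=> x cx; apply: JI; apply: sub_cell cx.
Qed.

End DensityTerm.

(** * Linear combinations of integrals *)

Section LinearCombination.
Variables (R : realType) (rho : {measure set (measurableTypeR R) -> \bar R}).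
Variables (A : set (measurableTypeR R)) (mA : measurable A).
Variables (p : nat) (c : 'I_p -> R) (f : 'I_p -> R -> R).
Hypothesis fi : forall i, rho.-integrable A (EFin \o f i).

Lemma integrable_lincomb : rho.-integrable A (EFin \o (fun x => \sum_i c i * f i x)).
Proof.
rewrite (_ : EFin \o _ = (fun x => \sum_i ((c i)%:E * (f i x)%:E)%E)).
  apply: (@integrable_sum _ _ _ rho A mA _ _ xpredT) => i _.
  exact: (@integrableZl _ _ _ _ _ mA (c i) (EFin \o f i)).
by apply/funext => x /=; rewrite -sumEFin.
Qed.

Lemma Rintegral_lincomb :
  \int[rho]_(x in A) (\sum_i c i * f i x) = \sum_i c i * \int[rho]_(x in A) f i x.
Proof.
rewrite /Rintegral; under eq_integral do rewrite -sumEFin.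
have ci i : rho.-integrable A (EFin \o (fun x => c i * f i x)).
  exact: (@integrableZl _ _ _ _ _ mA (c i) (EFin \o f i)).
rewrite integral_sum// -sum_fine; last by move=> i _; exact: (integrable_fin_num mA (ci i)).
by apply: eq_bigr => i _; exact: (RintegralZl (c i) mA (fi i)).
Qed.

End LinearCombination.

(** A singleton has counting measure 1, so only the empty set is null. *)
Lemma ae_counting (R : realType) (P : R -> Prop) :
  (\forall x \ae @counting (measurableTypeR R) R, P x) -> forall x, P x.
Proof.
move=> [Z [mZ Z0 hZ]] x; apply: contrapT => nP.
have Zx : [set x] `<=` Z by move=> y ->; exact: hZ.
have : (counting [set x] <= counting Z :> \bar R)%E.
  apply: (@le_measure _ _ _ (@counting (measurableTypeR R) R)); rewrite ?inE//.
by rewrite counting_set1 [X in (_ <= X)%E -> _]Z0 lee_fin ler10.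
Qed.

(** * The chain rule between two points *)

(** The radius [r] bounds the representatives of [u].  The hypotheses
[beta_lipschitz] and [grad_bound] are [A2] and [A3] on the ball of radius
[r + 1], in the supremum norm; the margin [1] leaves room for the difference
quotients at points of the ball of radius [r]. *)
Section ChainRule.
Variables (R : realType) (a b : R) (ab : a < b) (d : nat).
Local Notation I := (`]a, b[%classic : set R).
Local Notation W := 'rV[R]_d.+1.
Local Notation count := (@counting (measurableTypeR R) R).
Variables (B : R -> W -> R) (N : set R).
Hypothesis cN : countable N.
Hypothesis BVB : forall w, BV a b (B^~ w).
Hypothesis goodB : forall w, good_repr a b (B^~ w).
Hypothesis jumpB : forall w, jump_set a b (B^~ w) `<=` N.
Hypothesis C1B : forall x, (I `\` N) x -> C1 (B x).
Local Notation beta w := (Dist a b (B^~ w)).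

Variables (r D : R) (mu : {finite_measure set (measurableTypeR R) -> \bar R}).
Local Notation L w w' := (d.+1%:R * `|w - w'|).
Hypothesis r0 : 0 <= r.
Hypothesis D0 : 0 <= D.
Hypothesis beta_lipschitz : forall w w', `|w| <= r + 1 -> `|w'| <= r + 1 ->
  forall A : set (measurableTypeR R), measurable A -> A `<=` I ->
  `|fine (beta w A) - fine (beta w' A)| <= L w w' * fine (mu A).
Hypothesis grad_bound : forall x w i, (I `\` N) x -> `|w| <= r + 1 -> `|grad (B x) w ord0 i| <= D.

Variable lambda : {finite_measure set (measurableTypeR R) -> \bar R}.
Hypothesis lambda_cantor : cantor_measure a b lambda.
Hypothesis lambda_dom : forall w, Dcantor a b (B^~ w) `<< lambda.

Lemma B_rrep x w : (I `\` N) x -> B x w = rrep a b (B^~ w) x /\ B x w = lrep a b (B^~ w) x.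
Proof.
move=> [Ix nN]; apply: (@good_repr_rrep R a b ab (B^~ w) x) => // /jumpB; exact: nN.
Qed.

Lemma B_Lipschitz x w w' : (I `\` N) x -> `|w| <= r -> `|w'| <= r ->
  `|B x w' - B x w| <= d.+1%:R * D * `|w' - w|.
Proof.
move=> INx wr w'r; have [dB _] := C1B INx.
have [s [s01 ->]] := MVT_row w w' dB.
have xr : `|w + s *: (w' - w)| <= r + 1.
  by apply: (le_trans (segment_norm_le s01 wr w'r)); rewrite lerDl.
apply: (le_trans (ler_norm_sum _ _ _)).
apply: (@le_trans _ _ (\sum_(i < d.+1) D * `|w' - w|)).
  apply: ler_sum => i _; rewrite normrM; apply: ler_pM => //.
    exact: grad_bound.
  exact: coord_le_norm.
by rewrite sumr_const card_ord -[leLHS]mulr_natl mulrA.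
Qed.

(** For fixed [w] off the jumps, [B x w - B t w] is the mass of [D_xB(., w)] on
]t, x[.  Hence the difference of the increments of [B x] and [B t] from [w] to
[h *: e + w] is a difference of such masses, of size at most
[c |h| mu(]t, x[)] by [A2]; divide by [h] and let it tend to [0]. *)
Lemma grad_left_dist x t w i : (I `\` N) x -> (I `\` N) t -> t < x -> `|w| <= r ->
  `|grad (B t) w ord0 i - grad (B x) w ord0 i| <= d.+1%:R * fine (mu `]t, x[%classic).
Proof.
move=> INx INt tx wr; have [dBx _] := C1B INx; have [dBt _] := C1B INt.
apply: partial_dist_le => // h h1; set e := delta_mx _ _.
have e1 : `|e : W| <= 1.
  apply: norm_le_coord => // j; rewrite mxE eqxx/=; case: (_ == _) => /=; rewrite ?normr1 ?normr0//.
have he : `|h *: (e : W)| <= `|h| by rewrite mx_normZ ler_piMr.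
have inc z : B x z - B t z = fine (beta z `]t, x[%classic).
  have [_ ->] := B_rrep z INx; have [-> _] := B_rrep z INt.
  exact: lrep_rrepB.
have -> : (B t (h *: e + w) - B t w) - (B x (h *: e + w) - B x w) =
    - (fine (beta (h *: e + w) `]t, x[%classic) - fine (beta w `]t, x[%classic)).
  by rewrite -!inc; ring.
have sub : `]t, x[%classic `<=` I.
  move: INx INt => [/=]; rewrite in_itv/= => /andP[_ xb] _ [/=]; rewrite in_itv/= => /andP[at' _] _.
  by move=> z /=; rewrite !in_itv/= => /andP[z1 z2]; rewrite (lt_trans at' z1) (lt_trans z2 xb).
rewrite normrN; apply: le_trans (beta_lipschitz _ _ (measurable_itv _) sub) _.
- by apply: (le_trans (ler_normD _ _)); rewrite addrC lerD// (le_trans he)// ltW.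
- by rewrite (le_trans wr)// lerDl.
rewrite addrK mulrAC ler_wpM2l//; first by rewrite mulr_ge0// fine_ge0.
Qed.

(** The absolutely continuous part of [mu] with respect to [rho] has a density [m].
Integrals of [h w - h w'] over sets off the singular parts are values of
[D_xB(., w) - D_xB(., w')], at most [L w w'] times the integral of [m]; so
the same holds almost everywhere for the integrands. *)
Lemma density_lipschitz (rho : {sigma_finite_measure set (measurableTypeR R) -> \bar R})
    (h : W -> R -> R) :
  (forall w, rho.-integrable I (EFin \o h w)) ->
  (forall w, exists Bad : set (measurableTypeR R), [/\ measurable Bad, rho Bad = 0%E &
     forall A : set (measurableTypeR R), measurable A -> A `<=` I -> A `&` Bad = set0 ->
     fine (beta w A) = \int[rho]_(x in A) h w x]) ->
  exists m : R -> R, rho.-integrable I (EFin \o m) /\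
    forall w w', `|w| <= r + 1 -> `|w'| <= r + 1 ->
    \forall x \ae rho, I x -> `|h w x - h w' x| <= L w w' * m x.
Proof.
move=> hi hrep.
have mI : measurable (I : set (measurableTypeR R)) by exact: measurable_itv.
have [Z [m [mZ Z0 im hm]]] := finite_measure_lebesgue_decomposition rho mu.
have imI : rho.-integrable I (EFin \o m) by apply: integrableS im.
exists m; split => // w w' wr w'r.
have half z z' : `|z| <= r + 1 -> `|z'| <= r + 1 ->
    \forall x \ae rho, I x -> h z x - h z' x <= L z z' * m x.
  move=> zr z'r.
  have [Bd [mB B0 hB]] := hrep z; have [Bd' [mB' B0' hB']] := hrep z'.
  apply: (@ae_le_of_integrals R rho I (Z `|` (Bd `|` Bd')) (fun x => h z x - h z' x)
    (fun x => L z z' * m x)) => //.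
  - by apply: measurableU => //; exact: measurableU.
  - by rewrite null_set_setU//; [exact: measurableU|rewrite null_set_setU].
  - exact: (@integrableB _ _ _ _ _ mI (EFin \o h z) (EFin \o h z')).
  - exact: (@integrableZl _ _ _ _ _ mI (L z z') (EFin \o m)).
  move=> A mA AI AB.
  have AZ : A `&` Z = set0 by rewrite -subset0 => x [Ax Zx]; rewrite -AB; split => //; left.
  have ABd : A `&` Bd = set0.
    by rewrite -subset0 => x [Ax Zx]; rewrite -AB; split => //; right; left.
  have ABd' : A `&` Bd' = set0.
    by rewrite -subset0 => x [Ax Zx]; rewrite -AB; split => //; right; right.
  have iA f : rho.-integrable I (EFin \o f) -> rho.-integrable A (EFin \o f).
    by move=> fi; apply: integrableS fi.
  rewrite RintegralB//; [|exact: iA..].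
  rewrite -hB// -hB'// RintegralZl//; last exact: iA.
  apply: (le_trans (ler_norm _)); apply: (le_trans (beta_lipschitz zr z'r mA AI)).
  have AE : A `\` Z = A by rewrite -{2}(setUIDK A Z) AZ set0U.
  by rewrite ler_wpM2l ?mulr_ge0// -{1}AE hm// /Rintegral lexx.
apply: (ae_imp2 (half w w' wr w'r) (half w' w w'r wr)) => x h1 h2 Ix.
rewrite ler_norml h1// andbT lerNl opprB (le_trans (h2 Ix))//.
by rewrite (distrC w').
Qed.

(** On sets that avoid the jumps and the singular set, only the absolutely
continuous part of the derivative remains. *)
Lemma nabla_repr w : exists Bad : set (measurableTypeR R),
  [/\ measurable Bad, lebesgue_measure Bad = 0%E &
  forall A : set (measurableTypeR R), measurable A -> A `<=` I -> A `&` Bad = set0 ->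
  fine (beta w A) = \int[lebesgue_measure]_(x in A) nabla a b (B^~ w) x].
Proof.
have [ig [_ [na [Z [mZ Z0 kZ]]]] _ _] := decomposition_spec ab (BVB w).
have mN : measurable (N : set (measurableTypeR R)) by exact: countable_measurable_real.
exists (N `|` Z); split; first exact: measurableU.
  by rewrite null_set_setU//; exact: countable_lebesgue_measure0.
move=> A mA AI AB.
have AN : A `&` N = set0 by rewrite -subset0 => x [Ax Zx]; rewrite -AB; split => //; left.
have kA : Dcantor a b (B^~ w) A = 0%E.
  by apply: kZ => // x Ax Zx; rewrite -[False]/(set0 x) -AB; split => //; right.
rewrite (Dist_split ab (BVB w) cN (@jumpB w) mA AI).
by rewrite AN kA Rintegral_set0 !addr0.
Qed.

(** The real-valued version of the density [psi] of the statement. *)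
Definition cantor_density w x : R := fine (Radon_Nikodym (Dcantor a b (B^~ w)) lambda x).

Lemma integrable_cantor_density w : lambda.-integrable setT (EFin \o cantor_density w).
Proof.
apply: eq_integrable (Radon_Nikodym_integrable (lambda_dom w)) => // x _ /=.
by rewrite /cantor_density fineK//; exact: Radon_Nikodym_fin_num.
Qed.

Lemma cantor_density_integral w (A : set (measurableTypeR R)) : measurable A ->
  fine (Dcantor a b (B^~ w) A) = \int[lambda]_(x in A) cantor_density w x.
Proof.
move=> mA; rewrite (Radon_Nikodym_integral (lambda_dom w) mA); congr fine.
apply: eq_integral => x _; rewrite /cantor_density fineK//; exact: Radon_Nikodym_fin_num.
Qed.

(** On Lebesgue-null sets that avoid the jumps, only the Cantor part remains; the
complement of one such set is null for [lambda]. *)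
Lemma cantor_density_repr w : exists Bad : set (measurableTypeR R),
  [/\ measurable Bad, lambda Bad = 0%E &
  forall A : set (measurableTypeR R), measurable A -> A `<=` I -> A `&` Bad = set0 ->
  fine (beta w A) = \int[lambda]_(x in A) cantor_density w x].
Proof.
have [_ na [Z [mZ Z0 kZ]]] := lambda_cantor.
have mN : measurable (N : set (measurableTypeR R)) by exact: countable_measurable_real.
have mZC : measurable (~` Z : set (measurableTypeR R)) by exact: measurableC.
exists (N `|` ~` Z); split; first exact: measurableU.
  rewrite null_set_setU//; last by apply: kZ.
  by apply: measure_countable0 => // x _; exact: na.
move=> A mA AI AB.
have AN : A `&` N = set0 by rewrite -subset0 => x [Ax Zx]; rewrite -AB; split => //; left.
have AZ : A `<=` Z.
  by move=> x Ax; apply: contrapT => nZ; rewrite -[False]/(set0 x) -AB; split => //; right.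
have A0 : lebesgue_measure A = 0%E.
  by apply/eqP; rewrite eq_le measure_ge0 andbT -Z0; apply: le_measure; rewrite ?inE.
rewrite (Dist_split ab (BVB w) cN (@jumpB w) mA AI).
rewrite AN Rintegral_set0 addr0 cantor_density_integral// /Rintegral null_set_integral//.
  by rewrite add0r.
by apply: measurable_funS (measurable_int _ (integrable_nabla ab (BVB w))).
Qed.

Variables (u : R -> W) (hu : BVv a b u) (hu_good : good_reprv a b u).
Local Notation ru := (rrepv a b u).
Local Notation lu := (lrepv a b u).
Local Notation nu i := (Dist a b (coord i u)).
Local Notation C := (N `|` jump_setv a b u).
Hypothesis ru_r : forall x, `|ru x| <= r.
Hypothesis lu_r : forall x, `|lu x| <= r.

Lemma countable_C : countable C.
Proof.
rewrite -bigcup2inE; apply: bigcup_countable => // -[|[|[]]]//= _.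
refine (countable_jump_setv ab hu).
Qed.

Lemma beta_null w : (beta w).-null_set (~` I).
Proof. by have [] := Dist_spec (BVB w). Qed.

(** The bound [B_Lipschitz] holds at points of the interval off [N], which
accumulate at every point of the closed interval from one side; outside the interval the
representatives are constant. *)
Lemma rrepB_Lipschitz x w w' : `|w| <= r -> `|w'| <= r ->
  `|rrep a b (B^~ w') x - rrep a b (B^~ w) x| <= d.+1%:R * D * `|w' - w|.
Proof.
move=> wr wr'; set K := (X in _ <= X).
have out z y t : y <= t -> (t <= a \/ b <= y) -> rrep a b (B^~ z) y = rrep a b (B^~ z) t.
  move=> yt h; apply/esym/eqP; rewrite -subr_eq0 rrepB//; apply/eqP.
  rewrite [Dist _ _ _ _](beta_null z)//=.
  move=> s /=; rewrite !in_itv/= => /andP[ys st]; apply/negP; rewrite negb_and -!leNgt.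
  by case: h => [/(le_trans st) ->//|/le_trans h]; rewrite [b <= s]h ?orbT// ltW.
have inside y : a <= y -> y < b ->
    `|rrep a b (B^~ w') y - rrep a b (B^~ w) y| <= K.
  move=> ay yb; apply/ler_addgt0Pr => e e0; have e20 : 0 < e / 2 by rewrite divr_gt0.
  have [d1 d10 h1] := rrep_right a b (B^~ w) y e20.
  have [d2 d20 h2] := rrep_right a b (B^~ w') y e20.
  have [t /andP[yt]] := @ex_off_countable _ N y (Num.min b (Num.min (y + d1) (y + d2))) cN
    (ltac:(by rewrite !lt_min yb !ltrDl d10)).
  rewrite !lt_min => /and3P[tb t1 t2] nN.
  have INt : (I `\` N) t by split => //=; rewrite in_itv/= tb (le_lt_trans ay).
  have := B_Lipschitz INt wr wr'.
  rewrite -/K; have [-> _] := B_rrep w INt.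
  have [-> _] := B_rrep w' INt.
  have := h1 t (ltW yt) t1; have := h2 t (ltW yt) t2.
  rewrite !ltr_norml !ler_norml => /andP[? ?] /andP[? ?] /andP[? ?].
  by apply/andP; split; lra.
have [xa|ax] := leP x a.
  by rewrite (out w' x a)// ?(out w x a)//; [exact: inside|left..].
have [xb|bx] := ltP x b; first by apply: inside => //; exact: ltW.
have rl z : rrep a b (B^~ z) x = lrep a b (B^~ z) b.
  rewrite -(out z b x)//; last by right.
  apply/eqP; rewrite -subr_eq0 rrep_jump [Dist _ _ _ _](beta_null z)//=.
  by move=> s /= ->; rewrite in_itv/= ltxx andbF.
rewrite !rl; apply/ler_addgt0Pr => e e0; have e20 : 0 < e / 2 by rewrite divr_gt0.
have [d1 d10 h1] := rrep_left a b (B^~ w) b e20.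
have [d2 d20 h2] := rrep_left a b (B^~ w') b e20.
have [t /andP[]] := @ex_off_countable _ N (Num.max a (Num.max (b - d1) (b - d2))) b cN
    (ltac:(by rewrite !gt_max ab !ltrBlDr !ltrDl d10)).
rewrite !gt_max => /and3P[at' t1 t2] tb nN.
have INt : (I `\` N) t by split => //=; rewrite in_itv/= tb at'.
have := B_Lipschitz INt wr wr'.
rewrite -/K; have [-> _] := B_rrep w INt.
have [-> _] := B_rrep w' INt.
have := h1 t tb t1; have := h2 t tb t2.
rewrite !ltr_norml !ler_norml => /andP[? ?] /andP[? ?] /andP[? ?].
by apply/andP; split; lra.
Qed.

(** Compare with [w = 0] by [A2]. *)
Lemma beta_bound w (A : set (measurableTypeR R)) : `|w| <= r -> measurable A ->
  `|fine (beta w A)| <= fine (tvar (beta 0) A) + d.+1%:R * r * fine (mu A).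
Proof.
move=> wr mA; have mI : measurable (I : set (measurableTypeR R)) by exact: measurable_itv.
have mAI : measurable (A `&` I) by exact: measurableI.
rewrite (null_off_interval (@beta_null w) mA).
have h := beta_lipschitz (w := w) (w' := 0).
rewrite -[fine (beta w _)](subrK (fine (beta 0 (A `&` I)))) addrC.
rewrite (le_trans (ler_normD _ _))// lerD//.
  apply: (le_trans (charge_le_tvar _ mAI)); apply: mass_le => //; exact: tvarT.
have wr1 : `|w| <= r + 1 by rewrite (le_trans wr)// lerDl.
have z1 : `|0 : W| <= r + 1 by rewrite normr0 addr_ge0.
apply: le_trans (h wr1 z1 _ mAI (@subIsetr _ _ _)) _.
rewrite subr0; apply: ler_pM; rewrite ?mulr_ge0 ?fine_ge0 ?ler_wpM2l//.
by apply: mass_le => //; exact: finite_measureT.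
Qed.

(** The right-continuous representative of [x |-> B x (u x)]. *)
Definition composite x : R := rrep a b (B^~ (ru x)) x.

(** The three terms bound the variation of [composite] up to [x]: that of [B] in the first variable
at [0], the change of it when [w] moves in the ball of radius [r], and the
variation of [u] times the Lipschitz constant in the second variable. *)
Definition majorant x := mdf (tvar (beta 0)) x + d.+1%:R * r * mdf mu x
  + d.+1%:R * D * \sum_i mdf (tvar (nu i)) x.

Lemma right_cts_majorant : right_cts majorant.
Proof.
apply: right_ctsD; first apply: right_ctsD.
- by apply: mdf_right; exact: tvarT.
- by apply: right_ctsZ; [rewrite mulr_ge0|exact/mdf_right/finite_measureT].
- apply: right_ctsZ; first by rewrite mulr_ge0.
  by apply: right_cts_sum => i; apply: mdf_right; exact: tvarT.
Qed.

Lemma composite_increment x y : x <= y -> `|composite y - composite x| <= majorant y - majorant x.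
Proof.
move=> xy; rewrite /composite.
rewrite -[X in `|X|](subrKA (rrep a b (B^~ (ru y)) x)) (le_trans (ler_normD _ _))//.
have mxy : measurable (`]x, y]%classic : set (measurableTypeR R)) by exact: measurable_itv.
have h1 : `|rrep a b (B^~ (ru y)) y - rrep a b (B^~ (ru y)) x| <=
   mdf (tvar (beta 0)) y - mdf (tvar (beta 0)) x + d.+1%:R * r * (mdf mu y - mdf mu x).
  by rewrite rrepB// !mdfB//; [exact: beta_bound|exact: finite_measureT|exact: tvarT].
have h2 : `|rrep a b (B^~ (ru y)) x - rrep a b (B^~ (ru x)) x| <=
   d.+1%:R * D * (\sum_i mdf (tvar (nu i)) y - \sum_i mdf (tvar (nu i)) x).
  apply: (le_trans (rrepB_Lipschitz x (ru_r x) (ru_r y))).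
  rewrite ler_wpM2l ?mulr_ge0// -sumrB; apply: norm_le_coord => [|i].
    by apply: sumr_ge0 => i _; rewrite mdfB ?fine_ge0//; exact: tvarT.
  rewrite !mxE rrepB// (bigD1 i)//= mdfB//; last exact: tvarT.
  apply: (le_trans (charge_le_tvar _ mxy)); rewrite lerDl.
  by apply: sumr_ge0 => j _; rewrite mdfB ?fine_ge0//; exact: tvarT.
apply: (le_trans (lerD h1 h2)); rewrite /majorant.
by rewrite le_eqVlt; apply/orP; left; apply/eqP; ring.
Qed.

Lemma composite_charge : exists n : signedR R, n.-null_set (~` I) /\
  forall x y, a < x -> x <= y -> y < b -> fine (n `]x, y]%classic) = composite y - composite x.
Proof.
have h := charge_of_majorant ab (@right_cts_majorant).
exact: (h _ (@composite_increment)). Qed.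

Lemma compositeE x : I x -> ~ (N `|` jump_setv a b u) x -> B x (u x) = composite x.
Proof.
move=> Ix nC; have nN : ~ N x by move=> h; apply: nC; left.
have nJ : ~ jump_setv a b u x by move=> h; apply: nC; right.
have [-> _] := good_reprv_rrepv ab hu hu_good Ix nJ.
by have [] := B_rrep (ru x) (conj Ix nN).
Qed.

Lemma BV_composite : BV a b (fun x => B x (u x)).
Proof.
have [n [zn hn]] := composite_charge.
apply: (BV_of_increments ab (C := N `|` jump_setv a b u) _ zn hn compositeE).
exact: countable_C.
Qed.

Variables (al be : R).
Hypotheses (aal : a < al) (alb : al < be) (beb : be < b).
Local Notation J := (`]al, be]%classic : set R).
Local Notation t := (grid al be).
Local Notation cell := (cell al be).
Local Notation step := (step al be).
Hypothesis grid_off : forall n k, (k <= n.+1)%N -> ~ C (t n k).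

Variable sg : nat -> nat -> R.
Hypothesis sg01 : forall n k, 0 <= sg n k <= 1.
Local Notation xi n k := (ru (t n k) + sg n k *: (ru (t n k.+1) - ru (t n k))).
Local Notation slope n k i := (grad (B (t n k)) (xi n k) ord0 i).
Hypothesis mean_value : forall n k, (k < n.+1)%N ->
  B (t n k) (ru (t n k.+1)) - B (t n k) (ru (t n k)) =
  \sum_i slope n k i * (ru (t n k.+1) - ru (t n k)) ord0 i.

Lemma grid_regular n k : (k <= n.+1)%N -> (I `\` N) (t n k).
Proof.
move=> kn; split; last by move=> h; apply: (grid_off kn); left.
have /andP[h1 h2] := grid_bounds alb kn.
by rewrite /= in_itv/= (lt_le_trans aal)// (le_lt_trans h2).
Qed.

Lemma slope_bound n k i : (k < n.+1)%N -> `|slope n k i| <= D.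
Proof.
move=> kn; apply: grad_bound; first by apply: grid_regular; exact: ltnW.
by rewrite (le_trans (segment_norm_le (sg01 n k) (ru_r _) (ru_r _)))// lerDl.
Qed.

(** The slope is a partial derivative of [B (t n k)] at a point [xi n k] near
[ru x], as [ru] is continuous at [x].  [grad_left_dist] moves the base point from
[t n k] to [x] uniformly in the second argument, and then continuity of the
gradient of [B x] applies. *)
Lemma slope_cvg x i : J x -> ~ C x ->
  step n (fun k _ => slope n k i) x @[n --> \oo] --> grad (B x) (u x) ord0 i.
Proof.
move=> Jx nC; have Ix : I x by exact: (sub_JI aal beb).
have nN : ~ N x by move=> h; apply: nC; left.
have nJ : ~ jump_setv a b u x by move=> h; apply: nC; right.
have [-> rl] := good_reprv_rrepv ab hu hu_good Ix nJ.
have [_ cg] := C1B (conj Ix nN).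
apply: step_cvg => // e e0.
have e20 : 0 < e / 2 by rewrite divr_gt0.
have /cvgrPdist_lt/(_ _ e20)/nbhs_ballP[e1 e10 he1] := cg (ru x).
have e120 : 0 < e1 / 2 by rewrite divr_gt0.
have [d1 d10 h1] := rrepv_right a b u x e120.
have [d2 d20 h2] := rrepv_left a b u x e120.
have e30 : 0 < e / 2 / d.+1%:R by rewrite divr_gt0.
have [d3 d30 h3] := measure_left_shrink x (finite_measureT mu) e30.
exists (Num.min d1 (Num.min d2 d3)); first by rewrite !lt_min d10 d20.
move=> n k kn tk1 tk2 tk3 tk4.
have [{}tk1 tk1'] : x - d2 < t n k /\ x - d3 < t n k.
  by split; apply: le_lt_trans tk1; rewrite lerD2l lerN2 !ge_min lexx ?orbT.
have {}tk4 : t n k.+1 < x + d1 by apply: (lt_le_trans tk4); rewrite lerD2l ge_min lexx.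
have INt : (I `\` N) (t n k) by apply: grid_regular; exact: ltnW.
rewrite -[X in `|X|](subrKA (grad (B x) (xi n k) ord0 i)) (le_trans (ler_normD _ _))//.
rewrite [e]splitr lerD//.
  have := grad_left_dist i (conj Ix nN) INt tk2
    (segment_norm_le (sg01 n k) (ru_r (t n k)) (ru_r (t n k.+1))).
  move=> /le_trans; apply; rewrite mulrC -ler_pdivlMr//.
  have mt : measurable (`]t n k, x[%classic : set (measurableTypeR R)) by exact: measurable_itv.
  rewrite -lee_fin fineK ?fin_num_measure//.
  apply: le_trans (ltW h3); apply: le_measure; rewrite ?inE; [exact: measurable_itv..|].
  by move=> z /=; rewrite !in_itv/= => /andP[hz ->]; rewrite andbT (lt_trans tk1').
have xr : `|xi n k - ru x| <= e1 / 2.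
  have -> : xi n k - ru x =
      (ru (t n k) - ru x) + sg n k *: ((ru (t n k.+1) - ru x) - (ru (t n k) - ru x)).
    by rewrite opprB subrKA addrAC.
  by apply: segment_norm_le => //; [rewrite rl; exact: h2|exact: h1].
have : ball (ru x) e1 (xi n k).
  rewrite -ball_normE/= distrC (le_lt_trans xr)//.
  by rewrite ltr_pdivrMr// ltr_pMr// ltr1n.
move=> /he1/= h; rewrite distrC; apply: le_trans (ltW h).
have -> : grad (B x) (ru x) ord0 i - grad (B x) (xi n k) ord0 i =
    (grad (B x) (ru x) - grad (B x) (xi n k)) ord0 i by rewrite !mxE.
exact: coord_le_norm.
Qed.

Lemma atom_beta_cvg x : J x ->
  step n (fun k _ => fine (beta (ru (t n k.+1)) [set x])) x @[n --> \oo]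
    --> fine (beta (ru x) [set x]).
Proof.
move=> Jx; have Ix : I x by exact: (sub_JI aal beb).
apply: step_cvg => // e e0.
pose M := d.+1%:R * fine (mu [set x]).
have M0 : 0 <= M by rewrite mulr_ge0 ?fine_ge0.
have e10 : 0 < e / (M + 1) by rewrite divr_gt0// ltr_wpDl.
have [dl dl0 hdl] := rrepv_right a b u x e10.
exists dl => // n k kn _ _ h3 h4.
have wr z : `|ru z| <= r + 1 by rewrite (le_trans (ru_r z))// lerDl.
have sub : [set x] `<=` I by move=> z ->.
apply: (le_trans (beta_lipschitz (wr _) (wr _) (measurable_set1 x) sub)).
rewrite mulrAC -/M; apply: (@le_trans _ _ ((M + 1) * `|ru (t n k.+1) - ru x|)).
  by rewrite ler_wpM2r// lerDl.
by rewrite mulrC -ler_pdivlMr ?ltr_wpDl//; exact: hdl.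
Qed.

(** The limit is uniform in the second argument, by [B_Lipschitz]. *)
Lemma B_left_limit x z e : `|z| <= r -> 0 < e -> exists2 dl, 0 < dl & forall s w,
  (I `\` N) s -> x - dl < s -> s < x -> `|w| <= r -> `|w - z| <= dl ->
  `|B s w - lrep a b (B^~ z) x| <= e.
Proof.
move=> zr e0; have e20 : 0 < e / 2 by rewrite divr_gt0.
have [d1 d10 h1] := rrep_left a b (B^~ z) x e20.
pose M := d.+1%:R * D; have M0 : 0 <= M by rewrite mulr_ge0.
have e30 : 0 < e / 2 / (M + 1) by rewrite divr_gt0// ltr_wpDl.
exists (Num.min d1 (e / 2 / (M + 1))); first by rewrite lt_min d10.
move=> s w INs s1 s2 wr; rewrite le_min => /andP[_ wz].
rewrite -[X in `|X|](subrKA (B s z)) (le_trans (ler_normD _ _))// [e]splitr lerD//.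
  apply: (le_trans (B_Lipschitz INs zr wr)); rewrite -/M.
  apply: (@le_trans _ _ ((M + 1) * `|w - z|)); first by rewrite ler_wpM2r// lerDl.
  by rewrite mulrC -ler_pdivlMr ?ltr_wpDl.
have [-> _] := B_rrep z INs.
by apply/ltW/h1 => //; apply: le_lt_trans s1; rewrite lerD2l lerN2 ge_min lexx.
Qed.

Lemma B_right_value_cvg x : J x ->
  step n (fun k _ => B (t n k) (ru (t n k.+1))) x @[n --> \oo] --> lrep a b (B^~ (ru x)) x.
Proof.
move=> Jx; apply: step_cvg => // e e0.
have [d1 d10 h1] := B_left_limit x (ru_r x) e0.
have [d2 d20 h2] := rrepv_right a b u x d10.
exists (Num.min d1 d2); first by rewrite lt_min d10.
move=> n k kn tk1 tk2 tk3 tk4; apply: h1 => //.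
- by apply: grid_regular; exact: ltnW.
- by apply: le_lt_trans tk1; rewrite lerD2l lerN2 ge_min lexx.
- by apply: h2 => //; apply: (lt_le_trans tk4); rewrite lerD2l ge_min lexx orbT.
Qed.

Lemma B_left_value_cvg x : J x ->
  step n (fun k _ => B (t n k) (ru (t n k))) x @[n --> \oo] --> lrep a b (B^~ (lu x)) x.
Proof.
move=> Jx; apply: step_cvg => // e e0.
have [d1 d10 h1] := B_left_limit x (lu_r x) e0.
have [d2 d20 h2] := rrepv_left a b u x d10.
exists (Num.min d1 d2); first by rewrite lt_min d10.
move=> n k kn tk1 tk2 tk3 tk4; apply: h1 => //.
- by apply: grid_regular; exact: ltnW.
- by apply: le_lt_trans tk1; rewrite lerD2l lerN2 ge_min lexx.
- by apply: h2 => //; apply: le_lt_trans tk1; rewrite lerD2l lerN2 ge_min lexx orbT.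
Qed.

(** The cell deprived of [x] has small mass, and slopes are bounded. *)
Lemma atom_remainder_cvg x i : J x ->
  step n (fun k _ => slope n k i * (fine (nu i [set x]) - fine (nu i (cell n k)))) x
    @[n --> \oo] --> (0 : R).
Proof.
move=> Jx; apply: step_cvg => // e e0.
have e10 : 0 < e / (D + 1) / 2 by rewrite !divr_gt0// ltr_wpDl.
have [d1 d10 h1] := rrep_right a b (coord i u) x e10.
have [d2 d20 h2] := rrep_left a b (coord i u) x e10.
exists (Num.min d1 d2); first by rewrite lt_min d10.
move=> n k kn tk1 tk2 tk3 tk4; rewrite subr0 normrM.
have {}tk1 : x - d2 < t n k by apply: le_lt_trans tk1; rewrite lerD2l lerN2 ge_min lexx orbT.
have {}tk4 : t n k.+1 < x + d1 by apply: (lt_le_trans tk4); rewrite lerD2l ge_min lexx.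
rewrite -rrep_jump -rrepB; last by apply: ltW; exact: lt_le_trans tk3.
have := h1 _ tk3 tk4; have := h2 _ tk2 tk1 => hl hr.
apply: (@le_trans _ _ (D * (e / (D + 1)))).
  apply: ler_pM => //; first exact: slope_bound.
  rewrite [e / _]splitr.
  have -> : rrep a b (coord i u) x - lrep a b (coord i u) x -
     (rrep a b (coord i u) (t n k.+1) - rrep a b (coord i u) (t n k)) =
     (rrep a b (coord i u) (t n k) - lrep a b (coord i u) x) -
     (rrep a b (coord i u) (t n k.+1) - rrep a b (coord i u) x) by ring.
  by apply: (le_trans (ler_normB _ _)); rewrite lerD// ltW.
rewrite mulrA ler_pdivrMr ?ltr_wpDl// mulrC ler_wpM2l ?ltW//.
by rewrite ltrDl.
Qed.

(** By the mean value identity the sum over [i] is the increment of [B (t n k)] from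
[ru (t n k)] to [ru (t n k.+1)] up to the remainder of [atom_remainder_cvg]; the
right limit of [B] comes from the atom of its derivative at [x]. *)
Lemma jump_cvg x : J x ->
  step n (fun k _ => fine (beta (ru (t n k.+1)) [set x])
    + \sum_i slope n k i * fine (nu i [set x])) x @[n --> \oo]
    --> rrep a b (B^~ (ru x)) x - lrep a b (B^~ (lu x)) x.
Proof.
move=> Jx.
have -> : rrep a b (B^~ (ru x)) x - lrep a b (B^~ (lu x)) x =
    fine (beta (ru x) [set x]) + ((lrep a b (B^~ (ru x)) x + -1 * lrep a b (B^~ (lu x)) x)
      + \sum_(i < d.+1) 0).
  by rewrite big1// addr0 mulN1r -rrep_jump; ring.
apply: (step_cvg_eq alb (G := fun n k _ => fine (beta (ru (t n k.+1)) [set x]) +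
   ((B (t n k) (ru (t n k.+1)) + -1 * B (t n k) (ru (t n k)))
    + \sum_i slope n k i * (fine (nu i [set x]) - fine (nu i (cell n k)))))) => //.
  move=> n k kn _; rewrite mulN1r mean_value// -big_split/=; congr (_ + _).
  apply: eq_bigr => i _; rewrite !mxE rrepB; last by apply: ltW; exact: lt_grid.
  by rewrite mulrBr addrC subrK.
apply: step_cvgD => //; first exact: atom_beta_cvg.
apply: step_cvgD => //.
  apply: step_cvgD => //; first exact: B_right_value_cvg.
  apply: (step_cvgM alb (F := fun _ _ _ => -1)) => //; last exact: B_left_value_cvg.
  apply: step_cvg => // e e0; exists 1 => // n k _ _ _ _ _.
  by rewrite subrr normr0 ltW.
by apply: step_cvg_sum => // i; exact: atom_remainder_cvg.
Qed.

Variables (nablaB psi : R -> W -> R).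
Hypothesis hnablaB : forall w, nablaB^~ w = nabla a b (B^~ w) %[ae leb in I].
Hypothesis hnablaB_cont : \forall x \ae leb, I x -> continuous (nablaB x).
Hypothesis hpsi : forall w, EFin \o psi^~ w
  = Radon_Nikodym (Dcantor a b (B^~ w)) lambda %[ae lambda in I].
Hypothesis hpsi_cont : \forall x \ae lambda, I x -> continuous (psi x).

Variable phi : R -> R.
Hypothesis dphi : forall x, derivable phi x 1.
Hypothesis cdphi : continuous (derive1 phi).
Hypothesis cphi : continuous phi.
Hypotheses (phi_al : phi al = 0) (phi_be : phi be = 0).

Lemma cell_I n k : (k < n.+1)%N -> cell n k `<=` I.
Proof. by move=> kn x cx; apply: (sub_JI aal beb); apply: sub_cell cx. Qed.

Lemma countable_cell_C (A : set R) : countable (A `&` C).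
Proof. by apply: sub_countable countable_C; apply: subset_card_le; exact: subIsetr. Qed.

(** The first argument moves while the second one has its value at the right grid
point, the end where [ru] is continuous; then the second argument moves while the
first one is the left grid point, which is off [N]. *)
Lemma composite_cell n k : (k < n.+1)%N ->
  composite (t n k.+1) - composite (t n k) =
  fine (beta (ru (t n k.+1)) (cell n k)) + \sum_i slope n k i * fine (nu i (cell n k)).
Proof.
move=> kn; have lt : t n k < t n k.+1 by exact: lt_grid.
have reg : (I `\` N) (t n k).
  by apply: grid_regular; exact: ltnW.
have [e1 _] := B_rrep (ru (t n k)) reg.
have [e2 _] := B_rrep (ru (t n k.+1)) reg.
have := mean_value kn; rewrite e1 e2 => mv.
rewrite /composite -(rrepB _ _ _ (ltW lt)).
under eq_bigr do rewrite -(rrepB _ _ _ (ltW lt)).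
rewrite (eq_bigr (fun i => slope n k i * (ru (t n k.+1) - ru (t n k)) ord0 i)) => [|i _].
  by rewrite -mv; ring.
by rewrite !mxE.
Qed.

Lemma composite_cell_split n k : (k < n.+1)%N ->
  composite (t n k.+1) - composite (t n k) =
    \int[leb]_(x in cell n k) nabla a b (B^~ (ru (t n k.+1))) x
  + \int[lambda]_(x in cell n k) cantor_density (ru (t n k.+1)) x
  + \int[leb]_(x in cell n k) (\sum_i slope n k i * nabla a b (coord i u) x)
  + \sum_i slope n k i * fine (Dcantor a b (coord i u) (cell n k))
  + \int[count]_(x in cell n k `&` C) (fine (beta (ru (t n k.+1)) [set x])
      + \sum_i slope n k i * fine (nu i [set x])).
Proof.
move=> kn; rewrite composite_cell//.
have mc : measurable (cell n k : set (measurableTypeR R)) by exact: measurable_cell.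
have cI := cell_I kn.
have mI : measurable (I : set (measurableTypeR R)) by exact: measurable_itv.
have jB w : jump_set a b (B^~ w) `<=` C by move=> x /jumpB; left.
have ju i : jump_set a b (coord i u) `<=` C by move=> x /sub_jump_setv; right.
have mcC : measurable (cell n k `&` C : set (measurableTypeR R)).
  by apply: countable_measurable_real; exact: countable_cell_C.
have ed := cantor_density_integral (ru (t n k.+1)) mc.
have eB := Dist_split ab (BVB (ru (t n k.+1))) countable_C (jB _) mc cI.
rewrite ed in eB; rewrite eB {eB ed}.
rewrite (eq_bigr (fun i => slope n k i * \int[leb]_(x in cell n k) nabla a b (coord i u) x
   + (slope n k i * fine (Dcantor a b (coord i u) (cell n k))
   + slope n k i * \int[count]_(x in cell n k `&` C) fine (nu i [set x])))); last first.
  by move=> i _; rewrite (Dist_split ab (hu i) countable_C (ju i) mc cI); ring.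
have inab i : leb.-integrable (cell n k) (EFin \o nabla a b (coord i u)).
  exact: (integrableS mI mc cI (integrable_nabla ab (hu i))).
have icnt (n' : signedR R) : count.-integrable (cell n k `&` C) (EFin \o (fun x => fine (n' [set x]))).
  by apply: integrable_counting_charge; exact: countable_cell_C.
rewrite (Rintegral_lincomb mc _ inab) RintegralD//; last first.
  by apply: (integrable_lincomb mcC) => i; exact: icnt.
rewrite (Rintegral_lincomb mcC _ (fun i => icnt (nu i))).
by rewrite !big_split/=; ring.
Qed.

Lemma u_rrepv x : I x -> ~ C x -> u x = ru x.
Proof.
move=> Ix nC; have nJ : ~ jump_setv a b u x by move=> h; apply: nC; right.
by have [] := good_reprv_rrepv ab hu hu_good Ix nJ.
Qed.

Lemma lebesgue_term_cvg :
  ae_integrable leb J (fun x => phi x * nablaB x (u x)) /\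
  \sum_(k < n.+1) phi (t n k) * \int[leb]_(x in cell n k) nabla a b (B^~ (ru (t n k.+1))) x
    @[n --> \oo] --> \int[leb]_(x in J) (phi x * nablaB x (u x)).
Proof.
have [K _ phiK] := continuous_bounded_itv al be cphi.
have inab w : leb.-integrable I (EFin \o nabla a b (B^~ w)) := integrable_nabla ab (BVB w).
have [m [im hm]] := density_lipschitz inab (nabla_repr).
exact: (density_term_cvg aal alb beb r0 ru_r u_rrepv cphi phiK inab im hm hnablaB hnablaB_cont
  (leb_off_countable countable_C)).
Qed.

Lemma cantor_term_cvg :
  ae_integrable lambda J (fun x => phi x * psi x (u x)) /\
  \sum_(k < n.+1) phi (t n k) *
      \int[lambda]_(x in cell n k) cantor_density (ru (t n k.+1)) x
    @[n --> \oo] --> \int[lambda]_(x in J) (phi x * psi x (u x)).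
Proof.
have [K _ phiK] := continuous_bounded_itv al be cphi.
have mI : measurable (I : set (measurableTypeR R)) by exact: measurable_itv.
have id w : lambda.-integrable I (EFin \o cantor_density w).
  exact: (integrableS measurableT mI (@subsetT _ _) (integrable_cantor_density w)).
have [m [im hm]] := density_lipschitz id
  (cantor_density_repr).
have psiE w : psi^~ w = cantor_density w %[ae lambda in I].
  by apply: (ae_imp (hpsi w)) => x h Ix; rewrite /cantor_density -h.
have [_ na _] := lambda_cantor.
exact: (density_term_cvg aal alb beb r0 ru_r u_rrepv cphi phiK id im hm psiE hpsi_cont
  (ae_off_countable countable_C (fun x _ => na x))).
Qed.

(** The majorant is the bound on the gradient times the densities of [Du]. *)
Lemma gradient_term_cvg :
  ae_integrable leb J (fun x =>
    phi x * \sum_i grad (B x) (u x) ord0 i * nabla a b (coord i u) x) /\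
  \sum_(k < n.+1) phi (t n k) *
      \int[leb]_(x in cell n k) (\sum_i slope n k i * nabla a b (coord i u) x)
    @[n --> \oo] --> \int[leb]_(x in J)
      (phi x * \sum_i grad (B x) (u x) ord0 i * nabla a b (coord i u) x).
Proof.
have [K K0 phiK] := continuous_bounded_itv al be cphi.
have mI : measurable (I : set (measurableTypeR R)) by exact: measurable_itv.
have mJ : measurable (J : set (measurableTypeR R)) by exact: measurable_itv.
have JI : J `<=` I := sub_JI aal beb.
have inab i : leb.-integrable J (EFin \o nabla a b (coord i u)).
  exact: (integrableS mI mJ JI (integrable_nabla ab (hu i))).
have ilin n k : leb.-integrable J
    (EFin \o (fun x => \sum_i slope n k i * nabla a b (coord i u) x)).
  exact: (integrable_lincomb mJ).
pose g x := K * \sum_(i < d.+1) D * `|nabla a b (coord i u) x|.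
have ig : leb.-integrable J (EFin \o g).
  have ia i : leb.-integrable J (EFin \o (fun x => `|nabla a b (coord i u) x|)).
    exact: (integrable_abse (inab i)).
  exact: (@integrableZl _ _ _ leb J mJ K _ (integrable_lincomb mJ (fun=> D) ia)).
pose F n k x := phi (t n k) * \sum_i slope n k i * nabla a b (coord i u) x.
have mF n k : (k < n.+1)%N -> measurable_fun J (F n k : measurableTypeR R -> R).
  move=> _; apply: measurable_funM; first exact: measurable_cst.
  by apply/measurable_EFinP; exact: measurable_int (ilin n k).
have Fg x n k : (k < n.+1)%N -> `|F n k x| <= g x.
  move=> kn; rewrite normrM; apply: ler_pM; [exact: normr_ge0|exact: normr_ge0| |].
    by apply: phiK; apply: grid_bounds => //; exact: ltnW.
  apply: (le_trans (ler_norm_sum _ _ _)); apply: ler_sum => i _.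
  by rewrite normrM ler_wpM2r//; exact: slope_bound.
have cF : \forall x \ae leb, J x -> step n (F n) x @[n --> \oo] -->
    phi x * \sum_i grad (B x) (u x) ord0 i * nabla a b (coord i u) x.
  apply: (ae_imp (leb_off_countable countable_C)) => x nC Jx.
  apply: (step_cvgM alb) => //; first exact: step_continuous_cvg.
  apply: (step_cvg_sum alb) => // i; apply: (step_cvgM alb) => //.
    exact: slope_cvg.
  by apply: step_cvg => // e e0; exists 1 => // n k _ _ _ _ _; rewrite subrr normr0 ltW.
have bF : \forall x \ae leb, J x -> forall n k, (k < n.+1)%N -> cell n k x -> `|F n k x| <= g x.
  by apply: (ae_imp (leb_off_countable countable_C)) => x _ _ n k kn _; exact: Fg.
have [ai c] := step_dominated_cvg alb mF ig bF cF.
split => //; apply: cvg_trans c; apply: near_eq_cvg; apply: nearW => n.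
apply: eq_bigr => k _; rewrite RintegralZl//; first exact: measurable_cell.
apply: (integrableS mJ _ _ (ilin n k)); first exact: measurable_cell.
by apply: sub_cell.
Qed.

Lemma cantor_gradient_term_cvg i :
  ae_integrable (tvar (Dcantor a b (coord i u))) J
    (fun x => phi x * grad (B x) (u x) ord0 i) /\
  \sum_(k < n.+1) phi (t n k) * slope n k i * fine (Dcantor a b (coord i u) (cell n k))
    @[n --> \oo] --> cintegral (Dcantor a b (coord i u)) J
      (fun x => phi x * grad (B x) (u x) ord0 i).
Proof.
have [K K0 phiK] := continuous_bounded_itv al be cphi.
have bnd n k : (k < n.+1)%N -> `|phi (t n k) * slope n k i| <= K * D.
  move=> kn; rewrite normrM; apply: ler_pM => //; last exact: slope_bound.
  by apply: phiK; apply: grid_bounds => //; exact: ltnW.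
apply: (charge_step_cvg alb bnd).
have na := no_atoms_tvar (Dcantor_no_atoms ab (hu i)).
apply: (ae_imp (ae_off_countable countable_C (fun x _ => na x))) => x nC Jx.
by apply: (step_cvgM alb) => //; [exact: step_continuous_cvg|exact: slope_cvg].
Qed.

(** The majorant consists of the masses at [x] of the measures that bound the atoms
of [D_xB] and [Du]; it is summable as these measures are finite. *)
Lemma jump_term_cvg :
  count.-integrable (J `&` C) (EFin \o (fun x =>
    phi x * (rrep a b (B^~ (ru x)) x - lrep a b (B^~ (lu x)) x))) /\
  \sum_(k < n.+1) phi (t n k) *
      \int[count]_(x in cell n k `&` C) (fine (beta (ru (t n k.+1)) [set x])
        + \sum_i slope n k i * fine (nu i [set x]))
    @[n --> \oo] --> \int[count]_(x in J `&` C)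
      (phi x * (rrep a b (B^~ (ru x)) x - lrep a b (B^~ (lu x)) x)).
Proof.
have [K K0 phiK] := continuous_bounded_itv al be cphi.
have cE := countable_cell_C J.
have mE : measurable (J `&` C : set (measurableTypeR R)) by exact: countable_measurable_real.
pose g x := K * ((`|fine (beta 0 [set x])| + d.+1%:R * r * fine (mu [set x]))
  + \sum_(i < d.+1) D * `|fine (nu i [set x])|).
have iab (n' : signedR R) : count.-integrable (J `&` C) (EFin \o (fun x => `|fine (n' [set x])|)).
  exact: (integrable_abse (integrable_counting_charge n' cE)).
have ig : count.-integrable (J `&` C) (EFin \o g).
  have i1 := @integrableZl _ _ _ count _ mE (d.+1%:R * r) _ (integrable_counting_finite mu cE).
  have i2 := @integrableD _ _ _ count _ mE _ _ (iab (beta 0)) i1.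
  have i3 := integrable_lincomb mE (fun=> D) (fun i => iab (nu i)).
  exact: (@integrableZl _ _ _ count _ mE K _ (@integrableD _ _ _ count _ mE _ _ i2 i3)).
have beta_le n k x : J x -> `|fine (beta (ru (t n k.+1)) [set x])| <=
    `|fine (beta 0 [set x])| + d.+1%:R * r * fine (mu [set x]).
  move=> Jx; set w := ru _; have wr : `|w| <= r by exact: ru_r.
  have wr1 : `|w| <= r + 1 by rewrite (le_trans wr)// lerDl.
  have z1 : `|0 : W| <= r + 1 by rewrite normr0 addr_ge0.
  have xI : [set x] `<=` I by move=> y ->; exact: (sub_JI aal beb).
  rewrite -[fine (beta w _)](subrK (fine (beta 0 [set x]))) addrC.
  rewrite (le_trans (ler_normD _ _))// lerD2l.
  apply: (le_trans (beta_lipschitz wr1 z1 (measurable_set1 x) xI)).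
  by rewrite subr0 ler_wpM2r ?fine_ge0// ler_wpM2l.
have EJ : J `&` C `<=` J by exact: subIsetl.
pose F n k x := phi (t n k) * (fine (beta (ru (t n k.+1)) [set x])
  + \sum_i slope n k i * fine (nu i [set x])).
have mF n k : (k < n.+1)%N ->
    measurable_fun (J `&` C : set (measurableTypeR R)) (F n k : measurableTypeR R -> R).
  by move=> _; apply: measurable_fun_countable.
have Fg x n k : J x -> (k < n.+1)%N -> `|F n k x| <= g x.
  move=> Jx kn; rewrite normrM; apply: ler_pM; [exact: normr_ge0|exact: normr_ge0| |].
    by apply: phiK; apply: grid_bounds => //; exact: ltnW.
  apply: (le_trans (ler_normD _ _)); apply: lerD; first exact: beta_le.
  apply: (le_trans (ler_norm_sum _ _ _)); apply: ler_sum => i _.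
  by rewrite normrM ler_wpM2r//; exact: slope_bound.
have cF x : J x -> step n (F n) x @[n --> \oo] -->
    phi x * (rrep a b (B^~ (ru x)) x - lrep a b (B^~ (lu x)) x).
  move=> Jx; apply: (step_cvgM alb) => //; first exact: step_continuous_cvg.
  exact: (jump_cvg Jx).
have [ai c] := step_dominated_cvg_on alb mE EJ mF ig
  (aeW _ (fun x Ex n k kn _ => Fg x n k (EJ _ Ex) kn)) (aeW _ (fun x Ex => @cF x (EJ _ Ex))).
split.
  have [f [if_ /ae_counting fE]] := ai.
  by apply: eq_integrable if_ => // x /set_mem Ex /=; rewrite fE.
apply: cvg_trans c; apply: near_eq_cvg; apply: nearW => n.
apply: eq_bigr => k _; rewrite setIA (setIidl (sub_cell alb (ltn_ord k))).
have cA := countable_cell_C (cell n k).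
have mA : measurable (cell n k `&` C : set (measurableTypeR R)) by exact: countable_measurable_real.
rewrite RintegralZl//.
have i1 := integrable_counting_charge (beta (ru (t n k.+1))) cA.
have i2 := integrable_lincomb mA (fun i => slope n k i)
  (fun i => integrable_counting_charge (nu i) cA).
exact: (@integrableD _ _ _ count _ mA _ _ i1 i2).
Qed.

(** [composite] equals a constant plus a distribution function on the interval, and
that function is continuous off the countably many atoms. *)
Lemma composite_term_cvg :
  \sum_(k < n.+1) phi (t n k) *
     (composite (t n k.+1) - composite (t n k))
    @[n --> \oo] --> - \int[leb]_(x in J) (derive1 phi x * B x (u x)).
Proof.
have [m [_ hm]] := composite_charge.
have [c hc] := increments_cdf ab hm.
have JI := sub_JI aal beb.
rewrite (@eq_Rintegral_ae _ _ _ _ (fun x => derive1 phi x * (c + cdf m x))); last first.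
  apply: (ae_imp (leb_off_countable countable_C)) => x nC Jx.
  rewrite (compositeE) ?hc//; exact: JI.
have bF x : al <= x <= be -> `|c + cdf m x| <= `|c| + fine (tvar m setT).
  by move=> _; rewrite (le_trans (ler_normD _ _))// lerD2l cdf_bounded.
have cF : \forall x \ae leb, J x -> {for x, continuous (fun x => c + cdf m x)}.
  apply: (ae_imp (leb_off_countable (countable_charge_atoms m))) => x /= /negP/negPn/eqP h _.
  by apply: cvgD; [exact: cvg_cst|exact: cdf_continuous].
apply: cvg_trans (Riemann_Stieltjes_cvg alb dphi cdphi phi_al phi_be bF cF).
apply: near_eq_cvg; apply: nearW => n; apply: eq_bigr => k _.
have [I1 _] := grid_regular (ltn_ord k : (k.+1 <= n.+1)%N).
have [I0 _] := grid_regular (ltnW (ltn_ord k)).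
by rewrite !hc.
Qed.

Lemma chain_rule_between :
  [/\ ae_integrable leb J (fun x => phi x * nablaB x (u x)),
      ae_integrable lambda J (fun x => phi x * psi x (u x)),
      ae_integrable leb J (fun x =>
        phi x * \sum_i grad (B x) (u x) ord0 i * nabla a b (coord i u) x),
      forall i, ae_integrable (tvar (Dcantor a b (coord i u))) J
        (fun x => phi x * grad (B x) (u x) ord0 i) &
      count.-integrable (J `&` C) (EFin \o (fun x =>
        phi x * (rrep a b (B^~ (ru x)) x - lrep a b (B^~ (lu x)) x)))] /\
  \int[leb]_(x in J) (derive1 phi x * B x (u x)) =
    - (\int[leb]_(x in J) (phi x * nablaB x (u x)))
    - (\int[lambda]_(x in J) (phi x * psi x (u x)))
    - (\int[leb]_(x in J)
        (phi x * \sum_i grad (B x) (u x) ord0 i * nabla a b (coord i u) x))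
    - (\sum_i cintegral (Dcantor a b (coord i u)) J (fun x => phi x * grad (B x) (u x) ord0 i))
    - (\int[count]_(x in J `&` C)
        (phi x * (rrep a b (B^~ (ru x)) x - lrep a b (B^~ (lu x)) x))).
Proof.
have [i1 c1] := lebesgue_term_cvg; have [i2 c2] := cantor_term_cvg.
have [i3 c3] := gradient_term_cvg; have [i5 c5] := jump_term_cvg.
have i4 i := (cantor_gradient_term_cvg i).1.
split; first by split.
have c4 : \sum_i \sum_(k < n.+1) phi (t n k) * slope n k i *
      fine (Dcantor a b (coord i u) (cell n k)) @[n --> \oo] -->
    \sum_i cintegral (Dcantor a b (coord i u)) J (fun x => phi x * grad (B x) (u x) ord0 i).
  elim: (index_enum _) => [|j s IH].
    by rewrite big_nil; under eq_fun do rewrite big_nil; exact: cvg_cst.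
  rewrite big_cons; under eq_fun do rewrite big_cons.
  by apply: cvgD IH; have [_] := cantor_gradient_term_cvg j.
pose proof (cvgD (cvgD (cvgD (cvgD c1 c2) c3) c4) c5) as c.
set S := (X in _ --> X) in c.
have cS : \sum_(k < n.+1) phi (t n k) *
     (composite (t n k.+1) - composite (t n k)) @[n --> \oo] --> S.
  apply: cvg_trans c; apply: near_eq_cvg; apply: nearW => n /=.
  rewrite !fctE/= exchange_big/= -!big_split/=; apply: eq_bigr => k _.
  rewrite composite_cell_split//.
  rewrite (eq_bigr (fun i => phi (t n k) *
    (slope n k i * fine (Dcantor a b (coord i u) (cell n k))))).
    by rewrite -mulr_sumr; ring.
  by move=> i _; rewrite mulrA.
by rewrite -[LHS]opprK (cvg_eq composite_term_cvg cS) /S; ring.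
Qed.

End ChainRule.

(** * The chain rule on the interval *)

(** First choose [al] off [C].  A grid point with [k > 0] determines [be] when [al],
[n] and [k] are given, so only countably many [be] are excluded. *)
Lemma grid_off_countable (R : realType) (C : set R) (a al0 be0 b : R) : countable C ->
  a < al0 -> al0 < be0 -> be0 < b ->
  exists al be, [/\ a < al < al0, be0 < be < b &
    forall n k, (k <= n.+1)%N -> ~ C (grid al be n k)].
Proof.
move=> cC h1 h2 h3; have [al /andP[aal ala0] nCal] := ex_off_countable cC h1.
pose back n k (c : R) : R := al + (c - al) * n.+1%:R / k.+1%:R.
have cBad : countable (\bigcup_n \bigcup_k (back n k @` C)).
  apply: bigcup_countable => // n _; apply: bigcup_countable => // k _.
  exact: card_le_trans (card_image_le _ _) cC.
have [be /andP[be0be beb] nBad] := ex_off_countable cBad h3.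
exists al, be; split; [by rewrite aal|by rewrite be0be|] => n [_|k kn] Ct.
  by apply: nCal; rewrite grid0 in Ct.
apply: nBad; exists n => //; exists k => //; exists (grid al be n k.+1) => //.
have kz : (k.+1%:R : R) != 0 by rewrite pnatr_eq0.
have nz : (n.+1%:R : R) != 0 by rewrite pnatr_eq0.
rewrite /back /grid; move: kz nz; move: (k.+1%:R : R) (n.+1%:R : R) => p q p0 q0.
by field; rewrite p0 q0.
Qed.

Lemma integrable_ae_counting (R : realType) (D : set (measurableTypeR R)) (f : R -> R) :
  measurable D ->
  ae_integrable (@counting (measurableTypeR R) R) D f ->
  (@counting (measurableTypeR R) R).-integrable D (EFin \o f).
Proof.
move=> mD [g [ig /ae_counting fg]].
by apply: eq_integrable ig => // x /set_mem Dx /=; rewrite fg.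
Qed.

Theorem theorem4p1 (R : realType) (a b : R) (d : nat)
  (B : R -> 'rV[R]_d.+1 -> R) (N : set R)
  (lambda : {finite_measure set (measurableTypeR R) -> \bar R})
  (I := `]a, b[%classic : set R)
  (hab : a < b)
  (hB : forall (x : R) (w : 'rV[R]_d.+1), I x ->
     bounded_near (fun p : R * 'rV[R]_d.+1 => B p.1 p.2) (nbhs (x, w)))
  (A1 : [/\ countable N, N `<=` I &
        forall w, [/\ BV a b (B^~ w), good_repr a b (B^~ w) &
                      jump_set a b (B^~ w) `<=` N]])
  (A2 : forall M : set 'rV[R]_d.+1, compact M ->
     exists mu : {finite_measure set (measurableTypeR R) -> \bar R},
     forall w w' : 'rV[R]_d.+1, M w -> M w' ->
     forall A : set (measurableTypeR R), measurable A -> A `<=` I ->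
       (tvar (cadd (Dist a b (B^~ w)) (copp (Dist a b (B^~ w')))) A
          <= (enorm (w - w'))%:E * mu A)%E)
  (A3 : (forall x, (I `\` N) x -> C1 (B x)) /\
        forall M : set 'rV[R]_d.+1, compact M ->
        exists2 D : R, 0 < D &
        forall x w, (I `\` N) x -> M w -> enorm (grad (B x) w) <= D)
  (A4 : forall w, BVv a b (fun x => grad (B x) w))
  (A5 : cantor_measure a b lambda /\
        forall w, Dcantor a b (B^~ w) `<< lambda)
  (u : R -> 'rV[R]_d.+1) (hu : BVv a b u) (hu_good : good_reprv a b u) :
  let v := fun x => B x (u x) in
  BV a b v /\
  forall (nablaB psi : R -> 'rV[R]_d.+1 -> R)
    (hnablaB : forall w, nablaB^~ w = nabla a b (B^~ w) %[ae leb in I])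
    (hnablaB_cont : \forall x \ae leb, I x -> continuous (nablaB x))
    (hpsi : forall w, EFin \o psi^~ w
              = Radon_Nikodym (Dcantor a b (B^~ w)) lambda %[ae lambda in I])
    (hpsi_cont : \forall x \ae lambda, I x -> continuous (psi x))
    (phi : R -> R) (hphi : C01 a b phi),
  let f1 := fun x => phi x * nablaB x (u x) in
  let f2 := fun x => phi x * psi x (u x) in
  let f3 := fun x =>
    phi x * \sum_i grad (B x) (u x) ord0 i * nabla a b (coord i u) x in
  let f4 := fun i x => phi x * grad (B x) (u x) ord0 i in
  let f5 := fun x => phi x * (rlim (B^~ (rlimv u x)) x
                              - llim (B^~ (llimv u x)) x) in
  [/\ ae_integrable leb I f1,
      ae_integrable lambda I f2,
      ae_integrable leb I f3,
      forall i, ae_integrable (tvar (Dcantor a b (coord i u))) I (f4 i) &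
      rsummable (N `|` jump_setv a b u) f5] /\
  \int[leb]_(x in I) (derive1 phi x * v x) =
    - (\int[leb]_(x in I) f1 x)
    - (\int[lambda]_(x in I) f2 x)
    - (\int[leb]_(x in I) f3 x)
    - (\sum_i cintegral (Dcantor a b (coord i u)) I (f4 i))
    - rsum (N `|` jump_setv a b u) f5.
Proof.
(* the hypotheses on a ball that contains the values of u with a margin of 1 *)
move=> v.
have [cN NI hBw] := A1.
have BVB w : BV a b (B^~ w) by have [] := hBw w.
have goodB w : good_repr a b (B^~ w) by have [] := hBw w.
have jumpB w : jump_set a b (B^~ w) `<=` N by have [] := hBw w.
have [C1B hD] := A3; have [lambda_cantor lambda_dom] := A5.
have [r r0 hr] := rrepv_bounded a b u.
have ru_r x : `|rrepv a b u x| <= r by have [] := hr x.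
have lu_r x : `|lrepv a b u x| <= r by have [] := hr x.
have [mu hmu] := A2 _ (@compact_closed_ball0 R d (r + 1)).
have [D D0 hgrad] := hD _ (@compact_closed_ball0 R d (r + 1)).
have grad_bound x w i : (I `\` N) x -> `|w| <= r + 1 -> `|grad (B x) w ord0 i| <= D.
  by move=> INx wr; apply: (le_trans (coord_le_enorm _ i)); exact: hgrad.
have beta_lipschitz (w w' : 'rV[R]_d.+1) : `|w| <= r + 1 -> `|w'| <= r + 1 ->
    forall A : set (measurableTypeR R), measurable A -> A `<=` I ->
    `|fine (Dist a b (B^~ w) A) - fine (Dist a b (B^~ w') A)|
      <= d.+1%:R * `|w - w'| * fine (mu A).
  move=> wr w'r A mA AI.
  pose nn := cadd (Dist a b (B^~ w)) (copp (Dist a b (B^~ w'))).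
  have -> : fine (Dist a b (B^~ w) A) - fine (Dist a b (B^~ w') A) = fine (nn A).
    rewrite -[RHS]/(fine (Dist a b (B^~ w) A - Dist a b (B^~ w') A)%E).
    by rewrite fineD ?fin_numN ?fin_num_measure// fineN.
  apply: (le_trans (charge_le_tvar nn mA)).
  apply: (@le_trans _ _ (enorm (w - w') * fine (mu A))).
    rewrite -lee_fin EFinM !fineK ?tvar_fin ?fin_num_measure//.
    exact: hmu.
  by rewrite ler_wpM2r ?fine_ge0// enorm_le.
have D0' := ltW D0.
split.
  exact: (BV_composite hab cN BVB goodB jumpB C1B r0 D0' beta_lipschitz grad_bound hu hu_good ru_r).
move=> nablaB psi hnablaB hnablaB_cont hpsi hpsi_cont phi hphi f1 f2 f3 f4 f5.
pose C := N `|` jump_setv a b u.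
have cC : countable C := countable_C hab cN hu.
(* a grid that avoids the jumps, and mean value points on its cells *)
have [dphi cdphi _ _] := hphi; have cphi := C01_continuous hphi.
have [al0 [be0 [h1 h2 h3 supp]]] := C01_support hab hphi.
have [al [be [/andP[aal ala0] /andP[be0be beb] grid_off]]] := grid_off_countable cC h1 h2 h3.
have alb : al < be by apply: (lt_trans ala0); exact: (lt_trans h2).
pose t := grid al be; pose ru := rrepv a b u.
have /choice[sg hsg] : forall p : nat * nat, exists s : R, 0 <= s <= 1 /\
    ((p.2 < p.1.+1)%N -> B (t p.1 p.2) (ru (t p.1 p.2.+1)) - B (t p.1 p.2) (ru (t p.1 p.2)) =
    \sum_i grad (B (t p.1 p.2)) (ru (t p.1 p.2) +
      s *: (ru (t p.1 p.2.+1) - ru (t p.1 p.2))) ord0 i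
      * (ru (t p.1 p.2.+1) - ru (t p.1 p.2)) ord0 i).
  move=> [n k] /=; have [kn|kn] := ltnP k n.+1; last by exists 0; rewrite lexx ler01.
  have reg := grid_regular aal alb beb grid_off (ltnW kn).
  have [dB _] := C1B _ reg.
  by have [s [s01 e]] := MVT_row (ru (t n k)) (ru (t n k.+1)) dB; exists s.
pose sgn n k := sg (n, k).
have sg01 n k : 0 <= sgn n k <= 1 by have [] := hsg (n, k).
have mv n k : (k < n.+1)%N -> B (t n k) (ru (t n k.+1)) - B (t n k) (ru (t n k)) =
    \sum_i grad (B (t n k)) (ru (t n k) + sgn n k *: (ru (t n k.+1) - ru (t n k))) ord0 i
      * (ru (t n k.+1) - ru (t n k)) ord0 i.
  by move=> kn; have [_ h] := hsg (n, k); exact: h.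
have [phi_al phi_be] : phi al = 0 /\ phi be = 0.
  by split; apply: supp => /andP[]; [rewrite leNgt ala0|move=> _; rewrite leNgt be0be].
have mI : measurable (I : set (measurableTypeR R)) by exact: measurable_itv.
pose J : set R := `]al, be]%classic.
have mJ : measurable (J : set (measurableTypeR R)) by exact: measurable_itv.
have JI : J `<=` I by exact: (sub_JI aal beb).
have off x : I x -> ~ J x -> ~ al0 <= x <= be0.
  move=> _ nJ /andP[x1 x2]; apply: nJ; rewrite /J/= in_itv/=.
  by rewrite (lt_le_trans ala0 x1) (le_trans x2)// ltW.
have phi0 x : I x -> ~ J x -> phi x = 0 by move=> Ix nJ; apply/supp/off.
have [[i1 i2 i3 i4 i5] key] := chain_rule_between hab cN BVB goodB jumpB C1B r0 D0' beta_lipschitz grad_bound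
  lambda_cantor lambda_dom hu hu_good ru_r lu_r aal alb beb grid_off sg01 mv
  hnablaB hnablaB_cont hpsi hpsi_cont dphi cdphi cphi phi_al phi_be.
(* everything vanishes off ]al, be], so the integrals over I are those over J *)
have CI : C `<=` I by move=> x [/NI|[]].
have f5E x : I x ->
    phi x * (rrep a b (B^~ (rrepv a b u x)) x - lrep a b (B^~ (lrepv a b u x)) x) = f5 x.
  move=> Ix; rewrite -(rlimv_rrepv hab hu Ix) -(llimv_lrepv hab hu Ix).
  have [hR _ _] := rrep_limits hab (BVB (rlimv u x)).
  have [_ hL _] := rrep_limits hab (BVB (llimv u x)).
  by rewrite -(hR x Ix) -(hL x Ix).
have mC : measurable (C : set (measurableTypeR R)) by exact: countable_measurable_real.
have mJC : measurable (J `&` C : set (measurableTypeR R)) by exact: measurableI.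
have zero5 x : C x -> ~ (J `&` C) x -> f5 x = 0.
  move=> Cx nJC; rewrite /f5 phi0 ?mul0r//; first exact: CI.
  by move=> Jx; apply: nJC.
have s5 : rsummable C f5.
  apply/(integrable_counting f5 cC); apply: (integrable_ae_counting mC).
  apply: (ae_integrable_support mC mJC (@subIsetr _ _ _) zero5).
  exists f5; split; last by apply: aeW.
  by apply: eq_integrable i5 => // x /set_mem[Jx _] /=; rewrite f5E//; exact: JI.
split.
  split.
  - by apply: (ae_integrable_support mI mJ JI _ i1) => x Ix nJ; rewrite phi0 ?mul0r.
  - by apply: (ae_integrable_support mI mJ JI _ i2) => x Ix nJ; rewrite phi0 ?mul0r.
  - by apply: (ae_integrable_support mI mJ JI _ i3) => x Ix nJ; rewrite phi0 ?mul0r.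
  - by move=> i; apply: (ae_integrable_support mI mJ JI _ (i4 i)) => x Ix nJ; rewrite phi0 ?mul0r.
  - exact: s5.
rewrite (Rintegral_support _ JI) => [|x Ix nJ]; last first.
  by rewrite (derive1_support supp (off x Ix nJ)) mul0r.
have cong5 (p p' q q' s s' w w' z z' : R) : p = p' -> q = q' -> s = s' -> w = w' -> z = z' ->
    - p - q - s - w - z = - p' - q' - s' - w' - z' by move=> -> -> -> -> ->.
apply: (etrans key); apply: cong5.
- by apply/esym/Rintegral_support => // x Ix nJ; rewrite /f1 phi0 ?mul0r.
- by apply/esym/Rintegral_support => // x Ix nJ; rewrite /f2 phi0 ?mul0r.
- by apply/esym/Rintegral_support => // x Ix nJ; rewrite /f3 phi0 ?mul0r.
- apply: eq_bigr => i _; apply/esym/cintegral_support => // x Ix nJ.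
  by rewrite /f4 phi0 ?mul0r.
- rewrite -(Rintegral_counting cC s5) (Rintegral_support _ (@subIsetr _ J C) zero5).
  by apply: eq_Rintegral => x /set_mem[Jx _]; rewrite f5E//; exact: JI.
Qed.
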